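(* Let $P$ be a monic polynomial of degree $n\ge2$ and let $\mathfrak{I}_j=(T_{j-1},T_j)$, $1\le j\le\nu$, be a regular interval of $P$. Then there is a non-decreasing function $\sigma^{P,\mathfrak{I}_j}:\mathbb{R}\to\mathbb{R}$ such that $$|E_P(t)|=\int_{-\infty}^{+\infty}e^{xt}\,d\sigma^{P,\mathfrak{I}_j}(x),\qquad t\in\mathfrak{I}_j .$$ In particular, $\ln|E_P(t)|$ is a convex function on $\mathfrak{I}_j$.
   Context: For a polynomial $P$ and real $t$, $E_P(t)=\{z\in\mathbb{C}:\ln|P(z)|=t\}$ and $|E_P(t)|$ denotes its length. Let $T_1<\ldots<T_{\nu-1}$ be the set of all finite critical values of $\ln|P|$, i.e. the distinct numbers $\ln|P(\zeta)|$ with $P'(\zeta)=0$, $P(\zeta)\ne0$, and put $T_0=-\infty$, $T_\nu=+\infty$. The intervals $\mathfrak{I}_j=(T_{j-1},T_j)$, $1\le j\le\nu$, are called regular with respect to $P$. The integral is a Stieltjes integral. *)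

(* Defs.v *)
From HB Require Import structures.
From mathcomp Require Import all_boot all_order all_algebra.
From mathcomp Require Export complex.
From mathcomp Require Import all_classical all_reals all_analysis.

Set Implicit Arguments.
Unset Strict Implicit.
Unset Printing Implicit Defensive.

Import Order.TTheory GRing.Theory Num.Theory.
Import numFieldNormedType.Exports.

Local Open Scope classical_set_scope.
Local Open Scope ring_scope.

(* [normc] is the R-valued modulus; `|z| on R[i] has values in R[i]. *)
Local Notation normc := ComplexField.Normc.normc.

Section PlaneLength.
Context {R : realType}.
Implicit Types A : set R[i].

(* 0 is adjoined because the supremum of the empty set is -oo in \bar R. *)
Definition diameter A : \bar R :=
  ereal_sup ([set (normc (z - w))%:E | z in A & w in A] `|` [set 0%E]).

Definition hausdorff1_pre (d : R) A : \bar R :=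
  ereal_inf [set (\sum_(0 <= k <oo) diameter (U k))%E | U in
    [set U : (set R[i])^nat |
      A `<=` \bigcup_k U k /\ forall k, (diameter (U k) <= d%:E)%E]].

(* One-dimensional Hausdorff measure; on a finite union of rectifiable Jordan
   arcs or curves with finite pairwise intersections it is the total length. *)
Definition plane_length A : \bar R :=
  ereal_sup [set hausdorff1_pre d A | d in [set d : R | 0 < d]].

End PlaneLength.

Section LogLevel.
Context {R : realType}.
Variable P : {poly R[i]}.

(* [ln 0 = 0] here, whereas ln|P(z)| = -oo at a zero z of P: zeros of P lie on
   no finite level and must be excluded explicitly. *)
Definition log_level (t : R) : set R[i] :=
  [set z | P.[z] != 0 /\ ln (normc P.[z]) = t].

Definition critical_values : set R :=
  [set ln (normc P.[z]) | z in [set z | P^`().[z] = 0 /\ P.[z] != 0]].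

(* -oo = T 0 < T 1 < ... < T nu = +oo, the finite terms being exactly the
   critical values; the values of T beyond nu are irrelevant. *)
Definition critical_enumeration (nu : nat) (T : nat -> \bar R) : Prop :=
  [/\ T 0%N = -oo%E, T nu = +oo%E,
      forall i j : nat, (i < j <= nu)%N -> (T i < T j)%E &
      [set T i | i in [set i : nat | (0 < i < nu)%N]] =
      EFin @` critical_values].

End LogLevel.

Definition regular_interval {R : realType} (T : nat -> \bar R) (j : nat) :
    set R :=
  [set t | (T j.-1 < t%:E < T j)%E].

(* The Stieltjes measure of an arbitrary non-decreasing function is that of its
   right-continuous regularization. The monotonicity proof is an argument of
   [right_limit] so that the cumulative structure can be inferred. *)
Section Stieltjes.
Context {R : realType}.
Variable s : R -> R.

Definition right_limit (hs : {homo s : x y / x <= y}) (x : R) : R :=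
  lim (s y @[y --> x^'+]).

Variable hs : {homo s : x y / x <= y}.

Let lb x : has_lbound (s @` `]x, +oo[).
Proof.
exists (s x) => _ [y /= xy <-]; apply: hs.
by move: xy; rewrite in_itv/= andbT => /ltW.
Qed.

Let right_limitE x : right_limit hs x = inf (s @` `]x, +oo[).
Proof.
apply/cvg_lim => //; apply: nondecreasing_at_right_cvgr => //.
by move=> a b _ _; exact: hs.
Qed.

Let right_limit_le x y : x < y -> right_limit hs x <= s y.
Proof.
move=> xy; rewrite right_limitE; apply: ge_inf; first exact: lb.
by exists y => //=; rewrite in_itv/= xy.
Qed.

Let le_right_limit x : s x <= right_limit hs x.
Proof.
rewrite right_limitE; apply: lb_le_inf.
  by exists (s (x + 1)), (x + 1) => //=; rewrite in_itv/= ltrDl ltr01.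
move=> _ [y /= xy <-]; apply: hs.
by move: xy; rewrite in_itv/= andbT => /ltW.
Qed.

Let right_limit_nd : nondecreasing (right_limit hs).
Proof.
move=> x y; rewrite le_eqVlt => /predU1P[->//|xy].
exact: le_trans (right_limit_le xy) (le_right_limit y).
Qed.

Let right_limit_rc : right_continuous (right_limit hs).
Proof.
move=> x; apply/cvgrPdist_lt => e e0.
have [] := @inf_adherent _ (s @` `]x, +oo[) e e0.
  split; last exact: lb.
  by exists (s (x + 1)), (x + 1) => //=; rewrite in_itv/= ltrDl ltr01.
move=> _ [z /= + <-]; rewrite in_itv/= andbT -right_limitE => xz sz.
near=> y; have xy : x < y by near: y; exact: nbhs_right_gt.
have yz : y < z by near: y; exact: nbhs_right_lt.
rewrite distrC ger0_norm ?subr_ge0; last exact/right_limit_nd/ltW.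
by rewrite ltrBlDl (le_lt_trans (right_limit_le yz)).
Unshelve. all: by end_near. Qed.

HB.instance Definition _ :=
  isCumulative.Build R _ R (right_limit hs) right_limit_nd right_limit_rc.

Definition stieltjes_integral (f : R -> R) : \bar R :=
  (\int[lebesgue_stieltjes_measure (right_limit hs)]_(x in setT) (f x)%:E)%E.

End Stieltjes.

(* Main.v *)
Require Import Defs.
From mathcomp Require Import all_boot all_order all_algebra complex.
From mathcomp Require Import fingroup perm cyclic.
From mathcomp Require Import all_classical all_reals all_analysis.
From mathcomp Require Import measurable_realfun.
From mathcomp Require Import ring lra zify.

Set Implicit Arguments.
Unset Strict Implicit.
Unset Printing Implicit Defensive.

Import Order.TTheory GRing.Theory Num.Theory.
Import numFieldNormedType.Exports.
Import ComplexField.Normc.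

Local Open Scope classical_set_scope.
Local Open Scope ring_scope.
Local Open Scope complex_scope.

Local Notation Re := complex.Re.
Local Notation Im := complex.Im.
Local Notation normc0 := ComplexField.Normc.normc0.
Local Notation normc1 := ComplexField.Normc.normc1.

(** Put [w = ln P(z)], that is, [P(z) = exp w]. Over a vertical strip
    [{w | Re w in I}], where [I] is a regular interval, [P] has no critical
    points, so the equation is solved by finitely many holomorphic branches
    [z = Z_k(w)] on the whole strip (lemma [branches_exist]); the turn
    [w -> w + 2 i pi] permutes them. Since [Z_k'] does not vanish and the strip
    is simply connected, [Z_k' = q_k^2] with [q_k] holomorphic and periodic, of
    period [2 i pi Q] for some [Q]. The level [ln |P| = t] is the disjoint union
    of the arcs [Z_k(t + i th)], [0 <= th < 2 pi], so its length is the sum over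
    [k] of the integrals of [|q_k(t + i th)|^2 d th]. By Parseval's identity over
    a period this is a series [sum_m s_m exp(2 m t / Q)] with [s_m >= 0], because
    the [m]-th Fourier coefficient of [q_k] on the line [Re w = t] is a constant
    times [exp(m t / Q)]. A step function with jumps [s_m] at the points [2 m / Q]
    is the required [sigma], and a sum of exponentials with nonnegative
    coefficients is logarithmically convex.

    The analysis is carried out with finite sums and explicit error terms.
    Holomorphy is replaced by a uniform second order Taylor estimate
    ([unif_diff]). Branches are continued along segments by small steps: each
    step moves to the nearby root of [P - exp w], which exists because
    [|P(z) - v|] is the product of the distances of [z] to the roots of [P - v]
    ([root_near]), and is unique because the roots are separated
    ([fibre_separated]); the same lemmas applied to [X^2] give [q_k]. Integrals
    over a period are replaced by means over [N] equidistant points. The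
    Cauchy-Riemann equations make such means of a periodic function independent
    of [t] up to [O(1/N)] ([mean_const]), Parseval's identity is that of the
    cyclic group ([dft_parseval]), and the energy of the frequencies above [M]
    is [O(1/M^2)] uniformly in [N] ([dft_tail]), which gives the series in the
    limit ([fourier_coefficients]).

    The Hausdorff measure of the level is compared with the same Riemann sums.
    The arcs of a fine subdivision cover the level and have diameter at most
    speed times step, up to second order ([hausdorff1_pre_curve]). Conversely,
    slightly shortened arcs are at positive distance from each other, so that a
    fine enough cover splits into covers of the single arcs, and covering an arc
    costs at least its chord ([chord_le_cover],
    [riemann_length_le_plane_length]). *)

(** * Moduli of complex numbers *)

Section Modulus.
Context {R : realType}.
Implicit Types x y z : R[i].

Lemma normc_ge0 x : 0 <= normc x.
Proof. by case: x => a b; rewrite sqrtr_ge0. Qed.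

Lemma normcB x y : normc (x - y) <= normc x + normc y.
Proof. by rewrite (le_trans (le_normcD _ _))// normcN. Qed.

Lemma normc_distC x y : normc (x - y) = normc (y - x).
Proof. by rewrite -normcN opprB. Qed.

Lemma normc_dist_le x y : normc x - normc y <= normc (x - y).
Proof. by rewrite lerBlDr (le_trans _ (le_normcD _ _))// subrK. Qed.

Lemma normc_split z x y : normc (x - y) <= normc (x - z) + normc (z - y).
Proof. by rewrite (le_trans _ (le_normcD _ _))// addrA subrK. Qed.

Lemma normc_eq0 x : (normc x == 0) = (x == 0).
Proof.
by apply/eqP/eqP => [/eq0_normc|->]//; rewrite normc0.
Qed.

Lemma normc_gt0 x : (0 < normc x) = (x != 0).
Proof. by rewrite lt_neqAle normc_ge0 andbT eq_sym normc_eq0. Qed.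

Lemma normcM_le x y (a b : R) : normc x <= a -> normc y <= b ->
  normc (x * y) <= a * b.
Proof. by move=> xa yb; rewrite normcM; apply: ler_pM; rewrite ?normc_ge0. Qed.

Lemma normcX x n : normc (x ^+ n) = normc x ^+ n.
Proof.
elim: n => [|n IH]; first by rewrite !expr0 normc1.
by rewrite !exprS normcM IH.
Qed.

Lemma normcR (r : R) : normc r%:C = `|r|.
Proof. by rewrite /= expr0n addr0 sqrtr_sqr. Qed.

Lemma normcRi (r : R) : normc (Complex 0 r) = `|r|.
Proof. by rewrite /= expr0n add0r sqrtr_sqr. Qed.

Lemma normc_sqr x : normc x ^+ 2 = Re x ^+ 2 + Im x ^+ 2.
Proof. by case: x => a b /=; rewrite sqr_sqrtr// addr_ge0 ?sqr_ge0. Qed.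

Lemma Re_le_normc x : `|Re x| <= normc x.
Proof.
case: x => a b /=; rewrite -sqrtr_sqr ler_wsqrtr// lerDl; exact: sqr_ge0.
Qed.

Lemma Im_le_normc x : `|Im x| <= normc x.
Proof.
case: x => a b /=; rewrite -sqrtr_sqr ler_wsqrtr// lerDr; exact: sqr_ge0.
Qed.

Lemma normc_le_ReIm x : normc x <= `|Re x| + `|Im x|.
Proof.
rewrite {1}(complexE x) (le_trans (le_normcD _ _))// normcM normcR.
by rewrite normcRi normr1 mul1r normcR.
Qed.

Lemma ReD x y : Re (x + y) = Re x + Re y. Proof. by case: x y => ? ? []. Qed.
Lemma ImD x y : Im (x + y) = Im x + Im y. Proof. by case: x y => ? ? []. Qed.
Lemma ReN x : Re (- x) = - Re x. Proof. by case: x. Qed.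
Lemma ImN x : Im (- x) = - Im x. Proof. by case: x. Qed.
Lemma ReB x y : Re (x - y) = Re x - Re y. Proof. by rewrite ReD ReN. Qed.
Lemma ImB x y : Im (x - y) = Im x - Im y. Proof. by rewrite ImD ImN. Qed.

Lemma ReRM (r : R) x : Re (r%:C * x) = r * Re x.
Proof. by case: x => a b /=; rewrite mul0r subr0. Qed.

Lemma ImRM (r : R) x : Im (r%:C * x) = r * Im x.
Proof. by case: x => a b /=; rewrite mul0r addr0. Qed.

Lemma normc_sum (I : Type) (s : seq I) (f : I -> R[i]) :
  normc (\sum_(i <- s) f i) <= \sum_(i <- s) normc (f i).
Proof.
elim: s => [|i s IH]; first by rewrite !big_nil normc0.
by rewrite !big_cons (le_trans (le_normcD _ _))// lerD2l.
Qed.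

End Modulus.

(** * Uniform complex differentiability *)

Section UniformDerivative.
Context {R : realType}.
Implicit Types (K : set R[i]) (f g : R[i] -> R[i]).

(** A quantitative substitute for holomorphy on a compact set, with derivative
    [f'], which is stable under the algebraic operations and under solving
    equations, and directly yields the error terms of Riemann sums. *)
Definition unif_diff K f f' := exists2 A : R, 0 <= A &
  forall w w', K w -> K w' ->
  [/\ normc (f w) <= A, normc (f' w) <= A,
      normc (f w' - f w) <= A * normc (w' - w) &
      normc (f w' - f w - f' w * (w' - w)) <= A * normc (w' - w) ^+ 2].

Lemma unif_diff_sub K K' f f' : K `<=` K' ->
  unif_diff K' f f' -> unif_diff K f f'.
Proof. by move=> KK' [A A0 h]; exists A => // w w' /KK' ? /KK' ?; apply: h. Qed.

Lemma eq_unif_diff K f f' g g' :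
  (forall w, K w -> f w = g w) -> (forall w, K w -> f' w = g' w) ->
  unif_diff K f f' -> unif_diff K g g'.
Proof.
move=> fg fg' [A A0 h]; exists A => // w w' Kw Kw'.
by rewrite -!fg// -fg'//; apply: h.
Qed.

Lemma unif_diff_cst K c : unif_diff K (fun=> c) (fun=> 0).
Proof.
exists (normc c); first exact: normc_ge0.
move=> w w' _ _; rewrite subrr mul0r subr0 normc0.
by split; rewrite ?mulr_ge0 ?exprn_ge0 ?normc_ge0.
Qed.

Lemma unif_diff_id K (B : R) : (forall w, K w -> normc w <= B) ->
  unif_diff K id (fun=> 1).
Proof.
move=> KB; exists (`|B| + 1); first by rewrite addr_ge0.
move=> w w' Kw Kw'; rewrite mul1r subrr normc0 normc1.
split.
- by rewrite (le_trans (KB _ Kw))// (le_trans (ler_norm _))// lerDl.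
- by rewrite lerDr.
- by rewrite ler_peMl ?normc_ge0// lerDr.
- by rewrite mulr_ge0 ?addr_ge0 ?exprn_ge0 ?normc_ge0.
Qed.

Lemma unif_diffD K f f' g g' : unif_diff K f f' -> unif_diff K g g' ->
  unif_diff K (fun w => f w + g w) (fun w => f' w + g' w).
Proof.
move=> [A A0 hf] [B B0 hg]; exists (A + B); first exact: addr_ge0.
move=> w w' Kw Kw'; have [f1 f2 f3 f4] := hf _ _ Kw Kw'.
have [g1 g2 g3 g4] := hg _ _ Kw Kw'.
split.
- exact: le_trans (le_normcD _ _) (lerD f1 g1).
- exact: le_trans (le_normcD _ _) (lerD f2 g2).
- have -> : f w' + g w' - (f w + g w) = (f w' - f w) + (g w' - g w) by ring.
  by rewrite mulrDl; exact: le_trans (le_normcD _ _) (lerD f3 g3).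
- have -> : f w' + g w' - (f w + g w) - (f' w + g' w) * (w' - w) =
    (f w' - f w - f' w * (w' - w)) + (g w' - g w - g' w * (w' - w)) by ring.
  by rewrite mulrDl; exact: le_trans (le_normcD _ _) (lerD f4 g4).
Qed.

Lemma unif_diffM K f f' g g' : unif_diff K f f' -> unif_diff K g g' ->
  unif_diff K (fun w => f w * g w) (fun w => f' w * g w + f w * g' w).
Proof.
move=> [A A0 hf] [B B0 hg]; exists (3 * (A * B)); first by rewrite !mulr_ge0.
have AB0 : 0 <= A * B by rewrite mulr_ge0.
move=> w w' Kw Kw'; have [f1 f2 f3 f4] := hf _ _ Kw Kw'.
have [g1 g2 g3 g4] := hg _ _ Kw Kw'.
have [g1' _ _ _] := hg _ _ Kw' Kw.
set d := normc (w' - w) in f3 f4 g3 g4 *.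
have d0 : 0 <= d by exact: normc_ge0.
have pM := @normcM_le R.
split.
- by rewrite (le_trans (pM _ _ _ _ f1 g1))//; lra.
- rewrite (le_trans (le_normcD _ _))//.
  by rewrite (le_trans (lerD (pM _ _ _ _ f2 g1) (pM _ _ _ _ f1 g2)))//; lra.
- have -> : f w' * g w' - f w * g w =
    (f w' - f w) * g w' + f w * (g w' - g w) by ring.
  rewrite (le_trans (le_normcD _ _))//.
  rewrite (le_trans (lerD (pM _ _ _ _ f3 g1') (pM _ _ _ _ f1 g3)))//.
  have : 0 <= A * B * d by rewrite mulr_ge0.
  lra.
- have -> : f w' * g w' - f w * g w - (f' w * g w + f w * g' w) * (w' - w) =
    (f w' - f w - f' w * (w' - w)) * g w' +
    f w * (g w' - g w - g' w * (w' - w)) +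
    f' w * ((g w' - g w) * (w' - w)) by ring.
  rewrite (le_trans (le_normcD _ _))// (le_trans (lerD (le_normcD _ _) (lexx _)))//.
  have g3' : normc ((g w' - g w) * (w' - w)) <= B * d * d by exact: pM.
  rewrite (le_trans (lerD (lerD (pM _ _ _ _ f4 g1') (pM _ _ _ _ f1 g4))
    (pM _ _ _ _ f2 g3')))//.
  by rewrite le_eqVlt; apply/orP; left; apply/eqP; ring.
Qed.

Lemma unif_diff_comp K K' f f' g g' : (forall w, K w -> K' (f w)) ->
  unif_diff K f f' -> unif_diff K' g g' ->
  unif_diff K (fun w => g (f w)) (fun w => g' (f w) * f' w).
Proof.
move=> fK [A A0 hf] [B B0 hg].
exists (B + B * A + B * A ^+ 2); first by rewrite !addr_ge0 ?mulr_ge0 ?exprn_ge0.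
move=> w w' Kw Kw'; have [f1 f2 f3 f4] := hf _ _ Kw Kw'.
have [g1 g2 g3 g4] := hg _ _ (fK _ Kw) (fK _ Kw').
set d := normc (w' - w) in f3 f4 *.
have d0 : 0 <= d by exact: normc_ge0.
have n0 := normc_ge0 (f w' - f w).
have BA : 0 <= B * A by exact: mulr_ge0.
have BAA : 0 <= B * A ^+ 2 by rewrite mulr_ge0 ?exprn_ge0.
split.
- by lra.
- rewrite normcM (le_trans (ler_pM _ _ g2 f2)) ?normc_ge0//; lra.
- rewrite (le_trans g3)// (le_trans (ler_wpM2l B0 f3))// mulrA ler_wpM2r//; lra.
- have -> : g (f w') - g (f w) - g' (f w) * f' w * (w' - w) =
    (g (f w') - g (f w) - g' (f w) * (f w' - f w)) +
    g' (f w) * (f w' - f w - f' w * (w' - w)) by ring.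
  rewrite (le_trans (le_normcD _ _))// normcM.
  rewrite (le_trans (lerD g4 (ler_pM _ _ g2 f4))) ?normc_ge0//.
  have : normc (f w' - f w) ^+ 2 <= (A * d) ^+ 2.
    by rewrite lerXn2r ?nnegrE ?mulr_ge0.
  move=> /(ler_wpM2l B0); rewrite exprMn => h.
  have := mulr_ge0 B0 (exprn_ge0 2 d0).
  lra.
Qed.

Lemma unif_diffV K f f' (m : R) : 0 < m -> (forall w, K w -> m <= normc (f w)) ->
  unif_diff K f f' ->
  unif_diff K (fun w => (f w)^-1) (fun w => - f' w / f w ^+ 2).
Proof.
move=> m0 mf; have fn0 w : K w -> f w != 0.
  by move=> /mf mw; rewrite -normc_gt0 (lt_le_trans m0).
move=> fd; rewrite -[X in unif_diff K X]/(fun w => GRing.inv (f w)).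
suff inv_diff : unif_diff [set z | m <= normc z] (@GRing.inv R[i]) (fun z => - (z ^+ 2)^-1).
  apply: eq_unif_diff (unif_diff_comp mf fd inv_diff) => // w Kw /=.
  by rewrite mulrC mulrN mulNr.
have im := invr_gt0 m; rewrite m0 in im.
have i0 : 0 <= m^-1 by exact: ltW.
exists (m^-1 + m^-1 ^+ 2 + m^-1 ^+ 3); first by rewrite !addr_ge0 ?exprn_ge0.
move=> z z' /= mz mz'.
have z0 : z != 0 by rewrite -normc_gt0 (lt_le_trans m0).
have z'0 : z' != 0 by rewrite -normc_gt0 (lt_le_trans m0).
have nz : normc z^-1 <= m^-1 by rewrite normcV lef_pV2// posrE normc_gt0.
have nz' : normc z'^-1 <= m^-1 by rewrite normcV lef_pV2// posrE normc_gt0.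
have i2 := exprn_ge0 2 i0; have i3 := exprn_ge0 3 i0.
have d0 := normc_ge0 (z' - z).
have h2 : normc (z^-1 * z'^-1) <= m^-1 ^+ 2.
  by rewrite normcM expr2 ler_pM ?normc_ge0.
split.
- by lra.
- rewrite normcN normcV normcX -exprVn -normcV.
  have : normc z^-1 ^+ 2 <= m^-1 ^+ 2 by rewrite lerXn2r ?nnegrE ?normc_ge0.
  lra.
- have -> : z'^-1 - z^-1 = - (z^-1 * z'^-1) * (z' - z) by field; rewrite z'0 z0.
  rewrite normcM normcN ler_wpM2r//; lra.
- have -> : z'^-1 - z^-1 - (- (z ^+ 2)^-1) * (z' - z) =
     (z^-1 * z'^-1) * z^-1 * (z' - z) ^+ 2 by field; rewrite z'0 z0.
  rewrite normcM normcX ler_wpM2r ?exprn_ge0//.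
  by rewrite normcM (le_trans (ler_pM _ _ h2 nz)) ?normc_ge0// -exprSr; lra.
Qed.

Lemma unif_diff_horner K (p : {poly R[i]}) (B : R) :
  (forall w, K w -> normc w <= B) ->
  unif_diff K (fun w => p.[w]) (fun w => p^`().[w]).
Proof.
move=> KB; elim/poly_ind: p => [|p c IH].
  apply: eq_unif_diff (unif_diff_cst K 0) => w _; first by rewrite horner0.
  by rewrite deriv0 horner0.
apply: eq_unif_diff (unif_diffD (unif_diffM IH (unif_diff_id KB)) (unif_diff_cst K c)).
  by move=> w _; rewrite !hornerE.
by move=> w _; rewrite derivD derivM derivC derivX !hornerE.
Qed.

Lemma unif_diff_bounded K f f' : unif_diff K f f' ->
  exists2 A : R, 0 <= A & forall w, K w -> normc (f w) <= A /\ normc (f' w) <= A.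
Proof. by move=> [A A0 h]; exists A => // w Kw; case: (h w w Kw Kw). Qed.

(** Inverse function estimate: by Taylor's formula for [Phi] at [f w], the
    increment of [f] is that of [g] divided by [Phi' (f w)], up to the square of
    the increment of [f], which is of second order as [f] is Lipschitz. *)
Lemma unif_diff_implicit K f g g' (Phi : {poly R[i]}) (m B C : R) : 0 < m ->
  (forall w, K w -> normc (f w) <= B) ->
  (forall w, K w -> Phi.[f w] = g w) ->
  (forall w, K w -> m <= normc Phi^`().[f w]) ->
  (forall w w', K w -> K w' -> normc (f w' - f w) <= C * normc (w' - w)) ->
  unif_diff K g g' -> unif_diff K f (fun w => g' w / Phi^`().[f w]).
Proof.
move=> m0 fB fg mf fC [A A0 hg].
have [D D0 hP] := @unif_diff_horner [set z | normc z <= B] Phi B (fun _ h => h).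
have im : 0 < m^-1 by rewrite invr_gt0.
have i0 := ltW im.
pose M := `|B| + m^-1 * A + `|C| + m^-1 * (A + D * C ^+ 2).
have t1 : 0 <= m^-1 * A by rewrite mulr_ge0.
have t2 : 0 <= m^-1 * (A + D * C ^+ 2).
  by apply: mulr_ge0 => //; apply: addr_ge0 => //; rewrite mulr_ge0 ?sqr_ge0.
exists M; first by rewrite /M !addr_ge0.
move=> w w' Kw Kw'.
have [_ g2 _ g4] := hg _ _ Kw Kw'.
have [_ _ _ p4] := hP _ _ (fB _ Kw) (fB _ Kw').
rewrite !fg// in p4.
have mw := mf _ Kw; have Fn0 : Phi^`().[f w] != 0.
  by rewrite -normc_gt0 (lt_le_trans m0).
have nv : normc (Phi^`().[f w])^-1 <= m^-1.
  by rewrite normcV lef_pV2// posrE normc_gt0.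
have := fC _ _ Kw Kw'; set e := f w' - f w => eC.
have d0 := normc_ge0 (w' - w); set d := normc (w' - w) in g4 eC d0 *.
have B1 := ler_norm B; have C1 := ler_norm C.
have Bp := normr_ge0 B; have Cp := normr_ge0 C.
split.
- by rewrite (le_trans (fB _ Kw))// /M; lra.
- by rewrite normcM mulrC (le_trans (ler_pM _ _ nv g2)) ?normc_ge0// /M; lra.
- by rewrite (le_trans eC)// ler_wpM2r// /M; lra.
- have -> : e - g' w / Phi^`().[f w] * (w' - w) =
     (Phi^`().[f w])^-1 * ((g w' - g w - g' w * (w' - w)) -
       (g w' - g w - Phi^`().[f w] * e)) by field.
  have e2 : normc e ^+ 2 <= C ^+ 2 * d ^+ 2.
    by rewrite -exprMn lerXn2r ?nnegrE ?normc_ge0// (le_trans _ eC) ?normc_ge0.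
  rewrite normcM (le_trans (ler_pM _ _ nv (le_trans (normcB _ _) (lerD g4 p4))))
    ?normc_ge0//.
  have := ler_wpM2l (mulr_ge0 i0 D0) e2.
  have : 0 <= (`|B| + m^-1 * A + `|C|) * d ^+ 2.
    by rewrite mulr_ge0 ?exprn_ge0// !addr_ge0.
  rewrite /M; lra.
Qed.

End UniformDerivative.

(** * The complex exponential *)

Section ComplexExponential.
Context {R : realType}.
Implicit Types (x y : R) (u w : R[i]).

Definition cexp w : R[i] :=
  Complex (expR (Re w) * cos (Im w)) (expR (Re w) * sin (Im w)).

Lemma cexpD u w : cexp (u + w) = cexp u * cexp w.
Proof.
case: u w => a b [c d]; rewrite /cexp /= expRD cosD sinD.
by congr Complex; ring.
Qed.

Lemma cexp0 : cexp 0 = 1.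
Proof. by rewrite /cexp /= expR0 cos0 sin0 mulr1 mulr0. Qed.

Lemma normc_cexp w : normc (cexp w) = expR (Re w).
Proof.
by rewrite /= !exprMn -mulrDr cos2Dsin2 mulr1 sqrtr_sqr ger0_norm ?expR_ge0.
Qed.

Lemma cexp_neq0 w : cexp w != 0.
Proof. by rewrite -normc_gt0 normc_cexp expR_gt0. Qed.

Lemma cexpN w : cexp (- w) = (cexp w)^-1.
Proof.
by apply: (mulfI (cexp_neq0 w)); rewrite -cexpD subrr cexp0 divff// cexp_neq0.
Qed.

Lemma cexpMn w n : cexp (w *+ n) = cexp w ^+ n.
Proof.
elim: n => [|n IH]; first by rewrite mulr0n cexp0 expr0.
by rewrite mulrS cexpD IH exprS.
Qed.

Lemma cexp2pi : cexp (Complex 0 (pi *+ 2)) = 1.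
Proof. by rewrite /cexp /= expR0 cos2pi sin2pi mulr1 mulr0. Qed.

Lemma cexp2piMn n : cexp (Complex 0 (pi *+ 2 *+ n)) = 1.
Proof.
have -> : Complex 0 (pi *+ 2 *+ n) = Complex 0 (pi *+ 2) *+ n :> R[i].
  elim: n => [|n IH]; first by rewrite !mulr0n.
  by rewrite mulrS [RHS]mulrS -IH; congr Complex; rewrite add0r.
by rewrite cexpMn cexp2pi expr1n.
Qed.

Lemma abs_sin_le x : `|sin x| <= `|x|.
Proof.
wlog x0 : x / 0 <= x => [h|].
  have [/h//|x0] := leP 0 x.
  by rewrite -normrN -sinN -(normrN x) h// oppr_ge0 ltW.
have sc := continuous_subspaceT (@continuous_sin R) : {within `[0, x], continuous sin}.
have [c _] := MVT_segment x0 (fun z _ => is_derive_sin z) sc.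
rewrite sin0 !subr0 => ->; rewrite normrM (ger0_norm x0) ler_piMl//.
exact: cos_max.
Qed.

Lemma one_sub_cos_le x : 0 <= 1 - cos x <= x ^+ 2.
Proof.
have -> : 1 - cos x = 2 * sin (x / 2) ^+ 2.
  have {1}-> : x = x / 2 *+ 2 by rewrite -mulr_natr divfK.
  by rewrite cos_mulr2n cos2sin2; ring.
rewrite mulr_ge0 ?sqr_ge0//=.
have : `|sin (x / 2)| ^+ 2 <= `|x / 2| ^+ 2 by rewrite lerXn2r ?nnegrE// abs_sin_le.
rewrite !real_normK ?num_real// expr_div_n => h.
have := sqr_ge0 x; lra.
Qed.

Lemma abs_sin_sub_le x : `|sin x - x| <= x ^+ 2.
Proof.
wlog x0 : x / 0 <= x => [h|].
  have [/h//|x0] := leP 0 x.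
  have := h (- x); rewrite sinN sqrrN opprK addrC oppr_ge0 -normrN opprB.
  by apply; exact: ltW.
have [x1|x1] := leP 2 x.
  rewrite (le_trans (ler_normB _ _))//; have := abs_sin_le x.
  rewrite (ger0_norm x0) => ?; nra.
have sd z : z \in `]0, x[ -> is_derive z 1 (fun y => sin y - y) (cos z - 1).
  by move=> _; apply: is_deriveB.
have sc : {within `[0, x], continuous (fun y => sin y - y)}.
  apply: continuous_subspaceT => z.
  by apply: cvgB; [exact: continuous_sin|exact: cvg_id].
have [c] := MVT_segment x0 sd sc.
rewrite in_itv/= => /andP[c0 cx]; rewrite sin0 !subr0 => ->.
have /andP[h0 h1] := one_sub_cos_le (c).
have : 1 - cos c <= c.
  have -> : 1 - cos c = 2 * (sin (c / 2) * sin (c / 2)).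
    have {1}-> : c = c / 2 *+ 2 by rewrite -mulr_natr divfK.
    by rewrite cos_mulr2n cos2sin2; ring.
  have s1 := abs_sin_le (c / 2); have s2 := sin_max (c / 2).
  have c2 : 0 <= c / 2 by rewrite divr_ge0.
  rewrite (ger0_norm c2) in s1.
  have := ler_pM (normr_ge0 _) (normr_ge0 _) s1 s2.
  rewrite -normrM => /(le_trans (ler_norm _)); lra.
move=> h2; rewrite normrM distrC (ger0_norm h0) (ger0_norm x0) expr2.
by rewrite ler_wpM2r// (le_trans h2).
Qed.

Lemma expR_sub1_le x : expR x - 1 <= x * expR x.
Proof.
have := expR_ge1Dx (- x); rewrite -(ler_pM2l (expR_gt0 x)) -expRD subrr expR0.
lra.
Qed.

Lemma abs_expR_sub1_le x B : `|x| <= B -> `|expR x - 1| <= expR B * `|x|.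
Proof.
move=> xB; have B0 : 0 <= B by exact: le_trans (normr_ge0 _) xB.
have h1 := expR_sub1_le x; have h2 := expR_ge1Dx x.
have e1 : 1 <= expR B by rewrite -expR0 ler_expR.
have e2 : expR x <= expR B by rewrite ler_expR (le_trans (ler_norm _)).
have ex := expR_ge0 x.
rewrite ler_norml; have [x0|x0] := leP 0 x.
  rewrite ger0_norm//; apply/andP; split; nra.
rewrite ltr0_norm//; apply/andP; split; nra.
Qed.

Lemma abs_expR_sub1_sub_le x B : `|x| <= B ->
  `|expR x - 1 - x| <= expR B * x ^+ 2.
Proof.
move=> xB; have h1 := expR_sub1_le x; have h2 := expR_ge1Dx x.
rewrite ger0_norm; last by lra.
have := abs_expR_sub1_le xB.
have : x * (expR x - 1) <= `|x| * `|expR x - 1| by rewrite -normrM ler_norm.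
move=> h3 /(ler_wpM2l (normr_ge0 x)) h4.
rewrite -[x ^+ 2]real_normK ?num_real//; lra.
Qed.

Lemma cexp_taylor B : exists2 A : R, 0 < A & forall w, `|Re w| <= B ->
  normc (cexp w - 1) <= A * normc w /\
  normc (cexp w - 1 - w) <= A * normc w ^+ 2.
Proof.
exists (5 * expR B); first by rewrite mulr_gt0 ?expR_gt0.
move=> w wB; have a1 := Re_le_normc w; have a2 := Im_le_normc w.
have Rc : Re (cexp w) = expR (Re w) * cos (Im w) by [].
have Ic : Im (cexp w) = expR (Re w) * sin (Im w) by [].
set d := normc w in a1 a2 *; set x := Re w in a1 wB Rc Ic *.
set y := Im w in a2 Rc Ic *.
have d0 : 0 <= d by exact: normc_ge0.
have B0 : 0 <= B by exact: le_trans (normr_ge0 _) wB.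
have e1 : 1 <= expR B by rewrite -expR0 ler_expR.
have e2 : expR x <= expR B by rewrite ler_expR (le_trans (ler_norm _)).
have ex := expR_ge0 x.
have E1 : `|expR x - 1| <= expR B * d.
  by rewrite (le_trans (abs_expR_sub1_le wB))// ler_wpM2l// expR_ge0.
have x2 : x ^+ 2 <= d ^+ 2 by rewrite -real_normK ?num_real// lerXn2r ?nnegrE.
have y2 : y ^+ 2 <= d ^+ 2 by rewrite -real_normK ?num_real// lerXn2r ?nnegrE.
have E2 : `|expR x - 1 - x| <= expR B * d ^+ 2.
  by rewrite (le_trans (abs_expR_sub1_sub_le wB))// ler_wpM2l// expR_ge0.
have /andP[C0 C1] := one_sub_cos_le y.
have S1 := abs_sin_sub_le y.
have S2 : `|expR x * sin y| <= expR B * d.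
  by rewrite normrM (ger0_norm ex) ler_pM// (le_trans (abs_sin_le _)).
have d2 : 0 <= d ^+ 2 by rewrite exprn_ge0.
have C3 : `|expR x * (cos y - 1)| <= expR B * d ^+ 2.
  by rewrite normrM (ger0_norm ex) distrC (ger0_norm C0) ler_pM// (le_trans C1).
have C4 : `|cos y - 1| <= d.
  have -> : cos y - 1 = - (2 * (sin (y / 2) * sin (y / 2))).
    have {1}-> : y = y / 2 *+ 2 by rewrite -mulr_natr divfK.
    by rewrite cos_mulr2n cos2sin2; ring.
  have s1 := abs_sin_le (y / 2); have s2 := sin_max (y / 2).
  rewrite (normrM y) (@ger0_norm _ 2^-1) in s1; last by rewrite invr_ge0.
  have := ler_pM (normr_ge0 _) (normr_ge0 _) s1 s2.
  rewrite -normrM normrN (normrM 2) (@ger0_norm _ 2)//; lra.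
have C5 : `|expR x * (cos y - 1)| <= expR B * d.
  by rewrite normrM (ger0_norm ex) ler_pM.
have S3 : `|expR x * (sin y - y)| <= expR B * d ^+ 2.
  by rewrite normrM (ger0_norm ex) ler_pM// (le_trans S1).
have S4 : `|(expR x - 1) * y| <= expR B * d ^+ 2.
  by rewrite normrM expr2 mulrA ler_pM.
split.
  rewrite (le_trans (normc_le_ReIm _))// ReB ImB Rc Ic /= subr0.
  have -> : expR x * cos y - 1 = (expR x - 1) + expR x * (cos y - 1) by ring.
  have := ler_normD (expR x - 1) (expR x * (cos y - 1)).
  have : 0 <= expR B * d by rewrite mulr_ge0 ?expR_ge0.
  lra.
rewrite (le_trans (normc_le_ReIm _))// 2!ReB 2!ImB Rc Ic /= subr0.
have -> : expR x * cos y - 1 - x =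
  (expR x - 1 - x) + expR x * (cos y - 1) by ring.
have -> : expR x * sin y - y = expR x * (sin y - y) + (expR x - 1) * y by ring.
have := ler_normD (expR x - 1 - x) (expR x * (cos y - 1)).
have := ler_normD (expR x * (sin y - y)) ((expR x - 1) * y).
have : 0 <= expR B * d ^+ 2 by rewrite mulr_ge0 ?expR_ge0.
lra.
Qed.

(** The addition formula reduces the estimate to Taylor's formula at [0], and the
    bound on the real parts controls the factor [exp w]. *)
Lemma unif_diff_cexp (K : set R[i]) (B : R) :
  (forall w, K w -> `|Re w| <= B) -> unif_diff K cexp cexp.
Proof.
move=> KB; have [A A0 hA] := cexp_taylor (B + B).
have e0 := expR_ge0 B.
exists (expR B * (A + 1)); first by rewrite mulr_ge0 // addr_ge0// ltW.
move=> w w' Kw Kw'.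
have ew : expR (Re w) <= expR B by rewrite ler_expR (le_trans (ler_norm _))// KB.
have ewA : expR (Re w) <= expR B * (A + 1).
  by rewrite (le_trans ew)// ler_peMr// lerDr ltW.
rewrite !normc_cexp.
have [|h1 h2] := hA (w' - w).
  by rewrite ReB (le_trans (ler_normB _ _))// lerD// KB.
have -> : cexp w' = cexp w * cexp (w' - w) by rewrite -cexpD addrC subrK.
have d0 := normc_ge0 (w' - w); have er := expR_ge0 (Re w).
split=> //.
- rewrite -{2}[cexp w]mulr1 -mulrBr normcM normc_cexp -mulrA ler_pM ?normc_ge0//.
  by rewrite (le_trans h1)// ler_wpM2r// lerDl.
- have -> : cexp w * cexp (w' - w) - cexp w - cexp w * (w' - w) =
    cexp w * (cexp (w' - w) - 1 - (w' - w)) by ring.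
  rewrite normcM normc_cexp -mulrA ler_pM ?normc_ge0//.
  by rewrite (le_trans h2)// ler_wpM2r ?exprn_ge0// lerDl.
Qed.

End ComplexExponential.

(** * Lifting through a polynomial map *)

Section Lifting.
Context {R : realType}.
Implicit Types (K : set R[i]) (f g : R[i] -> R[i]) (Phi : {poly R[i]}).

Lemma prod_gt_exp (s : seq R) (y : R) : s != [::] -> 0 <= y ->
  (forall x, x \in s -> y < x) -> y ^+ size s < \prod_(x <- s) x.
Proof.
move=> s0 y0; elim: s s0 => [//|a s IH] _ ys.
have ya : y < a by apply: ys; rewrite mem_head.
rewrite big_cons /= exprS; have [->|s0] := eqVneq s [::].
  by rewrite big_nil /= expr0 !mulr1.
have h : y ^+ size s < \prod_(x <- s) x.
  by apply: IH => // x xs; apply: ys; rewrite inE xs orbT.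
by apply: ltr_pM => //; rewrite ?exprn_ge0.
Qed.

(** The value [|Phi z - v|] is the product of the distances from [z] to the
    roots of [Phi - v], so one of these distances is at most their geometric
    mean. *)
Lemma root_near Phi z v : Phi \is monic -> (1 < size Phi)%N ->
  exists2 z', Phi.[z'] = v &
    normc (z' - z) ^+ (size Phi).-1 <= normc (Phi.[z] - v).
Proof.
move=> Phim Phis.
have sv : (size (- v%:P) < size Phi)%N.
  by rewrite size_polyN (leq_ltn_trans (size_polyC_leq1 _)).
have [s es] := closed_field_poly_normal (Phi - v%:P).
rewrite lead_coefDl// (monicP Phim) scale1r in es.
have ss : size s = (size Phi).-1.
  by rewrite -(size_polyDl sv) es size_prod_XsubC.
have ev : Phi.[z] - v = \prod_(x <- s) (z - x).
  have := congr1 (fun p => p.[z]) es; rewrite !hornerE horner_prod => ->.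
  by apply: eq_bigr => x _; rewrite !hornerE.
have [[x xs xle]|nex] := pselect (exists2 x, x \in s &
    normc (x - z) ^+ (size Phi).-1 <= normc (Phi.[z] - v)).
  exists x => //; apply/eqP; rewrite -subr_eq0.
  have := congr1 (fun p => p.[x]) es; rewrite !hornerE horner_prod => ->.
  by apply/eqP; rewrite (big_rem x)//= !hornerE subrr mul0r.
suff : normc (Phi.[z] - v) ^+ size s < normc (Phi.[z] - v) ^+ size s.
  by rewrite ltxx.
have e : normc (Phi.[z] - v) ^+ size s =
    \prod_(y <- [seq normc (x - z) ^+ (size Phi).-1 | x <- s]) y.
  rewrite ev big_map -ss prodrXl; congr (_ ^+ _).
  elim: (s) => [|a l IH]; first by rewrite !big_nil normc1.
  by rewrite !big_cons normcM IH normc_distC.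
rewrite [ltRHS]e -(size_map (fun x => normc (x - z) ^+ (size Phi).-1) s).
apply: prod_gt_exp; rewrite ?normc_ge0//.
  by rewrite -size_eq0 size_map ss -lt0n -ltnS prednK// ltnW.
move=> _ /mapP[x xs ->]; rewrite ltNge; apply/negP => h.
by apply: nex; exists x.
Qed.

(** Each point is close to a root of [Phi] when [Phi] takes a small value there,
    by [root_near] for the value [0], and there are finitely many roots. *)
Lemma poly_preimage_bounded Phi (M : R) : Phi \is monic -> (1 < size Phi)%N ->
  exists B, forall z, normc Phi.[z] <= M -> normc z <= B.
Proof.
move=> Phim Phis.
have [s es] := closed_field_poly_normal Phi.
rewrite (monicP Phim) scale1r in es.
exists (\sum_(x <- s) normc x + 1 + M) => z zM.
have M0 : 0 <= M by exact: le_trans (normc_ge0 _) zM.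
have [r r0] := root_near z 0 Phim Phis.
rewrite subr0 => /le_trans/(_ zM) rz.
have rs : r \in s by rewrite -root_prod_XsubC -es; apply/rootP.
have h1 : normc r <= \sum_(x <- s) normc x.
  by rewrite (big_rem r)//= lerDl sumr_ge0// => x _; exact: normc_ge0.
have h2 : normc (r - z) <= 1 + M.
  have [|/ltW r1] := leP (normc (r - z)) 1; first by lra.
  rewrite (le_trans _ (le_trans rz _))// ?lerDr//.
  by rewrite -[leLHS]expr1 ler_weXn2l// -ltnS prednK// ltnW.
by have := normc_dist_le z r; rewrite normc_distC; lra.
Qed.

(** A uniform form of the local injectivity of [Phi] on its fibres over the
    values of [g]. *)
Definition unramified K Phi g := exists2 m : R, 0 < m &
  forall z w, K w -> Phi.[z] = g w -> m <= normc Phi^`().[z].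

Definition convex_region K := forall w w' (s : R), K w -> K w' ->
  0 <= s <= 1 -> K (w + s%:C * (w' - w)).

Definition bounded_region K := exists B : R, forall w, K w -> normc w <= B.

Definition lipschitz_section K Phi g f :=
  (forall w, K w -> Phi.[f w] = g w) /\
  exists C : R, forall w w', K w -> K w' ->
    normc (f w' - f w) <= C * normc (w' - w).

Section Region.
Variables (K : set R[i]) (Phi : {poly R[i]}) (g g' : R[i] -> R[i]).
Hypotheses (Phim : Phi \is monic) (Phis : (1 < size Phi)%N).
Hypotheses (gd : unif_diff K g g') (Phi_unram : unramified K Phi g).

Lemma fibre_bounded :
  exists B, forall z w, K w -> Phi.[z] = g w -> normc z <= B.
Proof.
have [A _ hA] := unif_diff_bounded gd.
have [B hB] := poly_preimage_bounded A Phim Phis.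
by exists B => z w Kw zw; apply: hB; rewrite zw; case: (hA _ Kw).
Qed.

(** By Taylor's formula at [z], whose linear term dominates near [z]. *)
Lemma fibre_increment : exists r m : R, [/\ 0 < r, 0 < m &
  forall z z' w w', K w -> K w' -> Phi.[z] = g w -> Phi.[z'] = g w' ->
    normc (z' - z) <= r -> m * normc (z' - z) <= normc (g w' - g w)].
Proof.
have [B hB] := fibre_bounded.
have [m m0 hm] := Phi_unram.
have [A A0 hA] := @unif_diff_horner R [set z | normc z <= B] Phi B (fun _ h => h).
have A1 : 0 < A + 1 by lra.
exists (m / (2 * (A + 1))), (m / 2); split; rewrite ?divr_gt0 ?mulr_gt0//.
move=> z z' w w' Kw Kw' zw zw'.
rewrite ler_pdivlMr ?mulr_gt0// => zz'.
have [_ _ _ +] := hA z z' (hB _ _ Kw zw) (hB _ _ Kw' zw').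
rewrite zw zw' => t.
have mz : m * normc (z' - z) <= normc (Phi^`().[z] * (z' - z)).
  by rewrite normcM ler_wpM2r ?normc_ge0// (hm _ w).
have d0 := normc_ge0 (z' - z).
have := normc_dist_le (Phi^`().[z] * (z' - z)) (g w' - g w).
rewrite [in leRHS]normc_distC; move: t mz zz' d0.
set d := normc (z' - z); set e := normc (_ - _ - _) => t mz zz' d0 h.
have : d * (d * (2 * (A + 1))) <= d * m by rewrite ler_wpM2l.
rewrite expr2 in t; have dd : 0 <= d * d by exact: mulr_ge0.
nra.
Qed.

Lemma fibre_separated : exists2 r : R, 0 < r &
  forall z z' w, K w -> Phi.[z] = g w -> Phi.[z'] = g w ->
    normc (z' - z) <= r -> z' = z.
Proof.
have [r [m [r0 m0 h]]] := fibre_increment; exists r => // z z' w Kw zw zw' zr.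
have := h _ _ _ _ Kw Kw zw zw' zr.
rewrite subrr normc0 pmulr_rle0// => n0.
apply/eqP; rewrite -subr_eq0 -normc_eq0 eq_le n0; exact: normc_ge0.
Qed.

Lemma fibre_follow : exists C d : R, [/\ 0 <= C, 0 < d &
  forall z w w', K w -> K w' -> Phi.[z] = g w -> normc (w' - w) <= d ->
    exists2 z', Phi.[z'] = g w' & normc (z' - z) <= C * normc (w' - w)].
Proof.
have [r [m [r0 m0 h]]] := fibre_increment.
have [A A0 hA] := gd.
pose n := (size Phi).-1.
have n0 : (0 < n)%N by rewrite /n -ltnS prednK// ltnW.
have A1 : 0 < A + 1 by lra.
exists (m^-1 * A), (r ^+ n / (A + 1)); split.
- by rewrite mulr_ge0// invr_ge0 ltW.
- by rewrite divr_gt0// exprn_gt0.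
move=> z w w' Kw Kw' zw; rewrite ler_pdivlMr// => ww'.
have [z' zw' zz'] := root_near z (g w') Phim Phis.
exists z' => //; have [_ _ gl _] := hA _ _ Kw Kw'.
rewrite zw (normc_distC (g w)) in zz'.
have zr : normc (z' - z) <= r.
  rewrite -(@ler_pXn2r _ n) ?nnegrE ?normc_ge0 ?(ltW r0)//.
  rewrite (le_trans zz')// (le_trans gl)// (le_trans _ ww')// mulrC.
  by rewrite ler_wpM2l ?normc_ge0// lerDl.
have := le_trans (h _ _ _ _ Kw Kw' zw zw' zr) gl.
by rewrite -mulrA ler_pdivlMl.
Qed.

(** Two sections cannot separate along a segment: they move by less than the
    separation of the fibres at each of many small steps. *)
Lemma section_unique f1 f2 w0 w : convex_region K ->
  lipschitz_section K Phi g f1 -> lipschitz_section K Phi g f2 ->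
  K w0 -> K w -> f1 w0 = f2 w0 -> f1 w = f2 w.
Proof.
move=> Kc [s1 [C1 l1]] [s2 [C2 l2]] Kw0 Kw e0.
have [r r0 hr] := fibre_separated.
pose D := (C1 + C2) * normc (w - w0) / r.
pose N := (Num.truncn `|D|).+1.
have N0 : 0 < N%:R :> R by rewrite ltr0n.
have ND : D <= N%:R.
  by rewrite (le_trans (ler_norm _))// ltW// truncnS_gt.
pose p k := w0 + (k%:R / N%:R)%:C * (w - w0).
have Kp k : (k <= N)%N -> K (p k).
  move=> kN; apply: Kc => //; rewrite divr_ge0 ?ler0n//=.
  by rewrite ler_pdivrMr// mul1r ler_nat.
have pS k : p k.+1 - p k = (N%:R^-1)%:C * (w - w0).
  rewrite /p -natr1 mulrDl rmorphD/= mul1r; ring.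
suff h k : (k <= N)%N -> f1 (p k) = f2 (p k).
  have := h N (leqnn _); rewrite /p divff ?gt_eqF//.
  by rewrite mul1r addrC subrK.
elim: k => [|k IH] kN; first by rewrite /p mul0r mul0r addr0.
have kN' := ltnW kN; apply: (hr _ _ (p k.+1)); rewrite ?s1 ?s2 //; try exact: Kp.
rewrite (le_trans (normc_split (f1 (p k)) _ _))// {2}(IH kN').
rewrite (le_trans (lerD (l1 _ _ (Kp _ kN') (Kp _ kN))
  (l2 _ _ (Kp _ kN) (Kp _ kN'))))//.
rewrite (normc_distC (p k)) -mulrDl pS normcM normcR ger0_norm ?invr_ge0 ?ler0n//.
by rewrite mulrCA ler_pdivrMl// -ler_pdivrMr// mulrAC.
Qed.

Hypotheses (Kc : convex_region K) (Kb : bounded_region K).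

(** The value at [w] is reached by following the fibre in finitely many small
    steps along the segment from [w0] to [w]; neighbouring segments stay in the
    same sheet. *)
Lemma section_exists w0 z0 : K w0 -> Phi.[z0] = g w0 ->
  exists2 f, lipschitz_section K Phi g f & f w0 = z0.
Proof.
move=> Kw0 zw0.
have [r r0 sep] := fibre_separated.
have [C [d1 [C0 d10 fol]]] := fibre_follow.
have [B hB] := fibre_bounded.
have [D hD] := Kb.
have C1 : 0 < 4 * (C + 1) by lra.
pose d := Num.min d1 (r / (4 * (C + 1))).
have d0 : 0 < d by rewrite lt_min d10 divr_gt0.
have dd1 : d <= d1 by rewrite ge_min lexx.
have Cd : 4 * (C * d) <= r.
  have : d <= r / (4 * (C + 1)) by rewrite ge_min lexx orbT.
  rewrite ler_pdivlMr//; nra.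
pose N := (Num.truncn `|2 * D / d|).+1.
have N0 : 0 < N%:R :> R by rewrite ltr0n.
have ND : 2 * D / N%:R <= d.
  rewrite ler_pdivrMr// [d * _]mulrC -ler_pdivrMr//.
  by rewrite (le_trans (ler_norm _))// ltW// truncnS_gt.
pose p k w := w0 + (k%:R / N%:R)%:C * (w - w0).
have Kp k w : (k <= N)%N -> K w -> K (p k w).
  move=> kN Kw; apply: Kc => //; rewrite divr_ge0 ?ler0n//=.
  by rewrite ler_pdivrMr// mul1r ler_nat.
have pS k w : K w -> normc (p k.+1 w - p k w) <= d.
  move=> Kw; have -> : p k.+1 w - p k w = (N%:R^-1)%:C * (w - w0).
    by rewrite /p -natr1 mulrDl rmorphD/= mul1r; ring.
  rewrite normcM normcR ger0_norm ?invr_ge0 ?ler0n// (le_trans _ ND)//.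
  rewrite mulrC ler_pM2r ?invr_gt0// (le_trans (normcB _ _))//.
  by have := hD _ Kw; have := hD _ Kw0; lra.
have pw k w w' : (k <= N)%N -> normc (p k w' - p k w) <= normc (w' - w).
  move=> kN; have -> : p k w' - p k w = (k%:R / N%:R)%:C * (w' - w).
    by rewrite /p; ring.
  rewrite normcM normcR ger0_norm ?divr_ge0 ?ler0n//.
  by rewrite ler_piMl ?normc_ge0// ler_pdivrMr// mul1r ler_nat.
have p0 k : p k w0 = w0 by rewrite /p subrr mulr0 addr0.
have step k : (k <= N)%N -> exists f, [/\ f w0 = z0,
    forall w, K w -> Phi.[f w] = g (p k w) &
    forall w w', K w -> K w' -> normc (w' - w) <= d ->
      normc (f w' - f w) <= C * normc (p k w' - p k w)].
  elim: k => [|k IH] kN.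
    exists (fun=> z0); split=> // [w Kw|w w' Kw Kw' _].
      by rewrite zw0 /p mul0r mul0r addr0.
    by rewrite subrr normc0 mulr_ge0 ?normc_ge0.
  have kN' := ltnW kN; have [f [f0 fg fl]] := IH kN'.
  have fol' w : exists z, K w -> Phi.[z] = g (p k.+1 w) /\
      normc (z - f w) <= C * normc (p k.+1 w - p k w).
    have [Kw|nKw] := pselect (K w); last by exists 0.
    have [z z1 z2] := fol (f w) (p k w) (p k.+1 w) (Kp _ _ kN' Kw) (Kp _ _ kN Kw)
      (fg _ Kw) (le_trans (pS _ _ Kw) dd1).
    by exists z.
  have [F hF] := choice fol'.
  exists F; split.
  - have [_] := hF _ Kw0; rewrite !p0 subrr normc0 mulr0 f0 => h.
    by apply/eqP; rewrite -subr_eq0 -normc_eq0 eq_le h normc_ge0.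
  - by move=> w /hF[].
  move=> w w' Kw Kw' ww'; have [F1 F2] := hF _ Kw; have [F1' F2'] := hF _ Kw'.
  have pww : normc (p k.+1 w' - p k.+1 w) <= d by rewrite (le_trans (pw _ _ _ kN)).
  have [z zg zl] := fol (F w) _ _ (Kp _ _ kN Kw) (Kp _ _ kN Kw') F1
    (le_trans pww dd1).
  suff <- : z = F w' by [].
  apply: (sep _ _ _ (Kp _ _ kN Kw')) => //.
  have Cle x : x <= d -> C * x <= C * d by move=> ?; rewrite ler_wpM2l.
  have a1 := le_trans zl (Cle _ pww).
  have a2 := le_trans F2 (Cle _ (pS _ _ Kw)).
  have a3 := le_trans (fl _ _ Kw Kw' ww') (Cle _ (le_trans (pw _ _ _ kN') ww')).
  have a4 := le_trans F2' (Cle _ (pS _ _ Kw')).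
  rewrite (le_trans (normc_split (F w) _ _))//.
  have b1 := normc_split (f w) (F w) (F w').
  have b2 := normc_split (f w') (f w) (F w').
  rewrite (normc_distC (f w) (f w')) in b2; rewrite (normc_distC (f w') (F w')) in b2.
  lra.
have [f [f0 fg fl]] := step N (leqnn N).
have pN w : p N w = w by rewrite /p divff ?gt_eqF// mul1r addrC subrK.
exists f => //; split=> [w Kw|]; first by rewrite fg// pN.
exists (C + 2 * B / d) => w w' Kw Kw'.
have B0 : 0 <= B by rewrite (le_trans (normc_ge0 z0))// (hB _ w0).
have Bd : 0 <= 2 * B / d by rewrite divr_ge0 ?mulr_ge0 ?(ltW d0).
have n0 := normc_ge0 (w' - w).
have [ww'|/ltW ww'] := leP (normc (w' - w)) d.
  by rewrite (le_trans (fl _ _ Kw Kw' ww'))// !pN mulrDl lerDl mulr_ge0.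
rewrite mulrDl (@le_trans _ _ (2 * B))//.
  rewrite (le_trans (normcB _ _))//.
  have := hB (f w) w Kw; rewrite fg// pN => /(_ erefl).
  have := hB (f w') w' Kw'; rewrite fg// pN => /(_ erefl); lra.
have : 2 * B / d * d <= 2 * B / d * normc (w' - w) by rewrite ler_wpM2l.
rewrite divfK ?gt_eqF//.
have := mulr_ge0 C0 n0; lra.
Qed.

Lemma section_unif_diff f : lipschitz_section K Phi g f ->
  unif_diff K f (fun w => g' w / Phi^`().[f w]).
Proof.
move=> [fg [C fC]]; have [B hB] := fibre_bounded.
have [m m0 hm] := Phi_unram.
apply: (@unif_diff_implicit R K f g g' Phi m B C) => //.
- by move=> w Kw; apply: (hB _ w) => //; exact: fg.
- by move=> w Kw; apply: (hm _ w) => //; exact: fg.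
Qed.

End Region.
End Lifting.

(** * Lifting over a vertical strip *)

Section Strip.
Context {R : realType}.
Implicit Types (I : set R) (f g : R[i] -> R[i]) (Phi : {poly R[i]}).

Definition box (a b r : R) : set R[i] :=
  [set w | a <= Re w <= b /\ `|Im w| <= r].

Definition strip I : set R[i] := [set w | I (Re w)].

Definition strip_diff I f f' :=
  forall a b r, I a -> I b -> unif_diff (box a b r) f f'.

Definition strip_unramified I Phi g :=
  forall a b r, I a -> I b -> unramified (box a b r) Phi g.

Lemma box_convex a b r : convex_region (box a b r).
Proof.
move=> w w' s [/andP[aw wb] rw] [/andP[aw' wb'] rw'] /andP[s0 s1].
move: rw rw'; rewrite /box /= ReD ImD ReRM ImRM ReB ImB !ler_norml.
by move=> /andP[? ?] /andP[? ?]; split; apply/andP; split; nra.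
Qed.

Lemma box_bounded a b r : bounded_region (box a b r).
Proof.
exists (`|a| + `|b| + r) => w [/andP[aw wb] rw].
rewrite (le_trans (normc_le_ReIm _))// lerD// ler_norml; apply/andP; split.
  have := lerNnormlW (lexx `|a|); have := normr_ge0 b; lra.
have := ler_norm b; have := normr_ge0 a; lra.
Qed.

Lemma box_strip I a b r : is_interval I -> I a -> I b -> box a b r `<=` strip I.
Proof. by move=> Ii Ia Ib w [ab _]; exact: Ii Ia Ib _ ab. Qed.

Lemma strip_diff_ext I f f' g g' : is_interval I ->
  (forall w, strip I w -> f w = g w) -> (forall w, strip I w -> f' w = g' w) ->
  strip_diff I f f' -> strip_diff I g g'.
Proof.
move=> Ii fg fg' fd a b r Ia Ib; apply: eq_unif_diff (fd a b r Ia Ib) => w Kw.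
  by apply: fg; exact: box_strip Ii Ia Ib w Kw.
by apply: fg'; exact: box_strip Ii Ia Ib w Kw.
Qed.

Let hull (w0 w : R[i]) := box (Num.min (Re w0) (Re w)) (Num.max (Re w0) (Re w))
  (Num.max `|Im w0| `|Im w|).

Let hullL w0 w : hull w0 w w0.
Proof. by split; rewrite ?ge_min ?le_max ?lexx. Qed.

Let hullR w0 w : hull w0 w w.
Proof. by split; rewrite ?ge_min ?le_max ?lexx ?orbT. Qed.

Let hull_sub w0 w a b r : box a b r w0 -> box a b r w -> hull w0 w `<=` box a b r.
Proof.
move=> [/andP[? ?] ?] [/andP[? ?] ?] z [/andP[h1 h2] h3].
split; [apply/andP; split|].
- by rewrite (le_trans _ h1)// le_min; apply/andP.
- by rewrite (le_trans h2)// ge_max; apply/andP.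
- by rewrite (le_trans h3)// ge_max; apply/andP.
Qed.

Let minI I x y : I x -> I y -> I (Num.min x y).
Proof. by rewrite /Num.min; case: ifP. Qed.

Let maxI I x y : I x -> I y -> I (Num.max x y).
Proof. by rewrite /Num.max; case: ifP. Qed.

Lemma unif_diff_lipschitz_section K Phi g f f' :
  (forall w, K w -> Phi.[f w] = g w) -> unif_diff K f f' ->
  lipschitz_section K Phi g f.
Proof.
move=> fg [A A0 hA]; split=> //; exists A => w w' Kw Kw'.
by have [] := hA _ _ Kw Kw'.
Qed.

Variables (I : set R) (Phi : {poly R[i]}) (g g' : R[i] -> R[i]).
Hypotheses (Ii : is_interval I) (Phim : Phi \is monic) (Phis : (1 < size Phi)%N).
Hypotheses (gd : strip_diff I g g') (Phi_unram : strip_unramified I Phi g).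

Lemma strip_section_unique f1 f1' f2 f2' w0 w :
  (forall w, strip I w -> Phi.[f1 w] = g w) ->
  (forall w, strip I w -> Phi.[f2 w] = g w) ->
  strip_diff I f1 f1' -> strip_diff I f2 f2' ->
  strip I w0 -> strip I w -> f1 w0 = f2 w0 -> f1 w = f2 w.
Proof.
move=> g1 g2 d1 d2 Iw0 Iw; have Ia := minI Iw0 Iw; have Ib := maxI Iw0 Iw.
pose r := Num.max `|Im w0| `|Im w|.
have sub := box_strip Ii Ia Ib (r:=r).
apply: (section_unique Phim Phis (gd r Ia Ib) (Phi_unram r Ia Ib)).
- exact: box_convex.
- by apply: unif_diff_lipschitz_section (d1 _ _ r Ia Ib) => z /sub /g1.
- by apply: unif_diff_lipschitz_section (d2 _ _ r Ia Ib) => z /sub /g2.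
- exact: hullL.
- exact: hullR.
Qed.

(** Lifts over boxes around [w0] agree on common boxes by uniqueness, hence glue
    to a lift over the whole strip. *)
Lemma strip_section_exists w0 z0 : strip I w0 -> Phi.[z0] = g w0 ->
  exists f, [/\ f w0 = z0, forall w, strip I w -> Phi.[f w] = g w &
    strip_diff I f (fun w => g' w / Phi^`().[f w])].
Proof.
move=> Iw0 zw0.
have ex a b r : I a -> I b -> box a b r w0 ->
    exists2 F, lipschitz_section (box a b r) Phi g F & F w0 = z0.
  move=> Ia Ib K0.
  exact: (section_exists Phim Phis (gd r Ia Ib) (Phi_unram r Ia Ib)
    (@box_convex a b r) (@box_bounded a b r)).
have exw w : exists F, strip I w ->
    lipschitz_section (hull w0 w) Phi g F /\ F w0 = z0.
  have [Iw|nIw] := pselect (strip I w); last by exists id.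
  have [F F1 F2] := ex _ _ (Num.max `|Im w0| `|Im w|) (minI Iw0 Iw) (maxI Iw0 Iw)
    (hullL _ _).
  by exists F.
have [F hF] := choice exw.
have Fbox a b r G w : I a -> I b -> lipschitz_section (box a b r) Phi g G ->
    G w0 = z0 -> box a b r w0 -> box a b r w -> F w w = G w.
  move=> Ia Ib [G1 [C G2]] G0 K0 Kw.
  have Iw : strip I w by exact: box_strip Ii Ia Ib w Kw.
  have [Fw F0] := hF _ Iw; have sub := hull_sub K0 Kw.
  apply: (section_unique Phim Phis (gd _ (minI Iw0 Iw) (maxI Iw0 Iw))
    (Phi_unram _ (minI Iw0 Iw) (maxI Iw0 Iw)) (@box_convex _ _ _) Fw _
    (hullL w0 w) (hullR w0 w)); last by rewrite F0.
  split=> [z /sub/G1//|]; exists C => z z' /sub Kz /sub Kz'; exact: G2.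
exists (fun w => F w w); split.
- by have [_] := hF _ Iw0.
- by move=> w Iw; have [[h _] _] := hF _ Iw; apply: h; exact: hullR.
move=> a b r Ia Ib.
pose a' := Num.min (Re w0) a; pose b' := Num.max (Re w0) b.
pose r' := Num.max `|Im w0| r.
have Ia' : I a' by exact: minI.
have Ib' : I b' by exact: maxI.
have K0 : box a' b' r' w0 by split; rewrite ?ge_min ?le_max ?lexx.
have [G G1 G2] := ex _ _ _ Ia' Ib' K0.
have sub : box a b r `<=` box a' b' r'.
  move=> w [/andP[aw wb] rw]; split.
    by rewrite ge_min aw orbT le_max wb orbT.
  by rewrite le_max rw orbT.
have FG w : box a b r w -> G w = F w w.
  by move=> /sub Kw; rewrite (Fbox _ _ _ _ _ Ia' Ib' G1 G2 K0 Kw).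
have GD := section_unif_diff Phim Phis (gd r' Ia' Ib') (Phi_unram r' Ia' Ib') G1.
by apply: (eq_unif_diff FG) (unif_diff_sub sub GD) => w Kw; rewrite FG.
Qed.

End Strip.

(** * Branches of the inverse of a polynomial *)

Section Branches.
Context {R : realType}.
Implicit Types (I : set R) (f g : R[i] -> R[i]) (w z : R[i]).

Definition ivec (y : R) : R[i] := Complex 0 y.

Lemma ivec0 : ivec 0 = 0. Proof. by []. Qed.

Lemma ivecD x y : ivec (x + y) = ivec x + ivec y.
Proof. by congr Complex; rewrite addr0. Qed.

Lemma cexp_period w m : cexp (w + ivec (pi *+ 2 *+ m)) = cexp w.
Proof. by rewrite cexpD cexp2piMn mulr1. Qed.

Lemma strip_shift I w y : strip I (w + ivec y) = strip I w.
Proof. by rewrite /strip /= ReD /= addr0. Qed.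

Lemma strip_diff_shift I f f' y : strip_diff I f f' ->
  strip_diff I (fun w => f (w + ivec y)) (fun w => f' (w + ivec y)).
Proof.
move=> fd a b r Ia Ib; have [A A0 hA] := fd a b (r + `|y|) Ia Ib.
have Kw w : box a b r w -> box a b (r + `|y|) (w + ivec y).
  move=> [ab rw]; split; first by rewrite ReD /= addr0.
  by rewrite ImD (le_trans (ler_normD _ _))// lerD.
exists A => // w w' /Kw Kw1 /Kw Kw2; have := hA _ _ Kw1 Kw2.
by have -> : w' + ivec y - (w + ivec y) = w' - w by ring.
Qed.

Lemma strip_diffN I f f' : strip_diff I f f' ->
  strip_diff I (fun w => - f w) (fun w => - f' w).
Proof.
move=> fd a b r Ia Ib.
apply: eq_unif_diff (unif_diffM (unif_diff_cst (box a b r) (-1)) (fd a b r Ia Ib)).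
  by move=> w _; rewrite mulN1r.
by move=> w _; rewrite mul0r add0r mulN1r.
Qed.

Lemma strip_diff_cexp I : strip_diff I cexp cexp.
Proof.
move=> a b r _ _; have [B hB] := @box_bounded R a b r.
by apply: (@unif_diff_cexp _ _ B) => w /hB; exact: le_trans (Re_le_normc w).
Qed.

(** Openness at both ends leaves room for compact subintervals to keep a definite
    distance from the critical values. *)
Definition regular_range (P : {poly R[i]}) I :=
  [/\ is_interval I, forall a, I a -> exists2 a', a' < a & I a',
      forall b, I b -> exists2 b', b < b' & I b' &
      forall z, P^`().[z] = 0 -> P.[z] != 0 -> ~ I (ln (normc P.[z]))].

Lemma normc_prod_ge (s : seq R[i]) (f : R[i] -> R[i]) (e : R) : 0 <= e ->
  (forall c, c \in s -> e <= normc (f c)) ->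
  e ^+ size s <= normc (\prod_(c <- s) f c).
Proof.
move=> e0; elim: s => [|c s IH] h; first by rewrite big_nil expr0 normc1.
rewrite big_cons normcM /= exprS ler_pM ?exprn_ge0//.
  by apply: h; rewrite mem_head.
by apply: IH => x xs; apply: h; rewrite inE xs orbT.
Qed.

Section Regular.
Variables (P : {poly R[i]}) (I : set R).
Hypotheses (Pm : P \is monic) (Ps : (1 < size P)%N) (regI : regular_range P I).

Let Ii : is_interval I. Proof. by case: regI. Qed.

Lemma deriv_neq0 : P^`() != 0.
Proof.
apply/negP => /eqP/(congr1 (fun p : {poly R[i]} => p`_(size P).-2)).
rewrite coef0 coef_deriv.
have -> : (size P).-2.+1 = (size P).-1 by case: (size P) Ps => [|[]].
have := monicP Pm; rewrite lead_coefE => ->.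
by apply/eqP; rewrite pnatr_eq0; case: (size P) Ps => [|[]].
Qed.

(** A point where [ln |P|] lies in a compact part of [I] stays away from each
    critical point, since the values of [|P|] differ by a definite amount. *)
Lemma strip_unramified_regular : strip_unramified I P cexp.
Proof.
move=> a b r Ia Ib; have [_ lI rI cI] := regI.
have [a' aa' Ia'] := lI _ Ia; have [b' bb' Ib'] := rI _ Ib.
pose d := Num.min (expR a - expR a') (expR b' - expR b).
have d0 : 0 < d by rewrite lt_min !subr_gt0 !ltr_expR aa'.
have gap w z c : box a b r w -> P.[z] = cexp w -> P^`().[c] = 0 ->
    d <= normc (P.[z] - P.[c]).
  move=> [/andP[aw wb] _] zw c0.
  have ea : expR a <= normc P.[z] by rewrite zw normc_cexp ler_expR.
  have eb : normc P.[z] <= expR b by rewrite zw normc_cexp ler_expR.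
  have [] : normc P.[c] <= expR a' \/ expR b' <= normc P.[c].
    have [->|Pc0] := eqVneq P.[c] 0; first by left; rewrite normc0 expR_ge0.
    have [h|h] := leP (normc P.[c]) (expR a'); first by left.
    right; rewrite leNgt; apply/negP => h'; apply: (cI _ c0 Pc0).
    have cp : normc P.[c] \is Num.pos by rewrite posrE normc_gt0.
    apply: (Ii Ia' Ib').
    by rewrite -(ler_expR a') -[in X in _ && X]ler_expR lnK// !ltW.
  - move=> h; have := normc_dist_le P.[z] P.[c].
    have : d <= expR a - expR a' by rewrite ge_min lexx.
    lra.
  - move=> h; have := normc_dist_le P.[c] P.[z]; rewrite normc_distC.
    have : d <= expR b' - expR b by rewrite ge_min lexx orbT.
    lra.
have [B hB] := poly_preimage_bounded (expR b) Pm Ps.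
have [s es] := closed_field_poly_normal P^`().
set l := lead_coef P^`() in es.
have l0 : l != 0 by rewrite lead_coef_eq0 deriv_neq0.
have sP c : c \in s -> P^`().[c] = 0.
  by move=> cs; rewrite es hornerZ horner_prod (big_rem c)//= hornerXsubC subrr
    mul0r mulr0.
pose B' := `|B| + \sum_(c <- s) normc c.
have [A A0 hA] := @unif_diff_horner R [set z | normc z <= B'] P B' (fun _ h => h).
have A1 : 0 < A + 1 by lra.
pose e := d / (A + 1); have e0 : 0 < e by rewrite divr_gt0.
exists (normc l * e ^+ size s); first by rewrite mulr_gt0 ?exprn_gt0 ?normc_gt0.
move=> z w Kw zw; rewrite es hornerZ normcM ler_wpM2l ?normc_ge0//.
have zB : normc z <= B'.
  have zB : normc z <= B.
    by apply: hB; rewrite zw normc_cexp ler_expR; case: Kw => /andP[].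
  rewrite (le_trans zB)// (le_trans (ler_norm _))// lerDl.
  by rewrite sumr_ge0// => c _; exact: normc_ge0.
have far c : c \in s -> e <= normc (z - c).
  move=> cs; have cB : normc c <= B'.
    apply: (@le_trans _ _ (\sum_(c <- s) normc c)); last by rewrite lerDr.
    by rewrite (big_rem c)//= lerDl sumr_ge0// => ? _; exact: normc_ge0.
  have [_ _ lip _] := hA c z cB zB.
  rewrite ler_pdivrMr// (le_trans (gap _ _ _ Kw zw (sP _ cs)))// (le_trans lip)//.
  by rewrite mulrC ler_wpM2l ?normc_ge0// lerDl.
rewrite horner_prod; apply: normc_prod_ge => [|c /far]; first exact: ltW.
by rewrite !hornerE.
Qed.

(** The [Z k] are the branches of the inverse of [P] in the variable [ln P], and
    the [q k] are square roots of their derivatives. The turn [w + 2 i pi] acts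
    on the branches by a permutation [s] of order dividing [d`!]; after [d`!]
    turns a square root is restored up to sign, whence the factor [2]. *)
Record branches (d : nat) (Z q q' : 'I_d -> R[i] -> R[i]) (s : 'I_d -> 'I_d) :
    Prop := Branches {
  branchP : forall w z, strip I w ->
    (P.[z] = cexp w) <-> (exists k, z = Z k w);
  branch_inj : forall w k l, strip I w -> Z k w = Z l w -> k = l;
  branch_diff : forall k, strip_diff I (Z k) (fun w => q k w ^+ 2);
  branch_root_diff : forall k, strip_diff I (q k) (q' k);
  branch_speed : forall k a b r, I a -> I b ->
    exists2 m : R, 0 < m & forall w, box a b r w -> m <= normc (q k w) ^+ 2;
  branch_perm_inj : injective s;
  branch_root_turn : forall k w, strip I w ->
    normc (q k (w + ivec (pi *+ 2))) = normc (q (s k) w);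
  branch_root_period : forall k w, strip I w ->
    q k (w + ivec (pi *+ 2 *+ (2 * d`!))) = q k w
}.

Let Punr := strip_unramified_regular.

Let dP z := P^`().[z].

Lemma strip_fibre_deriv_neq0 w z : strip I w -> P.[z] = cexp w -> dP z != 0.
Proof.
move=> Iw zw; have [m m0 hm] := Punr `|Im w| Iw Iw.
rewrite -normc_gt0 (lt_le_trans m0)// (hm _ w)//.
by split; rewrite ?lexx.
Qed.

Lemma strip_diff_horner (p : {poly R[i]}) f f' : strip_diff I f f' ->
  strip_diff I (fun w => p.[f w]) (fun w => p^`().[f w] * f' w).
Proof.
move=> fd a b r Ia Ib; have fd' := fd a b r Ia Ib.
have [B _ hB] := unif_diff_bounded fd'.
apply: (unif_diff_comp (K' := [set z | normc z <= B]) _ fd').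
  by move=> w /hB[].
exact: (@unif_diff_horner R _ p B).
Qed.

(** The derivative of a branch is again differentiable and does not vanish, so
    that it has a square root over the simply connected strip. *)
Lemma branch_root_exists Z w0 : strip I w0 ->
  (forall w, strip I w -> P.[Z w] = cexp w) ->
  strip_diff I Z (fun w => cexp w / dP (Z w)) ->
  exists g' q q', [/\ strip_diff I (fun w => cexp w / dP (Z w)) g',
    strip_unramified I 'X^2 (fun w => cexp w / dP (Z w)),
    forall w, strip I w -> q w ^+ 2 = cexp w / dP (Z w) & strip_diff I q q'].
Proof.
move=> Iw0 PZ Zd.
pose g w := cexp w / dP (Z w).
pose h w := P^`()^`().[Z w] * (cexp w / dP (Z w)).
have hd : strip_diff I (fun w => dP (Z w)) h by exact: strip_diff_horner.
pose g' w := cexp w * (dP (Z w))^-1 + cexp w * (- h w / dP (Z w) ^+ 2).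
have gd : strip_diff I g g'.
  move=> a b r Ia Ib; have [m m0 hm] := Punr r Ia Ib.
  apply: unif_diffM; first exact: strip_diff_cexp Ia Ib.
  apply: (unif_diffV m0); last exact: hd.
  by move=> w Kw; apply: (hm _ w) => //; apply: PZ; exact: box_strip Ii Ia Ib w Kw.
have gu : strip_unramified I 'X^2 g.
  move=> a b r Ia Ib.
  have [A A0 hA] := unif_diff_bounded (hd a b r Ia Ib).
  have A1 : 0 < A + 1 by lra.
  pose mu := expR a / (A + 1).
  have mu0 : 0 < mu by rewrite divr_gt0 ?expR_gt0.
  exists (Num.min 1 mu); first by rewrite lt_min ltr01.
  move=> z w Kw; rewrite hornerXn => zw.
  have Iw := box_strip Ii Ia Ib Kw.
  have gw : mu <= normc (g w).
    rewrite normcM normcV normc_cexp ler_pdivrMr// mulrAC ler_pdivlMr; last first.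
      by rewrite normc_gt0; exact: strip_fibre_deriv_neq0 Iw (PZ _ Iw).
    rewrite ler_pM ?expR_ge0 ?normc_ge0//.
      by rewrite ler_expR; case: Kw => /andP[].
    by have [le_A _] := hA _ Kw; rewrite (le_trans le_A)// lerDl.
  have zmin : Num.min 1 mu <= normc z.
    rewrite leNgt lt_min; apply/negP => /andP[z1 z2].
    have : normc z * normc z < mu.
      by rewrite (le_lt_trans _ z2)// ler_piMl ?normc_ge0// ltW.
    by rewrite -normcM -expr2 ltNge zw gw.
  rewrite derivXn /= hornerMn hornerXn expr1 normcMn mulr2n (le_trans zmin)//.
  by rewrite lerDl normc_ge0.
have X2m : 'X^2 \is @monic R[i] by exact: monicXn.
have X2s : (1 < size ('X^2 : {poly R[i]}))%N by rewrite size_polyXn.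
have gw0 : ('X^2).[sqrtc (g w0)] = g w0 by rewrite hornerXn sqr_sqrtc.
have [q [_ qg qd]] := strip_section_exists Ii X2m X2s gd gu Iw0 gw0.
exists g', q; eexists; split; [exact: gd|exact: gu| |exact: qd].
by move=> w Iw; rewrite -hornerXn qg.
Qed.


Lemma iter_fact (d : nat) (s : 'I_d -> 'I_d) k : injective s -> iter d`! s k = k.
Proof.
move=> si; have -> : iter d`! s k = (perm si ^+ d`!)%g k.
  by rewrite permX; apply: eq_iter => i; rewrite permE.
have <- : #|[set: 'S_d]%G| = d`! by rewrite /= finset.cardsT card_Sn.
by rewrite expg_cardG ?finset.in_setT// perm1.
Qed.

(** A root of [P - exp w] continues to a branch over the whole strip, which is
    one of the branches starting at the roots over [t0] by uniqueness; so these
    branches exhaust the fibres and stay distinct, and a shifted branch is again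
    one of them. *)
Lemma branches_exist t0 : I t0 -> exists d (Z q q' : 'I_d -> R[i] -> R[i]) s,
  (0 < d)%N /\ branches Z q q' s.
Proof.
move=> It0; pose w0 : R[i] := t0%:C.
have Iw0 : strip I w0 by [].
have [l el] := closed_field_poly_normal (P - (cexp w0)%:P).
pose r := undup l; pose d := size r.
have lead1 : lead_coef (P - (cexp w0)%:P) = 1.
  by rewrite lead_coefDl ?(monicP Pm)// size_polyN (leq_ltn_trans (size_polyC_leq1 _)).
rewrite lead1 scale1r in el.
have rootr z : P.[z] = cexp w0 <-> z \in r.
  rewrite mem_undup -root_prod_XsubC -el /root !hornerE subr_eq0.
  by split=> [->|/eqP].
have d0 : (0 < d)%N.
  have [z zw _] := root_near 0 (cexp w0) Pm Ps.
  by have := (rootr z).1 zw; rewrite /d; case: (r).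
pose rt (k : 'I_d) := nth 0 r k.
have rtw k : P.[rt k] = cexp w0 by apply/rootr; exact: mem_nth.
have Zex k := strip_section_exists Ii Pm Ps (@strip_diff_cexp I) Punr Iw0 (rtw k).
have [Z hZ] := choice Zex.
have Z0 k : Z k w0 = rt k by case: (hZ k).
have PZ k w : strip I w -> P.[Z k w] = cexp w by case: (hZ k) => _ h _; exact: h.
have Zd k : strip_diff I (Z k) (fun w => cexp w / dP (Z k w)) by case: (hZ k).
have uniq f f' k w w1 : (forall w, strip I w -> P.[f w] = cexp w) ->
    strip_diff I f f' -> strip I w1 -> f w1 = Z k w1 -> strip I w -> f w = Z k w.
  move=> fP fd Iw1 e Iw.
  exact: (strip_section_unique Ii Pm Ps (@strip_diff_cexp I) Punr fP (PZ k) fd (Zd k)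
    Iw1 Iw).
have inj w k m : strip I w -> Z k w = Z m w -> k = m.
  move=> Iw e; have := uniq _ _ _ _ _ (PZ k) (Zd k) Iw e Iw0.
  rewrite !Z0 => /eqP; rewrite nth_uniq ?undup_uniq// => /eqP; exact: val_inj.
have all w z : strip I w -> P.[z] = cexp w -> exists k, z = Z k w.
  move=> Iw zw.
  have [f [fz fP fd]] := strip_section_exists Ii Pm Ps (@strip_diff_cexp I) Punr Iw zw.
  have /rootr/(nthP 0)[k kd e] := fP _ Iw0.
  exists (Ordinal kd); rewrite -fz.
  by apply: uniq fP fd Iw0 _ Iw; rewrite Z0.
have PZ1 k w : strip I w -> P.[Z k (w + ivec (pi *+ 2))] = cexp w.
  move=> Iw; rewrite PZ ?strip_shift//; exact: (cexp_period w 1).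
have [s hs] := choice (fun k => all _ _ Iw0 (PZ1 k _ Iw0)).
have turn k w : strip I w -> Z k (w + ivec (pi *+ 2)) = Z (s k) w.
  by apply: uniq (PZ1 k) (strip_diff_shift _ (Zd k)) Iw0 (hs k).
have si : injective s.
  move=> k m e; have : Z k (w0 + ivec (pi *+ 2)) = Z m (w0 + ivec (pi *+ 2)).
    by rewrite !turn// e.
  by apply: inj; rewrite strip_shift.
have turns n k w : strip I w -> Z k (w + ivec (pi *+ 2 *+ n)) = Z (iter n s k) w.
  move=> Iw; elim: n k => [|n IH] k.
    by rewrite mulr0n ivec0 addr0.
  by rewrite mulrSr ivecD addrA turn ?strip_shift// IH -iterSr.
have qex k : exists Q : (R[i] -> R[i]) * (R[i] -> R[i]) * (R[i] -> R[i]),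
    [/\ strip_diff I (fun w => cexp w / dP (Z k w)) Q.1.1,
    strip_unramified I 'X^2 (fun w => cexp w / dP (Z k w)),
    forall w, strip I w -> Q.1.2 w ^+ 2 = cexp w / dP (Z k w) &
    strip_diff I Q.1.2 Q.2].
  have [g' [q [q' h]]] := branch_root_exists Iw0 (PZ k) (Zd k).
  by exists (g', q, q').
have [Q hQ] := choice qex.
pose q k := (Q k).1.2.
have q2 k w : strip I w -> q k w ^+ 2 = cexp w / dP (Z k w).
  by have [_ _ h _] := hQ k; exact: h.
have qd k : strip_diff I (q k) (Q k).2 by case: (hQ k).
pose m := pi *+ 2 *+ d`! : R.
have qm k w : strip I w -> q k (w + ivec m) ^+ 2 = cexp w / dP (Z k w).
  move=> Iw; rewrite q2 ?strip_shift// cexp_period turns// iter_fact//.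
have X2m : 'X^2 \is @monic R[i] by exact: monicXn.
have X2s : (1 < size ('X^2 : {poly R[i]}))%N by rewrite size_polyXn.
have quniq k f f' : (forall w, strip I w -> f w ^+ 2 = cexp w / dP (Z k w)) ->
    strip_diff I f f' ->
    f w0 = q k (w0 + ivec m) ->
    forall w, strip I w -> f w = q k (w + ivec m).
  move=> f2 fd e w Iw; have [gd gu _ _] := hQ k.
  apply: (strip_section_unique Ii X2m X2s gd gu _ _ fd (strip_diff_shift m (qd k))
    Iw0 Iw e) => z Iz; rewrite hornerXn; [exact: f2|exact: qm].
exists d, Z, q, (fun k => (Q k).2), s; split=> //; split=> //.
- move=> w z Iw; split; first exact: all.
  by move=> [k ->]; exact: PZ.
- by move=> k; apply: strip_diff_ext Ii _ _ (Zd k) => w Iw //; rewrite q2.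
- move=> k a b r' Ia Ib; have [_ gu _ _] := hQ k.
  have [e e0 he] := gu a b r' Ia Ib.
  exists ((e / 2) ^+ 2); first by rewrite exprn_gt0// divr_gt0.
  move=> w Kw; rewrite lerXn2r ?nnegrE ?normc_ge0 ?divr_ge0 ?(ltW e0)//.
  have := he (q k w) w Kw; rewrite hornerXn => /(_ (q2 _ _ (box_strip Ii Ia Ib Kw))).
  rewrite derivXn /= hornerMn hornerXn expr1 normcMn mulr2n; lra.
- move=> k w Iw; apply: (@pexpIrn _ 2) => //; rewrite ?nnegrE ?normc_ge0//.
  rewrite -!normcX !q2 ?strip_shift// turn//.
  by rewrite (cexp_period w 1).
move=> k w Iw; have -> : pi *+ 2 *+ (2 * d`!) = m + m :> R.
  by rewrite mulnC mulrnA mulr2n.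
have : q k w0 ^+ 2 = q k (w0 + ivec m) ^+ 2 by rewrite q2// qm.
move=> /eqP; rewrite eqf_sqr => /orP[/eqP e|/eqP e].
  have e1 := quniq k _ _ (q2 k) (qd k) e.
  rewrite ivecD addrA -e1; first by rewrite -e1.
  by rewrite strip_shift.
have q2N z : strip I z -> (- q k z) ^+ 2 = cexp z / dP (Z k z).
  by move=> Iz; rewrite sqrrN q2.
have e' : - q k w0 = q k (w0 + ivec m) by rewrite e opprK.
have e1 := quniq k _ _ q2N (strip_diffN (qd k)) e'.
rewrite ivecD addrA -e1; last by rewrite strip_shift.
by rewrite -e1 ?opprK.
Qed.

End Regular.
End Branches.

(** * Discrete Fourier analysis *)

Section DiscreteFourier.
Context {R : realType}.
Implicit Types (N : nat) (x y : nat -> R[i]).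

Lemma conj_cexp_ivec (t : R) : conjc (cexp (ivec t)) = cexp (ivec (- t)).
Proof. by rewrite /cexp /= expR0 !mul1r cosN sinN. Qed.

Lemma normc_sqrE (z : R[i]) : (normc z ^+ 2)%:C = z * conjc z.
Proof.
by rewrite normc_sqr; case: z => a b /=; congr Complex; ring.
Qed.

Lemma ivecMn (t : R) n : ivec (t *+ n) = ivec t *+ n.
Proof. by elim: n => [|n IH]; rewrite ?mulr0n// !mulrS ivecD IH. Qed.

Lemma normc_cexp_ivec_sub1 (t : R) :
  normc (cexp (ivec t) - 1) ^+ 2 = 2 * (1 - cos t).
Proof.
rewrite normc_sqr ReB ImB /= expR0 !mul1r subr0.
have := cos2Dsin2 t; nra.
Qed.

Lemma cexp_ivec_neq1 (t : R) : 0 < t < pi *+ 2 -> cexp (ivec t) != 1.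
Proof.
move=> /andP[t0 t2]; apply/eqP => /(congr1 (fun z => normc (z - 1) ^+ 2)).
rewrite normc_cexp_ivec_sub1 subrr normc0 expr0n/= => /eqP; rewrite mulf_eq0.
have -> : 1 - cos t = 2 * sin (t / 2) ^+ 2.
  have {1}-> : t = t / 2 *+ 2 by rewrite -mulr_natr divfK.
  by rewrite cos_mulr2n cos2sin2; ring.
rewrite mulf_eq0 expf_eq0 /= !pnatr_eq0/= gt_eqF// sin_gt0_pi//.
by rewrite divr_gt0//= ltr_pdivrMr// mulr_natr.
Qed.

Lemma geometric_sum0 N (z : R[i]) : z != 1 -> z ^+ N = 1 ->
  \sum_(j < N) z ^+ j = 0.
Proof.
move=> z1 zN; apply: (@mulfI _ (z - 1)); first by rewrite subr_eq0.
by rewrite -subrX1 zN subrr mulr0.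
Qed.

(** Unnormalised Fourier coefficient, at the frequency [m], of a sequence
    sampled at [N] equidistant points of the circle. *)
Definition dft N x (m : int) : R[i] :=
  \sum_(k < N) x k * cexp (ivec (- (m%:~R * k%:R * (pi *+ 2) / N%:R))).

(** For [k <> l] this is a geometric sum over all powers of an [N]-th root of
    unity other than [1]. *)
Lemma dft_orthogonal N (H : nat) (k l : 'I_N) :
  \sum_(j < N) cexp (ivec (- ((j%:Z - H%:Z)%:~R * k%:R * (pi *+ 2) / N%:R))) *
    conjc (cexp (ivec (- ((j%:Z - H%:Z)%:~R * l%:R * (pi *+ 2) / N%:R)))) =
  (N%:R * (k == l)%:R : R[i]).
Proof.
have N0 : N%:R != 0 :> R by rewrite pnatr_eq0 -lt0n (leq_ltn_trans _ (ltn_ord k)).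
pose a : R := (l%:R - k%:R) * (pi *+ 2) / N%:R.
transitivity (\sum_(j < N) cexp (ivec (- (H%:R * a))) * cexp (ivec a) ^+ j).
  apply: eq_bigr => j _; rewrite conj_cexp_ivec -cexpD -ivecD.
  rewrite -cexpMn -ivecMn -cexpD -ivecD; congr (cexp (ivec _)).
  by rewrite rmorphB/= -!pmulrn /a -[_ *+ j]mulr_natr; field.
have rootN (p q : 'I_N) : p != q ->
    cexp (ivec ((q%:R - p%:R) * (pi *+ 2) / N%:R)) != 1 :> R[i] /\
    cexp (ivec ((q%:R - p%:R) * (pi *+ 2) / N%:R)) ^+ N = 1 :> R[i].
  have lt_case (p' q' : 'I_N) : (p' < q')%N ->
      cexp (ivec ((q'%:R - p'%:R) * (pi *+ 2) / N%:R)) != 1 :> R[i] /\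
      cexp (ivec ((q'%:R - p'%:R) * (pi *+ 2) / N%:R)) ^+ N = 1 :> R[i].
    move=> pq; have N1 : 0 < N%:R :> R by rewrite lt_neqAle eq_sym N0 ler0n.
    have p2 : 0 < pi *+ 2 :> R by rewrite pmulrn_lgt0 ?pi_gt0.
    split.
      apply: cexp_ivec_neq1; rewrite divr_gt0 ?mulr_gt0 ?subr_gt0 ?ltr_nat//=.
      rewrite ltr_pdivrMr// mulrC ltr_pM2l// ltrBlDr -natrD ltr_nat.
      by rewrite (leq_trans (ltn_ord q')) ?leq_addr.
    rewrite -cexpMn -ivecMn -[X in ivec X]mulr_natr divfK// -natrB ?(ltnW pq)// mulr_natl.
    exact: cexp2piMn.
  move=> pq; have [pq'|qp|e] := ltngtP p q; first exact: lt_case.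
    have [h1 h2] := lt_case _ _ qp.
    have -> : cexp (ivec ((q%:R - p%:R) * (pi *+ 2) / N%:R)) =
        (cexp (ivec ((p%:R - q%:R) * (pi *+ 2) / N%:R)))^-1 :> R[i].
      rewrite -cexpN; congr cexp; congr Complex; first by rewrite oppr0.
      by rewrite -!mulNr opprB.
    by rewrite exprVn h2 invr1 invr_eq1.
  by move: pq; rewrite (val_inj e) eqxx.
rewrite -mulr_sumr; have [kl|kl] := eqVneq k l.
  have -> : a = 0 by rewrite /a kl subrr !mul0r.
  rewrite mulr0 oppr0 ivec0 cexp0 mul1r mulr1.
  by rewrite (eq_bigr (fun=> 1)) ?sumr_const ?card_ord// => j _; rewrite expr1n.
rewrite mulr0 geometric_sum0 ?mulr0//.
  by rewrite /a; case: (rootN k l kl).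
by rewrite /a; case: (rootN k l kl).
Qed.

(** Parseval's identity on the cyclic group of order [N]; the frequencies are
    represented by the integers from [- H] to [N - H - 1]. *)
Lemma dft_parseval N (H : nat) x :
  \sum_(j < N) normc (dft N x (j%:Z - H%:Z)) ^+ 2 =
  N%:R * \sum_(k < N) normc (x k) ^+ 2.
Proof.
apply: complexI; rewrite rmorph_sum rmorphM rmorph_sum/= rmorph_nat.
under eq_bigr do rewrite normc_sqrE.
pose e (m : int) (k : nat) : R[i] := cexp (ivec (- (m%:~R * k%:R * (pi *+ 2) / N%:R))).
transitivity (\sum_(j < N) \sum_(k < N) \sum_(l < N)
    x k * conjc (x l) * (e (j%:Z - H%:Z) k * conjc (e (j%:Z - H%:Z) l))).
  apply: eq_bigr => j _; rewrite /dft rmorph_sum mulr_suml; apply: eq_bigr => k _.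
  by rewrite mulr_sumr; apply: eq_bigr => l _; rewrite /e rmorphM/= mulrACA.
rewrite exchange_big/= mulr_sumr; apply: eq_bigr => k _.
rewrite exchange_big/= (bigD1 k)//= -mulr_sumr dft_orthogonal eqxx mulr1.
rewrite big1 ?addr0 => [|l lk]; last first.
  by rewrite -mulr_sumr dft_orthogonal eq_sym (negbTE lk) !mulr0.
by rewrite normc_sqrE mulrC.
Qed.

(** Summation by parts over a full period, hence without boundary terms. *)
Lemma dft_diff N x m : (0 < N)%N -> x N = x 0%N ->
  dft N (fun k => x k.+1 - x k) m =
  (cexp (ivec (m%:~R * (pi *+ 2) / N%:R)) - 1) * dft N x m.
Proof.
move=> N0 xN; have N1 : N%:R != 0 :> R by rewrite pnatr_eq0 -lt0n.
rewrite /dft; under eq_bigr do rewrite mulrBl.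
rewrite sumrB mulrBl mul1r; congr (_ - _).
pose F k := x k * cexp (ivec (- (m%:~R * k%:R * (pi *+ 2) / N%:R))).
have cexpm (i : int) : cexp (ivec (i%:~R * (pi *+ 2))) = 1 :> R[i].
  case: i => n; first by rewrite -pmulrn mulr_natl cexp2piMn.
  rewrite NegzE mulrNz mulNr -[ivec _]/(ivec _) -pmulrn mulr_natl.
  have -> : ivec (- (pi *+ 2 *+ n.+1)) = - ivec (pi *+ 2 *+ n.+1) :> R[i].
    by congr Complex; rewrite oppr0.
  by rewrite cexpN cexp2piMn invr1.
have FN : F N = F 0%N.
  rewrite /F xN mulr0 mul0r mul0r oppr0 [cexp (ivec 0)]cexp0.
  have -> : - (m%:~R * N%:R * (pi *+ 2) / N%:R) = (- m)%:~R * (pi *+ 2) :> R.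
    by rewrite mulrNz; field.
  by rewrite cexpm.
have shift : \sum_(k < N) F k.+1 = \sum_(k < N) F k.
  apply: (@addrI _ (F 0%N)); rewrite -(big_ord_recl N (fun k => F k)) big_ord_recr/=.
  by rewrite FN addrC.
rewrite -shift mulr_sumr; apply: eq_bigr => k _.
rewrite /F mulrCA -cexpD -ivecD; congr (_ * cexp (ivec _)).
by rewrite -natr1; field.
Qed.

Lemma cos_mono (x y : R) : 0 <= x -> x <= y -> y <= pi -> cos y <= cos x.
Proof.
move=> x0 xy yp; have [->//|xy'] := eqVneq x y.
have x_lt : x < y by rewrite lt_neqAle xy'.
by rewrite ltW// ltr_cos// in_itv/=; apply/andP; split=> //; lra.
Qed.

Lemma dist_center_le j H : (j < 2 * H)%N -> `|j%:Z - H%:Z| <= H%:Z.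
Proof. lia. Qed.

Lemma le_dist_center j H M : (j + M < H)%N || (H + M <= j)%N ->
  M%:Z <= `|j%:Z - H%:Z|.
Proof. lia. Qed.

(** High frequencies carry little energy: differencing multiplies them by a
    factor of order at least [M / N], while the increments are of order
    [1 / N]. *)
Lemma dft_tail : exists2 x0 : R, 0 < x0 &
  forall H M x (B : R), let N := (2 * H)%N in
  (0 < M)%N -> (0 < H)%N -> M%:R * (pi *+ 2) / N%:R <= x0 -> x N = x 0%N ->
  (forall k, (k < N)%N -> normc (x k.+1 - x k) <= B) ->
  \sum_(j < N | (j + M < H)%N || (H + M <= j)%N)
     normc (dft N x (j%:Z - H%:Z)) ^+ 2 <= N%:R ^+ 4 * B ^+ 2 / M%:R ^+ 2.
Proof.
have [A A0 hA] := @cexp_taylor R 0.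
exists (Num.min pi (2 * A)^-1); first by rewrite lt_min pi_gt0 invr_gt0 mulr_gt0.
move=> H M x B N M0 H0 xle xN xB.
have N0 : (0 < N)%N by rewrite muln_gt0.
have N1 : 0 < N%:R :> R by rewrite ltr0n.
have p0 := @pi_gt0 R; have p2 := @pi_ge2 R.
have pp0 : 0 <= pi *+ 2 :> R by rewrite mulrn_wge0 ?pi_ge0.
pose u : R := M%:R * (pi *+ 2) / N%:R.
have u0 : 0 < u by rewrite divr_gt0// mulr_gt0 ?ltr0n// pmulrn_lgt0.
have up : u <= pi by rewrite (le_trans xle)// ge_min lexx.
have uA : u <= (2 * A)^-1 by rewrite (le_trans xle)// ge_min lexx orbT.
have c1 : (u / 2) ^+ 2 <= 2 * (1 - cos u).
  have u2 : 0 <= u / 2 by apply: divr_ge0 => //; exact: ltW.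
  rewrite -normc_cexp_ivec_sub1 lerXn2r ?nnegrE ?normc_ge0 ?u2//.
  have [|_] := hA (ivec u); first by rewrite normr0.
  rewrite normcRi (ger0_norm (ltW u0)) normc_distC => h.
  have := normc_dist_le (ivec u) (cexp (ivec u) - 1).
  rewrite normcRi (ger0_norm (ltW u0)).
  have : A * u ^+ 2 <= u / 2.
    have uA' : u * (2 * A) <= 1 by rewrite -ler_pdivlMr ?mulr_gt0// mul1r.
    by have := ler_wpM2r (ltW u0) uA'; rewrite mul1r expr2; lra.
  lra.
have c2 (j : 'I_N) : (j + M < H)%N || (H + M <= j)%N ->
    cos ((j%:Z - H%:Z)%:~R * (pi *+ 2) / N%:R) <= cos u.
  move=> jM; pose D : R := `|(j%:Z - H%:Z)%:~R|.
  have ND : D <= H%:R.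
    by rewrite /D -intr_norm -[leRHS]/(H%:Z%:~R) ler_int dist_center_le.
  have MD : M%:R <= D.
    by rewrite /D -intr_norm -[leLHS]/(M%:Z%:~R) ler_int le_dist_center.
  have -> : cos ((j%:Z - H%:Z)%:~R * (pi *+ 2) / N%:R) = cos (D * (pi *+ 2) / N%:R) :> R.
    rewrite -cos_norm normrM normrM (@ger0_norm _ (pi *+ 2))//.
    by rewrite (@ger0_norm _ N%:R^-1) ?invr_ge0 ?ler0n.
  apply: cos_mono; first exact: ltW.
    by rewrite ler_wpM2r ?invr_ge0 ?(ltW N1)// ler_wpM2r.
  rewrite ler_pdivrMr// /N natrM -[pi *+ 2]mulr_natr.
  by have := ler_wpM2l (ltW p0) ND; lra.
pose y k := x k.+1 - x k.
have E : \sum_(j < N) normc (dft N y (j%:Z - H%:Z)) ^+ 2 <= N%:R ^+ 2 * B ^+ 2.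
  rewrite dft_parseval expr2 -mulrA ler_wpM2l//.
  rewrite (le_trans (ler_sum _ (_ : forall k : 'I_N, true -> _ <= B ^+ 2)))//.
    move=> k _; rewrite lerXn2r ?nnegrE ?normc_ge0//; last exact: xB.
    by rewrite (le_trans (normc_ge0 _) (xB k _)).
  by rewrite sumr_const card_ord mulr_natl.
rewrite ler_pdivlMr ?exprn_gt0 ?ltr0n//.
have c3 (j : 'I_N) : (j + M < H)%N || (H + M <= j)%N ->
    normc (dft N x (j%:Z - H%:Z)) ^+ 2 * (u / 2) ^+ 2 <=
    normc (dft N y (j%:Z - H%:Z)) ^+ 2.
  move=> jM; rewrite dft_diff// normcM [in leRHS]exprMn [leLHS]mulrC.
  rewrite ler_wpM2r ?exprn_ge0 ?normc_ge0//.
  rewrite (le_trans c1)// normc_cexp_ivec_sub1 ler_wpM2l// lerD2l lerN2.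
  exact: c2.
set S := \sum_(j < N | _) _.
have S1 : S * (u / 2) ^+ 2 <= N%:R ^+ 2 * B ^+ 2.
  rewrite (le_trans _ E)// mulr_suml (le_trans (ler_sum _ c3))//.
  rewrite [leRHS](bigID (fun j : 'I_N => (j + M < H)%N || (H + M <= j)%N))/= lerDl.
  by rewrite sumr_ge0// => j _; rewrite exprn_ge0 ?normc_ge0.
have S0 : 0 <= S by rewrite sumr_ge0// => j _; rewrite exprn_ge0 ?normc_ge0.
have uE : (u / 2) = M%:R * pi / N%:R by rewrite /u -mulr_natr; field; rewrite gt_eqF.
have M2 : M%:R ^+ 2 <= (u / 2) ^+ 2 * N%:R ^+ 2.
  have uN : u / 2 * N%:R = M%:R * pi by rewrite uE divfK ?gt_eqF.
  have Mp : M%:R <= M%:R * pi :> R by rewrite ler_peMr//; lra.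
  by rewrite -exprMn uN lerXn2r ?nnegrE ?ler0n// (le_trans _ Mp).
have := ler_wpM2l S0 M2.
have := ler_wpM2r (exprn_ge0 2 (ltW N1)) S1.
lra.
Qed.

End DiscreteFourier.

(** * Means over equidistant points of a vertical period *)

Section Sequences.
Context {R : realType}.

Lemma pow2_large (x : R) : exists r0, forall r, (r0 <= r)%N -> x <= 2 ^+ r.
Proof.
exists (Num.truncn `|x|).+1 => r r0.
rewrite (le_trans (ler_norm _))// (le_trans (ltW (truncnS_gt _)))//.
rewrite -natrX ler_nat (leq_trans r0)// ltnW//.
exact: ltn_expl.
Qed.

(** The sequences [u r - 2 A / 2^r] and [u r + 2 A / 2^r] are monotone in
    opposite directions; the limit is the supremum of the first. *)
Lemma geometric_cauchy (u : nat -> R) (A : R) :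
  (forall r, `|u r.+1 - u r| <= A / 2 ^+ r) ->
  exists l, forall r, `|u r - l| <= 2 * A / 2 ^+ r.
Proof.
move=> uA; have A0 : 0 <= A.
  by have := le_trans (normr_ge0 _) (uA 0%N); rewrite expr0 divr1.
pose v r := u r - 2 * A / 2 ^+ r; pose w r := u r + 2 * A / 2 ^+ r.
have e2 r : 2 * A / 2 ^+ r = A / 2 ^+ r + 2 * A / 2 ^+ r.+1.
  by rewrite exprS; field; rewrite expf_neq0.
have v1 r : v r <= v r.+1.
  by rewrite /v (e2 r); have := uA r; rewrite ler_norml => /andP[+ _]; lra.
have w1 r : w r.+1 <= w r.
  by rewrite /w (e2 r); have := uA r; rewrite ler_norml => /andP[_ +]; lra.
have vw r : v r <= w r.
  rewrite /v /w; have : 0 <= 2 * A / 2 ^+ r by rewrite divr_ge0 ?mulr_ge0 ?exprn_ge0.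
  lra.
have vn r s : (r <= s)%N -> v r <= v s.
  by move=> rs; apply: (homo_leq (@lexx _ R) (@le_trans _ R)) => //.
have wn r s : (r <= s)%N -> w s <= w r.
  move=> rs; apply: (homo_leq (fun x => lexx x) (fun y x z xy yz => le_trans yz xy)) rs => //.
have vwrs r s : v r <= w s.
  by rewrite (le_trans (vn _ _ (leq_maxl r s)))// (le_trans (vw _))// wn// leq_maxr.
pose E := [set v r | r in [set: nat]].
have hE : has_sup E.
  by split; [exists (v 0%N), 0%N|exists (w 0%N) => _ [r _ <-]].
exists (sup E) => r.
have h1 : v r <= sup E by apply: ub_le_sup; [exact: hE.2|exists r].
have h2 : sup E <= w r by apply: ge_sup; [exact: hE.1|move=> _ [s _ <-]].
by rewrite ler_norml; move: h1 h2; rewrite /v /w => h1 h2; apply/andP; split; lra.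
Qed.

Lemma sqr_normc_dist (x y : R[i]) (A : R) : normc x <= A -> normc y <= A ->
  `|normc x ^+ 2 - normc y ^+ 2| <= 2 * A * normc (x - y).
Proof.
move=> xA yA; rewrite subr_sqr normrM mulrC ler_pM//.
  rewrite ger0_norm ?addr_ge0 ?normc_ge0//; lra.
rewrite ler_norml; have := normc_dist_le x y; have := normc_dist_le y x.
by rewrite (normc_distC y) => ? ?; apply/andP; split; lra.
Qed.

End Sequences.

Section Means.
Context {R : realType}.
Implicit Types (F : R[i] -> R[i]) (N : nat) (t : R).

Definition mean (L : R) N F t : R[i] :=
  (N%:R^-1)%:C * \sum_(k < N) F (Complex t (L * k%:R / N%:R)).

Lemma ivecE (h : R) : ivec h = ivec 1 * h%:C.
Proof. by congr Complex; rewrite ?mul0r ?mul1r ?mulr0 ?subr0 ?add0r. Qed.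

Lemma normc_mean_le L N F t (A : R) : (0 < N)%N ->
  (forall k, (k < N)%N -> normc (F (Complex t (L * k%:R / N%:R))) <= A) ->
  normc (mean L N F t) <= A.
Proof.
move=> N0 FA; have N1 : 0 < N%:R :> R by rewrite ltr0n.
rewrite normcM normcR ger0_norm ?invr_ge0 ?ler0n// ler_pdivrMl//.
rewrite (le_trans (normc_sum _ _))//.
rewrite (le_trans (ler_sum _ (_ : forall k : 'I_N, true -> _ <= A)))//.
  by move=> k _; apply: FA.
by rewrite sumr_const card_ord mulr_natl.
Qed.

Lemma meanB L N F t t' : mean L N F t' - mean L N F t =
  (N%:R^-1)%:C * \sum_(k < N) (F (Complex t' (L * k%:R / N%:R)) -
    F (Complex t (L * k%:R / N%:R))).
Proof. by rewrite sumrB mulrBr. Qed.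

Section Periodic.
Variables (I : set R) (F F' : R[i] -> R[i]) (L : R).
Hypotheses (Fd : strip_diff I F F') (L0 : 0 < L).
Hypothesis Fper : forall w, strip I w -> F (w + ivec L) = F w.
Variables (a b : R).
Hypotheses (Ia : I a) (Ib : I b) (Ii : is_interval I).

Let pbox t N k : a <= t <= b -> (k <= N)%N ->
  box a b L (Complex t (L * k%:R / N%:R)).
Proof.
move=> tab kN; split=> //=; have [->|N0] := posnP N.
  by rewrite invr0 mulr0 normr0 ltW.
have N1 : 0 < N%:R :> R by rewrite ltr0n.
rewrite ger0_norm ?divr_ge0 ?mulr_ge0 ?(ltW L0) ?ler0n//.
by rewrite ler_pdivrMr// ler_wpM2l ?(ltW L0)// ler_nat.
Qed.

(** A Cauchy-Riemann computation: the increments of [F] by a step to the right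
    and by a step upwards differ by the factor [i] up to second order, and the
    latter add up to zero over a period. *)
Lemma mean_step : exists2 A : R, 0 <= A & forall N t, (0 < N)%N -> a <= t ->
  t + L / N%:R <= b ->
  normc (mean L N F (t + L / N%:R) - mean L N F t) <= A * (L / N%:R) ^+ 2.
Proof.
have [A A0 hA] := Fd L Ia Ib.
exists (A + A) => [|N t N0 at_ tb]; first by rewrite addr_ge0.
have N1 : 0 < N%:R :> R by rewrite ltr0n.
set h := L / N%:R in tb *; have h0 : 0 < h by rewrite divr_gt0.
have tab : a <= t <= b by apply/andP; split => //; lra.
have tab' : a <= t + h <= b by apply/andP; split => //; lra.
pose p k := Complex t (L * k%:R / N%:R).
pose p' k := Complex (t + h) (L * k%:R / N%:R).
have pp' k : p' k - p k = h%:C.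
  by congr Complex; rewrite ?subrr// addrAC subrr add0r.
have pS k : p k.+1 - p k = ivec h.
  congr Complex; first by rewrite subrr.
  by rewrite -natr1 mulrDr mulrDl mulr1 addrAC subrr add0r.
have ii : ivec 1 * ivec 1 = -1 :> R[i].
  by rewrite -expr2; exact: sqr_i.
pose D1 k := F (p' k) - F (p k) - F' (p k) * (p' k - p k).
pose D2 k := F (p k.+1) - F (p k) - F' (p k) * (p k.+1 - p k).
have D1A k : (k < N)%N -> normc (D1 k) <= A * h ^+ 2.
  move=> kN; have [_ _ _] := hA _ _ (pbox tab (ltnW kN)) (pbox tab' (ltnW kN)).
  by rewrite -/(p k) -/(p' k) -/(D1 k) pp' normcR ger0_norm ?(ltW h0).
have D2A k : (k < N)%N -> normc (D2 k) <= A * h ^+ 2.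
  move=> kN; have [_ _ _] := hA _ _ (pbox tab (ltnW kN)) (pbox tab kN).
  by rewrite -/(p k) -/(p k.+1) -/(D2 k) pS normcRi ger0_norm ?(ltW h0).
have tel : \sum_(k < N) (F (p k.+1) - F (p k)) = 0.
  rewrite -(big_mkord xpredT (fun k => F (p k.+1) - F (p k))) telescope_sumr//.
  have -> : p N = p 0%N + ivec L.
    by rewrite /p mulfK ?gt_eqF// mulr0 mul0r; congr Complex; rewrite ?addr0 ?add0r.
  by rewrite Fper ?subrr//; exact: Ii Ia Ib _ tab.
rewrite meanB normcM normcR ger0_norm ?invr_ge0 ?ler0n// ler_pdivrMl//.
have -> : \sum_(k < N) (F (p' k) - F (p k)) = \sum_(k < N) (D1 k + ivec 1 * D2 k).
  transitivity (\sum_(k < N) (F (p' k) - F (p k)) +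
      ivec 1 * \sum_(k < N) (F (p k.+1) - F (p k))).
    by rewrite tel mulr0 addr0.
  rewrite mulr_sumr -big_split/=.
  apply: eq_bigr => k _; rewrite /D1 /D2 pp' pS (ivecE h).
  rewrite [ivec 1 * (_ - _ - _)]mulrBr.
  have -> : ivec 1 * (F' (p k) * (ivec 1 * h%:C)) = - (F' (p k) * h%:C).
    by rewrite mulrCA mulrA mulrA -[F' _ * _ * _]mulrA ii mulrN1 mulNr.
  ring.
rewrite (le_trans (normc_sum _ _))//.
rewrite (le_trans (ler_sum _ (_ : forall k : 'I_N, true -> _ <= (A + A) * h ^+ 2)))//.
  move=> k _; rewrite (le_trans (le_normcD _ _))// mulrDl lerD ?D1A//.
  by rewrite normcM normcRi normr1 mul1r D2A.
by rewrite sumr_const card_ord mulr_natl.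
Qed.

Lemma mean_bounded : exists2 A : R, 0 <= A & forall N t, (0 < N)%N ->
  a <= t <= b -> normc (mean L N F t) <= A.
Proof.
have [A A0 hA] := unif_diff_bounded (Fd L Ia Ib); exists A => // N t N0 tab.
by apply: normc_mean_le => // k kN; have [] := hA _ (pbox tab (ltnW kN)).
Qed.

Lemma mean_lipschitz : exists2 A : R, 0 <= A & forall N t t', (0 < N)%N ->
  a <= t <= b -> a <= t' <= b ->
  normc (mean L N F t' - mean L N F t) <= A * `|t' - t|.
Proof.
have [A A0 hA] := Fd L Ia Ib; exists A => // N t t' N0 tab tab'.
have N1 : 0 < N%:R :> R by rewrite ltr0n.
rewrite meanB normcM normcR ger0_norm ?invr_ge0 ?ler0n// ler_pdivrMl//.
rewrite (le_trans (normc_sum _ _))//.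
rewrite (le_trans (ler_sum _ (_ : forall k : 'I_N, true -> _ <= A * `|t' - t|)))//.
  move=> k _; have [_ _ h _] := hA _ _ (pbox tab (ltnW (ltn_ord k)))
    (pbox tab' (ltnW (ltn_ord k))).
  rewrite (le_trans h)//; set z := _ - _.
  have -> : z = (t' - t)%:C by congr Complex; rewrite subrr.
  by rewrite normcR.
by rewrite sumr_const card_ord mulr_natl.
Qed.

(** Discrete form of Cauchy's theorem: the steps of length [L / N] leading from
    [t] to [t'] cost [O(1/N^2)] each, and there are [O(N)] of them. *)
Lemma mean_const : exists2 A : R, 0 <= A & forall N t t', (0 < N)%N ->
  a <= t <= b -> a <= t' <= b ->
  normc (mean L N F t' - mean L N F t) <= A / N%:R.
Proof.
have [A1 A10 h1] := mean_step; have [A2 A20 h2] := mean_lipschitz.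
have Cge0 : 0 <= (`|b - a| * A1 + A2) * L.
  by rewrite mulr_ge0 ?addr_ge0 ?mulr_ge0// ltW.
exists ((`|b - a| * A1 + A2) * L) => // N t t' N0.
wlog tt' : t t' / t <= t'.
  move=> H tab tab'; have [|/ltW] := leP t t' => h; first exact: H.
  by rewrite normc_distC H.
move=> /andP[a1 b1] /andP[a2 b2].
have N1 : 0 < N%:R :> R by rewrite ltr0n.
set h := L / N%:R; have h0 : 0 < h by rewrite divr_gt0.
have chain j : t + h *+ j <= b ->
    normc (mean L N F (t + h *+ j) - mean L N F t) <= j%:R * (A1 * h ^+ 2).
  elim: j => [|j IH] tj; first by rewrite mulr0n addr0 subrr normc0 mul0r.
  have tj' : t + h *+ j + h <= b by rewrite -addrA -mulrSr.
  have hj : 0 <= h *+ j by rewrite mulrn_wge0 ?ltW.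
  rewrite (le_trans (normc_split (mean L N F (t + h *+ j)) _ _))//.
  rewrite -natr1 mulrDl mul1r addrC lerD//; first by apply: IH; lra.
  by rewrite mulrSr addrA h1//; lra.
pose j := Num.truncn ((t' - t) / h).
have /andP[j1 j2] : j%:R <= (t' - t) / h < j.+1%:R.
  by apply: truncn_itv; rewrite divr_ge0 ?(ltW h0)// subr_ge0.
rewrite ler_pdivlMr// in j1; rewrite ltr_pdivrMr// in j2.
have jh : h *+ j = j%:R * h by rewrite mulr_natl.
have hj : 0 <= j%:R * h by rewrite mulr_ge0 ?ler0n ?ltW.
have s1 : t' - (t + h *+ j) <= h by rewrite jh; move: j2; rewrite -natr1; lra.
have s2 : 0 <= t' - (t + h *+ j) by rewrite jh; lra.
rewrite (le_trans (normc_split (mean L N F (t + h *+ j)) _ _))//.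
have c1 := chain j; have c2 := h2 N (t + h *+ j) t' N0.
rewrite (ger0_norm s2) in c2.
have {}c1 : normc (mean L N F (t + h *+ j) - mean L N F t) <= j%:R * (A1 * h ^+ 2).
  by apply: c1; rewrite jh; lra.
have {}c2 : normc (mean L N F t' - mean L N F (t + h *+ j)) <=
    A2 * (t' - (t + h *+ j)).
  by apply: c2; rewrite ?a2 ?b2//; apply/andP; split; rewrite jh; lra.
have c3 : j%:R * (A1 * h ^+ 2) <= `|b - a| * A1 * h.
  have -> : j%:R * (A1 * h ^+ 2) = j%:R * h * (A1 * h) by ring.
  have Ah0 : 0 <= A1 * h by exact: mulr_ge0 A10 (ltW h0).
  rewrite -[leRHS]mulrA ler_wpM2r//.
  by have := ler_norm (b - a); move: j1; rewrite -/h; lra.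
have c4 : A2 * (t' - (t + h *+ j)) <= A2 * h by rewrite ler_wpM2l.
by rewrite -mulrA -/h mulrDl; lra.
Qed.

(** Makes the means converge when [N] runs through the powers of [2], without an
    integral as the limit given in advance. *)
Lemma mean_double : exists2 A : R, 0 <= A & forall N t, (0 < N)%N ->
  a <= t <= b -> normc (mean L (N * 2) F t - mean L N F t) <= A / N%:R.
Proof.
have [A A0 hA] := Fd L Ia Ib; exists (A * L); first exact: mulr_ge0 A0 (ltW L0).
move=> N t N0 tab.
have N1 : 0 < N%:R :> R by rewrite ltr0n.
have N2 : (0 < N * 2)%N by rewrite muln_gt0 N0.
have pair_sum (G : nat -> R[i]) n :
    \sum_(k < n * 2) G k = \sum_(k < n) (G (k * 2)%N + G (k * 2).+1).
  elim: n => [|n IH]; first by rewrite mul0n !big_ord0.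
  by rewrite mulSn !addSn add0n !big_ord_recr/= IH addrA.
pose p k := Complex t (L * k%:R / N%:R).
pose p' k := Complex t (L * (k * 2).+1%:R / (N * 2)%:R).
have h0 : 0 <= L / (N * 2)%:R by rewrite divr_ge0 ?ler0n ?(ltW L0).
have pp' k : p' k - p k = ivec (L / (N * 2)%:R).
  congr Complex; first by rewrite subrr.
  by rewrite -natr1 !natrM; field; rewrite gt_eqF.
have pe k : Complex t (L * (k * 2)%:R / (N * 2)%:R) = p k.
  by congr Complex; rewrite !natrM; field; rewrite gt_eqF.
have -> : mean L (N * 2) F t - mean L N F t =
    ((N * 2)%:R^-1)%:C * \sum_(k < N) (F (p' k) - F (p k)).
  rewrite /mean (pair_sum (fun k => F (Complex t (L * k%:R / (N * 2)%:R)))).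
  have -> : (N%:R^-1)%:C = ((N * 2)%:R^-1)%:C *+ 2 :> R[i].
    by rewrite -rmorphMn/= -mulr_natr natrM; congr (_%:C); field; rewrite gt_eqF.
  rewrite mulrnAl -mulrnAr -mulrBr -sumrMnl -sumrB; congr (_ * _).
  by apply: eq_bigr => k _; rewrite pe -/(p k) -/(p' k) mulr2n; ring.
rewrite normcM normcR ger0_norm ?invr_ge0 ?ler0n// ler_pdivrMl ?ltr0n//.
rewrite (le_trans (normc_sum _ _))//.
rewrite (le_trans (ler_sum _ (_ : forall k : 'I_N, true -> _ <= A * (L / N%:R))))//.
  move=> k _; have kN : ((k * 2).+1 <= N * 2)%N by have := ltn_ord k; lia.
  have [_ _ h _] := hA _ _ (pbox tab (ltnW (ltn_ord k))) (pbox tab kN).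
  rewrite (le_trans h)// -/(p k) -/(p' k) pp' normcRi ger0_norm// ler_wpM2l//.
  by rewrite ler_wpM2l ?(ltW L0)// lef_pV2 ?posrE ?ltr0n// ler_nat leq_pmulr.
rewrite sumr_const card_ord -[leLHS]mulr_natl natrM.
have := mulr_ge0 A0 (ltW L0).
have -> : N%:R * (A * (L / N%:R)) = A * L by field; rewrite gt_eqF.
have -> : N%:R * 2 * (A * L / N%:R) = 2 * (A * L) by field; rewrite gt_eqF.
lra.
Qed.

End Periodic.
End Means.

(** * Fourier coefficients of a periodic function on a strip *)

Lemma window_sum {R : realType} (G : int -> R) M H : (M <= H)%N ->
  \sum_(j < 2 * H | ~~ ((j + M < H)%N || (H + M <= j)%N)) G (j%:Z - H%:Z) =
  \sum_(j < 2 * M) G (j%:Z - M%:Z).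
Proof.
move=> MH.
rewrite -(big_mkord (fun j => ~~ ((j + M < H)%N || (H + M <= j)%N))
  (fun j => G (j%:Z - H%:Z)))/=.
rewrite -(big_mkord xpredT (fun j => G (j%:Z - M%:Z))).
rewrite (@big_cat_nat _ _ _ (H - M)%N)//=; last by lia.
rewrite (@big_cat_nat _ _ _ (H + M)%N (H - M)%N)//=; try by lia.
rewrite big_nat_cond big_pred0 ?add0r; last by move=> j; lia.
rewrite [X in _ + X]big_nat_cond [X in _ + X]big_pred0 ?addr0; last by move=> j; lia.
rewrite big_nat_cond (eq_bigl (fun j => (H - M <= j < H + M)%N && true)); last first.
  by move=> j; lia.
rewrite -big_nat_cond -{1}(add0n (H - M)%N) big_addn.
have -> : (H + M - (H - M) = 2 * M)%N by lia.
by apply: eq_bigr => j _; congr G; lia.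
Qed.

Section FourierCoefficients.
Context {R : realType}.
Variables (I : set R) (f f' : R[i] -> R[i]) (Q : nat).
Hypotheses (Ii : is_interval I) (fd : strip_diff I f f') (Q0 : (0 < Q)%N).

Let L : R := pi *+ 2 *+ Q.
Hypothesis fper : forall w, strip I w -> f (w + ivec L) = f w.

Let L0 : 0 < L. Proof. by rewrite /L pmulrn_lgt0// pmulrn_lgt0// pi_gt0. Qed.

Let freq (m : int) : R := m%:~R / Q%:R.

(** The exponential factor turns the Fourier coefficient of [f] at the frequency
    [m] into a mean value, to which [mean_const] applies. *)
Definition mode (m : int) (w : R[i]) : R[i] := f w * cexp ((- freq m)%:C * w).

Lemma mode_diff m : exists h, strip_diff I (mode m) h.
Proof.
pose c : R[i] := (- freq m)%:C.
exists (fun w => f' w * cexp (c * w) + f w * (cexp (c * w) * (0 * w + c * 1))).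
move=> a b r Ia Ib; apply: unif_diffM; first exact: fd.
have [B hB] := @box_bounded R a b r.
have ud := unif_diffM (unif_diff_cst (box a b r) c) (unif_diff_id hB).
apply: (unif_diff_comp (K' := [set z | normc z <= normc c * B])) ud _.
  by move=> w /hB wB; rewrite /= normcM ler_wpM2l ?normc_ge0.
by apply: unif_diff_cexp => w /= h; exact: le_trans (Re_le_normc w) h.
Qed.

Lemma mode_period m w : strip I w -> mode m (w + ivec L) = mode m w.
Proof.
move=> Iw; rewrite /mode fper// mulrDr cexpD.
have -> : (- freq m)%:C * ivec L = - ivec (pi *+ 2 * m%:~R).
  congr Complex; first by rewrite !(mulr0, mul0r) subr0 oppr0.
  rewrite mul0r addr0 mulNr; congr (- _).
  by rewrite /freq /L -[_ *+ Q]mulr_natl; field; rewrite pnatr_eq0 -lt0n.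
suff -> : cexp (- ivec (pi *+ 2 * m%:~R)) = 1 :> R[i] by rewrite mulr1.
rewrite cexpN; case: m => n; first by rewrite -pmulrn mulr_natr cexp2piMn invr1.
rewrite NegzE mulrNz mulrN -pmulrn mulr_natr.
have -> : ivec (- (pi *+ 2 *+ n.+1)) = - ivec (pi *+ 2 *+ n.+1) :> R[i].
  by congr Complex; rewrite oppr0.
by rewrite cexpN cexp2piMn !invr1.
Qed.

Let sample N (t : R) (k : nat) : R[i] := f (Complex t (L * k%:R / N%:R)).

Lemma mode_dft N m t : (0 < N)%N ->
  expR (2 * freq m * t) * normc (mean L N (mode m) t) ^+ 2 =
  normc (dft N (sample N t) m) ^+ 2 / N%:R ^+ 2.
Proof.
move=> N0; have N1 : N%:R != 0 :> R by rewrite pnatr_eq0 -lt0n.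
have Q1 : Q%:R != 0 :> R by rewrite pnatr_eq0 -lt0n.
have -> : mean L N (mode m) t =
    (N%:R^-1)%:C * (cexp ((- freq m * t)%:C) * dft N (sample N t) m).
  congr (_ * _); rewrite /dft mulr_sumr; apply: eq_bigr => k _.
  rewrite /mode -/(sample N t k) mulrCA -cexpD; congr (_ * cexp _).
  congr Complex; first by rewrite mul0r subr0 addr0.
  rewrite mul0r addr0 add0r mulNr; congr (- _).
  by rewrite /freq /L -[_ *+ Q]mulr_natl; field; rewrite N1 Q1.
rewrite !normcM normc_cexp normcR ger0_norm ?invr_ge0 ?ler0n// !exprMn /=.
have -> : expR (2 * freq m * t) = (expR (- freq m * t) ^+ 2)^-1.
  by rewrite -expRM_natr -expRN; congr expR; ring.
by field; rewrite N1 gt_eqF ?expR_gt0.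
Qed.

(** The mean of [mode m] does not depend on [t] in the limit, and [c m] is the
    limit of its squared modulus at [t0]; hence the squared Fourier coefficient
    of [f] over the abscissa [t] is [c m * expR (2 m t / Q)]. Parseval's identity
    and the estimate of the tail do the rest. *)
Lemma fourier_coefficients t0 : I t0 -> exists c : int -> R,
  (forall m, 0 <= c m) /\
  forall t, I t -> exists2 B : R, 0 <= B & forall M (e : R), (0 < M)%N -> 0 < e ->
    exists r0, forall r N, (r0 <= r)%N -> N = (Q * 2 ^ r)%N ->
      `|N%:R^-1 * (\sum_(k < N) normc (sample N t k) ^+ 2) -
        \sum_(j < 2 * M) c (j%:Z - M%:Z) *
          expR ((j%:Z - M%:Z)%:~R * (2 / Q%:R * t))| <= B / M%:R ^+ 2 + e.
Proof.
move=> It0.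
pose Nr r := (Q * 2 ^ r)%N.
have Nr0 r : (0 < Nr r)%N by rewrite muln_gt0 Q0 expn_gt0.
have Nr2 r : 2 ^+ r <= (Nr r)%:R :> R.
  by rewrite natrM natrX ler_peMl ?exprn_ge0// ler1n.
have NrV r (A : R) : 0 <= A -> A / (Nr r)%:R <= A / 2 ^+ r.
  by move=> A0; rewrite ler_wpM2l// lef_pV2 ?posrE ?exprn_gt0 ?ltr0n.
pose u m r := normc (mean L (Nr r) (mode m) t0) ^+ 2.
have cex m : exists c, 0 <= c /\ forall a b, I a -> I b -> a <= t0 <= b ->
    exists2 A, 0 <= A & forall t r, a <= t <= b ->
      `|normc (mean L (Nr r) (mode m) t) ^+ 2 - c| <= A / 2 ^+ r.
  have [h hd] := mode_diff m; have hp := @mode_period m.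
  have [A1 A10 h1] := mean_bounded hd L0 It0 It0.
  have [A2 A20 h2] := mean_double hd L0 It0 It0.
  have t00 : t0 <= t0 <= t0 by rewrite lexx.
  have [r|c hc] := @geometric_cauchy R (u m) (2 * A1 * A2).
    rewrite /u (le_trans (sqr_normc_dist (h1 _ _ (Nr0 _) t00) (h1 _ _ (Nr0 _) t00)))//.
    rewrite -[leRHS]mulrA ler_wpM2l ?mulr_ge0// (le_trans _ (NrV _ _ A20))//.
    by rewrite /Nr expnSr mulnA h2// -/(Nr r).
  exists c; split.
    rewrite leNgt; apply/negP => c0.
    have [r0 /(_ r0 (leqnn _)) hr0] := pow2_large (4 * A1 * A2 / - c + 1).
    have := hc r0; rewrite ler_norml => /andP[_].
    have p2 : 0 < 2 ^+ r0 :> R by rewrite exprn_gt0.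
    rewrite ler_pdivlMr//; have : 0 <= u m r0 by rewrite exprn_ge0 ?normc_ge0.
    have cN : - c != 0 by rewrite oppr_eq0 lt_eqF.
    have : (4 * A1 * A2 / - c + 1) * - c <= 2 ^+ r0 * - c.
      by rewrite ler_wpM2r// oppr_ge0 ltW.
    rewrite mulrDl divfK// mul1r => k1 k2 k3.
    have := mulr_ge0 k2 (ltW p2); lra.
  move=> a b Ia Ib tab.
  have [A3 A30 h3] := mean_bounded hd L0 Ia Ib.
  have [A4 A40 h4] := mean_const hd L0 hp Ia Ib Ii.
  exists (2 * A3 * A4 + 2 * (2 * A1 * A2)).
    by rewrite addr_ge0 ?mulr_ge0.
  move=> t r tab'; have := hc r; rewrite /u => hcr.
  rewrite -[X in `|X|](subrKA (normc (mean L (Nr r) (mode m) t0) ^+ 2)).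
  rewrite (le_trans (ler_normD _ _))// mulrDl lerD//.
  rewrite (le_trans (sqr_normc_dist (h3 _ _ (Nr0 _) tab') (h3 _ _ (Nr0 _) tab)))//.
  rewrite -[leRHS]mulrA ler_wpM2l ?mulr_ge0// (le_trans _ (NrV _ _ A40))//.
  exact: h4.
have [c hc] := choice cex.
exists c; split=> [m|t It]; first by case: (hc m).
pose a := Num.min t0 t; pose b := Num.max t0 t.
have Ia : I a by rewrite /a /Num.min; case: ifP.
have Ib : I b by rewrite /b /Num.max; case: ifP.
have tab0 : a <= t0 <= b by rewrite ge_min le_max lexx.
have tab : a <= t <= b by rewrite ge_min le_max lexx !orbT.
have errex m : exists2 A, 0 <= A & forall r,
    `|normc (mean L (Nr r) (mode m) t) ^+ 2 - c m| <= A / 2 ^+ r.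
  have [_ h] := hc m; have [A A0 hA] := h a b Ia Ib tab0.
  by exists A => // r; exact: hA.
have [Ae Ae0 hAe] : exists2 Ae : int -> R, forall m, 0 <= Ae m & forall m r,
    `|normc (mean L (Nr r) (mode m) t) ^+ 2 - c m| <= Ae m / 2 ^+ r.
  have ex m : exists A, 0 <= A /\ forall r,
    `|normc (mean L (Nr r) (mode m) t) ^+ 2 - c m| <= A / 2 ^+ r.
    by have [A] := errex m; exists A.
  have [Ae h] := choice ex.
  by exists Ae => m; have [] := h m.
have [Af Af0 hAf] := fd L Ia Ib.
have [x0 x00 tail] := @dft_tail R.
exists (Af ^+ 2 * L ^+ 2); first by rewrite mulr_ge0 ?exprn_ge0 ?(ltW L0).
move=> M e M0 e0.
pose E := \sum_(j < 2 * M) expR (2 * freq (j%:Z - M%:Z) * t) * Ae (j%:Z - M%:Z).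
have [r1 hr1] := pow2_large (E / e).
have [r2 hr2] := pow2_large (M%:R * (pi *+ 2) / x0 : R).
exists (r1 + r2 + M).+1 => r N rr NE; rewrite -/(Nr r) in NE.
have N0 : (0 < N)%N by rewrite NE.
have N1 : 0 < N%:R :> R by rewrite ltr0n.
case: r => [//|r] in rr NE *.
pose H := (Q * 2 ^ r)%N.
have NH : N = (2 * H)%N by rewrite NE /Nr /H expnS mulnCA.
have H0 : (0 < H)%N by rewrite muln_gt0 Q0 expn_gt0.
have MH : (M <= H)%N.
  rewrite (@leq_trans (2 ^ r))//; last by rewrite leq_pmull.
  rewrite (leq_trans _ (ltnW (ltn_expl r (ltnSn 1))))//.
  exact: leq_trans (leq_addl _ _) rr.
have xle : M%:R * (pi *+ 2) / N%:R <= x0.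
  rewrite ler_pdivrMr// [x0 * _]mulrC -ler_pdivrMr// (le_trans (hr2 r.+1 _))//.
    exact: leq_trans (leq_trans (leq_addl r1 r2) (leq_addr M _)) (ltnW rr).
  by rewrite NE; exact: Nr2.
have xN : sample N t N = sample N t 0%N.
  have -> : sample N t N = f (Complex t 0 + ivec L).
    by rewrite /sample mulfK ?gt_eqF//; congr (f (Complex _ _)); rewrite ?addr0 ?add0r.
  by rewrite fper// /sample mulr0 mul0r.
have pb k : (k <= N)%N -> box a b L (Complex t (L * k%:R / N%:R)).
  move=> kN; split=> //=.
  rewrite ger0_norm ?divr_ge0 ?mulr_ge0 ?(ltW L0) ?ler0n//.
  by rewrite ler_pdivrMr// ler_wpM2l ?(ltW L0)// ler_nat.
have xB k : (k < N)%N -> normc (sample N t k.+1 - sample N t k) <= Af * (L / N%:R).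
  move=> kN; have [_ _ h _] := hAf _ _ (pb _ (ltnW kN)) (pb _ kN).
  rewrite (le_trans h)// ler_wpM2l//; set z := _ - _.
  have -> : z = ivec (L / N%:R).
    congr Complex; first by rewrite subrr.
    by rewrite -natr1 mulrDr mulrDl mulr1 addrAC subrr add0r.
  by rewrite normcRi ger0_norm// divr_ge0 ?ler0n ?(ltW L0).
pose G (m : int) := normc (dft N (sample N t) m) ^+ 2 / N%:R ^+ 2.
have pars : N%:R^-1 * (\sum_(k < N) normc (sample N t k) ^+ 2) =
    \sum_(j < N) G (j%:Z - H%:Z).
  rewrite -mulr_suml dft_parseval; field; rewrite gt_eqF//.
have window : \sum_(j < N) G (j%:Z - H%:Z) =
    \sum_(j < N | (j + M < H)%N || (H + M <= j)%N) G (j%:Z - H%:Z) +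
    \sum_(j < 2 * M) G (j%:Z - M%:Z).
  rewrite (bigID (fun j : 'I_N => (j + M < H)%N || (H + M <= j)%N))/=; congr (_ + _).
  by rewrite NH; exact: (@window_sum R G M H MH).
have tailB : \sum_(j < N | (j + M < H)%N || (H + M <= j)%N) G (j%:Z - H%:Z) <=
    Af ^+ 2 * L ^+ 2 / M%:R ^+ 2.
  rewrite -mulr_suml ler_pdivrMr ?exprn_gt0//.
  have := tail H M (sample N t) (Af * (L / N%:R)) M0 H0.
  rewrite -NH => /(_ xle xN xB) /le_trans; apply.
  rewrite le_eqVlt; apply/orP; left; apply/eqP; field.
  by rewrite !pnatr_eq0 -!lt0n M0 N0.
have tail0 : 0 <= \sum_(j < N | (j + M < H)%N || (H + M <= j)%N) G (j%:Z - H%:Z).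
  by rewrite sumr_ge0// => j _; rewrite divr_ge0 ?exprn_ge0 ?normc_ge0 ?ler0n.
have GE m : G m = expR (2 * freq m * t) * normc (mean L N (mode m) t) ^+ 2.
  by rewrite mode_dft.
rewrite pars window -addrA (le_trans (ler_normD _ _))// (ger0_norm tail0) lerD//.
rewrite -sumrB (le_trans (ler_norm_sum _ _ _))//.
rewrite (@le_trans _ _ (E / 2 ^+ r.+1))//; last first.
  rewrite ler_pdivrMr ?exprn_gt0// mulrC -ler_pdivrMr// hr1//.
  exact: leq_trans (leq_trans (leq_addr r2 r1) (leq_addr M _)) (ltnW rr).
rewrite /E mulr_suml ler_sum// => j _.
have -> : (j%:Z - M%:Z)%:~R * (2 / Q%:R * t) = 2 * freq (j%:Z - M%:Z) * t.
  by rewrite /freq; ring.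
rewrite GE [c _ * _]mulrC -mulrBr normrM ger0_norm ?expR_ge0// -[leRHS]mulrA.
by rewrite ler_wpM2l ?expR_ge0// NE.
Qed.

End FourierCoefficients.

(** * The one-dimensional Hausdorff measure of curves *)

Section Diameter.
Context {R : realType}.
Implicit Types (A E : set R[i]) (V : (set R[i])^nat).

Lemma diameter_ge0 A : (0 <= diameter A)%E.
Proof. by apply: ereal_sup_ubound; right. Qed.

Lemma diameter_le A (r : R) : 0 <= r ->
  (forall z w, A z -> A w -> normc (z - w) <= r) -> (diameter A <= r%:E)%E.
Proof.
move=> r0 h; apply: ge_ereal_sup => _ [[z Az [w Aw <-]]|->]; rewrite lee_fin//.
exact: h.
Qed.

Lemma normc_le_diameter A z w : A z -> A w -> ((normc (z - w))%:E <= diameter A)%E.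
Proof. by move=> Az Aw; apply: ereal_sup_ubound; left; exists z => //; exists w. Qed.

Lemma diameter_set0 : diameter (set0 : set R[i]) = 0%E.
Proof.
by apply/eqP; rewrite eq_le diameter_ge0 andbT; apply: diameter_le => // ? ? [].
Qed.

Lemma hausdorff1_pre_le (d : R) E (s : seq (set R[i])) :
  (forall z, E z -> exists2 A, A \in s & A z) ->
  (forall A, A \in s -> (diameter A <= d%:E)%E) -> 0 <= d ->
  (hausdorff1_pre d E <= \sum_(A <- s) diameter A)%E.
Proof.
move=> Es sd d0; apply: ge_ereal_inf.
exists (\sum_(0 <= k <oo) diameter (nth set0 s k))%E.
  exists (nth set0 s) => //; split.
    move=> z /Es[A /(nthP set0)[k _ <-] Az]; by exists k.
  move=> k; have [ks|ks] := ltnP k (size s); first by apply: sd; exact: mem_nth.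
  by rewrite nth_default// diameter_set0 lee_fin.
rewrite (nneseries_split 0%N (size s)) => [|k _]; last exact: diameter_ge0.
rewrite add0n eseries0 => [|k ks _]; last by rewrite nth_default// diameter_set0.
by rewrite adde0 (big_nth set0).
Qed.

Lemma le_hausdorff1_pre (d : R) E (x : \bar R) :
  (forall V, E `<=` \bigcup_k V k -> (forall k, (diameter (V k) <= d%:E)%E) ->
    (x <= \sum_(0 <= k <oo) diameter (V k))%E) -> (x <= hausdorff1_pre d E)%E.
Proof. by move=> h; apply: le_ereal_inf_tmp => _ [V [EV Vd] <-]; exact: h. Qed.

Lemma hausdorff1_pre_le_plane_length (d : R) E : 0 < d ->
  (hausdorff1_pre d E <= plane_length E)%E.
Proof. by move=> d0; apply: ereal_sup_ubound; exists d. Qed.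

Lemma plane_length_le E (x : \bar R) :
  (forall d : R, 0 < d -> (hausdorff1_pre d E <= x)%E) -> (plane_length E <= x)%E.
Proof. by move=> h; apply: ge_ereal_sup => _ [d d0 <-]; exact: h. Qed.

Lemma lipschitz_IVT (f : R -> R) (u v C z : R) : u <= v ->
  (forall x y, u <= x <= v -> u <= y <= v -> `|f y - f x| <= C * `|y - x|) ->
  f u <= z <= f v -> exists2 c, u <= c <= v & f c = z.
Proof.
move=> uv fC fz.
pose g x := f (Num.max u (Num.min v x)).
have clamp x : u <= Num.max u (Num.min v x) <= v.
  by rewrite le_max lexx ge_max uv ge_min lexx.
have clamp_lip x y :
    `|Num.max u (Num.min v y) - Num.max u (Num.min v x)| <= `|y - x|.
  wlog xy : x y / x <= y.
    by move=> h; have [/h//|/ltW/h] := leP x y; rewrite distrC (distrC x).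
  rewrite (@ger0_norm _ (y - x)) ?subr_ge0// ger0_norm.
    rewrite /Num.max /Num.min; do ! case: ifPn; rewrite -?leNgt => *; lra.
  rewrite subr_ge0 ge_max le_max lexx /= le_max le_min !ge_min lexx xy.
  by rewrite !orbT.
have gid x : u <= x <= v -> g x = f x.
  by move=> /andP[ux xv]; rewrite /g (min_idPr xv) (max_idPr ux).
have gc : continuous g.
  move=> x; apply/cvgrPdist_le => e e0; near=> y.
  have C1 : 0 < `|C| + 1 by rewrite ltr_wpDl.
  rewrite distrC (le_trans (fC _ _ (clamp x) (clamp y)))//.
  apply: (@le_trans _ _ ((`|C| + 1) * `|y - x|)).
    rewrite (le_trans (ler_wpM2r (normr_ge0 _) (ler_norm C)))//.
    rewrite (le_trans (ler_wpM2l (normr_ge0 _) (clamp_lip x y)))//.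
    by rewrite ler_wpM2r// lerDl.
  rewrite -ler_pdivlMl// mulrC distrC; near: y.
  by apply: (@cvgr_dist_le R R _ (nbhs x) _ id x) => //; rewrite divr_gt0.
have [|c] := @IVT R g u v z uv (continuous_subspaceT gc).
  by rewrite !gid ?lexx ?uv// ge_min le_max; case/andP: fz => -> ->; rewrite orbT.
by rewrite in_itv/= => cuv; rewrite gid// => <-; exists c.
Unshelve. all: by end_near. Qed.

(** The orthogonal projection onto the line of the chord does not increase
    diameters and maps the arc onto a set containing the chord, whose Lebesgue
    measure bounds the sum of the diameters of a cover from below. *)
Lemma chord_le_cover (g : R -> R[i]) (u v C d : R) V : u <= v ->
  (forall x y, u <= x <= v -> u <= y <= v -> normc (g y - g x) <= C * `|y - x|) ->
  (forall x, u <= x <= v -> exists k, V k (g x)) ->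
  (forall k, (diameter (V k) <= d%:E)%E) ->
  ((normc (g v - g u))%:E <= \sum_(0 <= k <oo) diameter (V k))%E.
Proof.
move=> uv gC gV Vd.
pose D := g v - g u; have D0 := normc_ge0 D.
rewrite -/D; have [->|Dn0] := eqVneq D 0.
  by rewrite normc0 nneseries_ge0// => *; exact: diameter_ge0.
have Dp : 0 < normc D by rewrite normc_gt0.
pose e : R[i] := conjc D * (normc D)^-1%:C.
have ne : normc e = 1.
  rewrite normcM normcR ger0_norm ?invr_ge0//.
  have -> : normc (conjc D) = normc D by case: (D) => x y /=; rewrite sqrrN.
  by rewrite divff ?gt_eqF.
pose p z := Re (z * e).
have pB z w : p z - p w = Re ((z - w) * e) by rewrite mulrBl ReB.
have p1 z w : `|p z - p w| <= normc (z - w).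
  by rewrite pB (le_trans (Re_le_normc _))// normcM ne mulr1.
have pD : p (g v) - p (g u) = normc D.
  rewrite pB -/D /e mulrA -normc_sqrE -rmorphM/= expr2 mulfK ?gt_eqF//.
pose f x := p (g x).
have fIVT z : f u <= z <= f v -> exists2 c, u <= c <= v & f c = z.
  apply: (lipschitz_IVT (C := C)) => // x y xuv yuv.
  exact: le_trans (p1 _ _) (gC _ _ xuv yuv).
pose W k := p @` V k.
have Wd k x y : W k x -> W k y -> x - y <= fine (diameter (V k)).
  move=> [z Vz <-] [w Vw <-]; rewrite (le_trans (ler_norm _))// (le_trans (p1 _ _))//.
  rewrite -lee_fin fineK ?normc_le_diameter//.
  by rewrite ge0_fin_numE ?diameter_ge0// (le_lt_trans (Vd k))// ltry.
have dfin k : (fine (diameter (V k)))%:E = diameter (V k).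
  by rewrite fineK// ge0_fin_numE ?diameter_ge0// (le_lt_trans (Vd k))// ltry.
pose J k : set R := if pselect (W k !=set0) then `[inf (W k), sup (W k)]%classic else set0.
have Wsup k x : W k x -> has_sup (W k).
  move=> Wx; split; first by exists x.
  by exists (x + fine (diameter (V k))) => y Wy; have := Wd _ _ _ Wy Wx; lra.
have Winf k x : W k x -> has_inf (W k).
  move=> Wx; split; first by exists x.
  by exists (x - fine (diameter (V k))) => y Wy; have := Wd _ _ _ Wx Wy; lra.
have WJ k : W k `<=` J k.
  move=> x Wx; rewrite /J; case: pselect => [nW|/= nW]; last by case: nW; exists x.
  rewrite /= in_itv/=; apply/andP; split.
    by apply: ge_inf => //; exact: (Winf _ _ Wx).2.
  by apply: ub_le_sup => //; exact: (Wsup _ _ Wx).2.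
have Jm k : measurable (J k).
  by rewrite /J; case: pselect => nW; [exact: measurable_itv|exact: measurable0].
have Jd k : (@lebesgue_measure R (J k) <= diameter (V k))%E.
  rewrite /J; case: pselect => [/= [x Wx]|nW]; last by rewrite measure0 diameter_ge0.
  rewrite lebesgue_measure_itv/=; case: ifP => _; last exact: diameter_ge0.
  rewrite -EFinB -dfin lee_fin.
  have h1 : sup (W k) <= inf (W k) + fine (diameter (V k)).
    apply: ge_sup; first by exists x.
    move=> y Wy; rewrite -lerBlDr; apply: lb_le_inf; first by exists x.
    by move=> z Wz; have := Wd _ _ _ Wy Wz; lra.
  by lra.
have sub : `[f u, f v]%classic `<=` \bigcup_k J k.
  move=> z /=; rewrite in_itv/= => /fIVT[c cuv <-].
  by have [k Vk] := gV _ cuv; exists k => //; apply: WJ; exists (g c).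
have fD : f v - f u = normc D by exact: pD.
have <- : @lebesgue_measure R `[f u, f v]%classic = (normc D)%:E.
  by rewrite lebesgue_measure_itv/= lte_fin -subr_gt0 fD Dp -EFinB fD.
have := measure_sigma_subadditive (@lebesgue_measure R) Jm (measurable_itv _) sub.
move=> /le_trans; apply.
apply: lee_nneseries => [k _ _|k _]; [exact: measure_ge0|exact: Jd].
Qed.

End Diameter.

Section Curves.
Context {R : realType}.
Variables (d : nat) (g s : 'I_d -> R -> R[i]) (L A : R).
Hypotheses (L0 : 0 < L) (A0 : 0 <= A).
Hypothesis gA : forall i x y, 0 <= x <= L -> 0 <= y <= L ->
  [/\ normc (s i x) <= A, normc (g i y - g i x) <= A * `|y - x| &
      normc (g i y - g i x - s i x * (y - x)%:C) <= A * `|y - x| ^+ 2].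

Definition curve_points : set R[i] :=
  [set z | exists i x, 0 <= x <= L /\ z = g i x].

Definition riemann_length N : R :=
  \sum_(i < d) \sum_(k < N) normc (s i (L * k%:R / N%:R)) * (L / N%:R).

Let node_in N k : (0 < N)%N -> (k <= N)%N -> 0 <= L * k%:R / N%:R <= L.
Proof.
move=> N0 kN; have N1 : 0 < N%:R :> R by rewrite ltr0n.
rewrite divr_ge0 ?mulr_ge0 ?(ltW L0) ?ler0n//=.
by rewrite ler_pdivrMr// ler_wpM2l ?(ltW L0)// ler_nat.
Qed.

Let nodeS N k : (0 < N)%N -> L * k.+1%:R / N%:R = L * k%:R / N%:R + L / N%:R.
Proof. by move=> N0; rewrite -natr1 mulrDr mulr1 mulrDl. Qed.

Let inode N (x : R) : (0 < N)%N -> 0 <= x <= L ->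
  exists2 k : 'I_N, true & L * k%:R / N%:R <= x <= L * k.+1%:R / N%:R.
Proof.
move=> N0 /andP[x0 xL]; have N1 : 0 < N%:R :> R by rewrite ltr0n.
pose j := Num.truncn (x * N%:R / L).
have /andP[j1 j2] : j%:R <= x * N%:R / L < j.+1%:R.
  by apply: truncn_itv; rewrite divr_ge0 ?mulr_ge0 ?ler0n ?(ltW L0).
rewrite ler_pdivlMr// in j1; rewrite ltr_pdivrMr// in j2.
have [jN|jN] := ltnP j N.
  exists (Ordinal jN) => //=; rewrite ler_pdivrMr// ler_pdivlMr//.
  by rewrite !(mulrC L) j1 ltW.
have pN : (N.-1 < N)%N by rewrite prednK.
exists (Ordinal pN) => //=; rewrite prednK// mulfK ?gt_eqF// xL andbT.
rewrite ler_pdivrMr// (le_trans _ j1)// mulrC ler_wpM2r ?(ltW L0)// ler_nat.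
by rewrite (leq_trans (leq_pred N)).
Qed.

Let in_arc N (k : 'I_N) x : (0 < N)%N ->
  L * k%:R / N%:R <= x <= L * k.+1%:R / N%:R -> 0 <= x <= L.
Proof.
move=> N0 /andP[x1 x2]; have /andP[a1 _] := node_in N0 (ltnW (ltn_ord k)).
by have /andP[_ a2] := node_in N0 (ltn_ord k); apply/andP; split; lra.
Qed.

(** The arcs of the subdivision into [N] parts cover the curves, and on each of
    them the curve is affine up to second order. *)
Lemma hausdorff1_pre_curve : exists2 C : R, 0 <= C & forall e : R, 0 < e ->
  exists N0, forall N, (N0 <= N)%N -> (0 < N)%N ->
    (hausdorff1_pre e curve_points <= (riemann_length N + C / N%:R)%:E)%E.
Proof.
exists (d%:R * (2 * A) * L ^+ 2); first by rewrite !mulr_ge0 ?exprn_ge0 ?(ltW L0).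
move=> e e0; pose N0 := (Num.truncn L + Num.truncn (3 * A * L / e)).+1.
exists N0 => N N0N Np; have N1 : 0 < N%:R :> R by rewrite ltr0n.
have LN : L <= N%:R.
  rewrite (le_trans (ltW (truncnS_gt L)))// ler_nat (leq_trans _ N0N)//.
  by rewrite ltnS leq_addr.
have eN : 3 * A * L / e <= N%:R.
  rewrite (le_trans (ltW (truncnS_gt _)))// ler_nat (leq_trans _ N0N)//.
  by rewrite ltnS leq_addl.
set h := L / N%:R.
have h0 : 0 < h by rewrite divr_gt0.
have h1 : h <= 1 by rewrite ler_pdivrMr// mul1r.
pose arc i (k : 'I_N) : set R[i] :=
  [set z | exists2 x, L * k%:R / N%:R <= x <= L * k.+1%:R / N%:R & z = g i x].
have arcd i k : (diameter (arc i k) <=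
    (normc (s i (L * k%:R / N%:R)) * h + 2 * A * h ^+ 2)%:E)%E.
  have n0 := normc_ge0 (s i (L * k%:R / N%:R)).
  apply: diameter_le.
    by have := mulr_ge0 n0 (ltW h0); have := mulr_ge0 A0 (exprn_ge0 2 (ltW h0)); lra.
  move=> _ _ [x kx ->] [y ky ->].
  set p := L * k%:R / N%:R in kx ky n0 *.
  rewrite (nodeS _ Np) -/p -/h in kx ky.
  have pL : 0 <= p <= L by exact: node_in (ltnW (ltn_ord k)).
  have xL : 0 <= x <= L.
    by apply: (in_arc (k := k) Np); rewrite (nodeS _ Np) -/p -/h.
  have yL : 0 <= y <= L.
    by apply: (in_arc (k := k) Np); rewrite (nodeS _ Np) -/p -/h.
  have [_ _ gx] := gA i pL xL; have [_ _ gy] := gA i pL yL.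
  move/andP: kx => [kx1 kx2]; move/andP: ky => [ky1 ky2].
  have -> : g i x - g i y = (g i x - g i p - s i p * (x - p)%:C) -
      (g i y - g i p - s i p * (y - p)%:C) + s i p * (x - y)%:C.
    by rewrite !rmorphB/=; ring.
  rewrite addrC (le_trans (le_normcD _ _))// lerD//.
    rewrite normcM normcR ler_wpM2l// ler_norml; apply/andP; split; lra.
  rewrite (le_trans (normcB _ _))//.
  have sq z : p <= z -> z <= p + h -> A * `|z - p| ^+ 2 <= A * h ^+ 2.
    move=> z1 z2; rewrite ler_wpM2l// lerXn2r ?nnegrE ?(ltW h0)//.
    by rewrite ger0_norm; lra.
  by have := sq _ kx1 kx2; have := sq _ ky1 ky2; lra.
have small i k : (diameter (arc i k) <= e%:E)%E.
  rewrite (le_trans (arcd i k))// lee_fin.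
  have [sA _ _] := gA i (node_in Np (ltnW (ltn_ord k))) (node_in Np (ltnW (ltn_ord k))).
  have : normc (s i (L * k%:R / N%:R)) * h <= A * h by rewrite ler_wpM2r ?(ltW h0).
  have : A * h ^+ 2 <= A * h.
    by rewrite ler_wpM2l// expr2 ler_piMl ?(ltW h0).
  have : 3 * A * h <= e.
    by move: eN; rewrite ler_pdivrMr// /h mulrA ler_pdivrMr// [e * _]mulrC.
  lra.
have cover z : curve_points z ->
    exists2 U, U \in [seq arc i k | i <- enum 'I_d, k <- enum 'I_N] & U z.
  move=> [i [x [xL ->]]]; have [k _ kx] := inode Np xL.
  exists (arc i k); last by exists x.
  by apply/allpairsP; exists (i, k); rewrite /= !mem_enum.
have smalls U : U \in [seq arc i k | i <- enum 'I_d, k <- enum 'I_N] ->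
    (diameter U <= e%:E)%E.
  by move=> /allpairsP[[i k] [_ _ ->]]; exact: small.
rewrite (le_trans (hausdorff1_pre_le cover smalls (ltW e0)))//.
rewrite big_allpairs_dep/= big_enum/=.
under eq_bigr do rewrite big_enum/=.
have -> : riemann_length N + d%:R * (2 * A) * L ^+ 2 / N%:R =
    \sum_(i < d) \sum_(k < N) (normc (s i (L * k%:R / N%:R)) * h + 2 * A * h ^+ 2).
  transitivity (\sum_(i < d) (\sum_(k < N) normc (s i (L * k%:R / N%:R)) * h +
      N%:R * (2 * A * h ^+ 2))).
    rewrite big_split/= sumr_const card_ord; congr (_ + _).
    rewrite -[RHS]mulr_natl /h; field.
    by rewrite gt_eqF.
  by apply: eq_bigr => i _; rewrite big_split/= sumr_const card_ord mulr_natl.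
by rewrite -sumEFin lee_sum// => i _; rewrite -sumEFin lee_sum.
Qed.

(** Shrinking the arcs of a subdivision makes them pairwise separated, so that a
    fine cover of the curves splits into covers of the single arcs, each of which
    is at least as long as the chord. *)
Lemma riemann_length_le_plane_length (N1 : nat) :
  (forall N, (N1 <= N)%N -> (0 < N)%N -> exists2 e : R, 0 < e &
    forall i i' (k k' : 'I_N) x x',
      L * k%:R / N%:R <= x <= L * k%:R / N%:R + (L / N%:R - L / N%:R / N%:R) ->
      L * k'%:R / N%:R <= x' <= L * k'%:R / N%:R + (L / N%:R - L / N%:R / N%:R) ->
      (i, k) != (i', k') -> e < normc (g i x - g i' x')) ->
  exists2 C : R, 0 <= C & forall N, (N1 <= N)%N -> (0 < N)%N ->
    ((riemann_length N - C / N%:R)%:E <= plane_length curve_points)%E.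
Proof.
move=> sep; exists (d%:R * (A * L + A * L ^+ 2)).
  by rewrite mulr_ge0// addr_ge0 ?mulr_ge0 ?exprn_ge0 ?(ltW L0).
move=> N NN1 Np; have Ng1 : 1 <= N%:R :> R by rewrite ler1n.
have N0 : 0 < N%:R :> R by rewrite ltr0n.
have [e e0 he] := sep N NN1 Np.
apply: le_trans (hausdorff1_pre_le_plane_length _ e0).
apply: le_hausdorff1_pre => V EV Vd.
set h := L / N%:R in he *.
have h0 : 0 < h by rewrite divr_gt0.
have hN : h / N%:R <= h by rewrite ler_pdivrMr// ler_peMr// ltW.
have hN0 : 0 <= h / N%:R by rewrite divr_ge0// ltW.
pose p (k : 'I_N) := L * k%:R / N%:R.
pose q k := p k + (h - h / N%:R).
have pq k : p k <= q k by rewrite lerDl subr_ge0.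
have arcL k x : p k <= x <= q k -> 0 <= x <= L.
  move=> /andP[x1 x2]; apply: (in_arc (k := k) Np).
  by rewrite (nodeS _ Np) -/(p k) -/h x1/= (le_trans x2)// lerD2l gerBl.
pose meets (a : 'I_d * 'I_N) n := exists2 x, p a.2 <= x <= q a.2 & V n (g a.1 x).
pose W a n : set R[i] := if pselect (meets a n) then V n else set0.
have chord a : ((normc (g a.1 (q a.2) - g a.1 (p a.2)))%:E <=
    \sum_(0 <= n <oo) diameter (W a n))%E.
  apply: (@chord_le_cover R (g a.1) (p a.2) (q a.2) A e) => //.
  - by move=> x y /arcL xL /arcL yL; have [] := gA a.1 xL yL.
  - move=> x xpq; have [n _ Vn] : (\bigcup_k V k) (g a.1 x).
      by apply: EV; exists a.1, x; split=> //; exact: arcL xpq.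
    exists n; rewrite /W; case: pselect => [//|/= nm]; case: nm; by exists x.
  - move=> n; rewrite /W; case: pselect => m; first exact: Vd.
    by rewrite diameter_set0 lee_fin ltW.
have single n : (\sum_(a : 'I_d * 'I_N) diameter (W a n) <= diameter (V n))%E.
  have [[a ma]|nm] := pselect (exists a, meets a n); last first.
    rewrite big1 ?diameter_ge0// => a _; rewrite /W; case: pselect => [/= m|m].
      by case: nm; exists a.
    exact: diameter_set0.
  rewrite (bigD1 a)//= big1 ?adde0 => [|b ba].
    by rewrite /W; case: pselect.
  rewrite /W; case: pselect => [/= mb|m]; last exact: diameter_set0.
  case: ma mb => x xa Vx [y yb Vy].
  have ab : (a.1, a.2) != (b.1, b.2).
    by rewrite -!surjective_pairing eq_sym.
  have := he _ _ _ _ _ _ xa yb ab.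
  have := le_trans (normc_le_diameter Vx Vy) (Vd n); rewrite lee_fin.
  by move=> /le_lt_trans h' /h'; rewrite ltxx.
have low : ((\sum_(a : 'I_d * 'I_N) normc (g a.1 (q a.2) - g a.1 (p a.2)))%:E <=
    \sum_(0 <= n <oo) diameter (V n))%E.
  rewrite -sumEFin (le_trans (lee_sum _ (fun a _ => chord a)))//.
  rewrite -nneseries_sum => [|a n _]; last exact: diameter_ge0.
  apply: lee_nneseries => [n _ _|n _]; last exact: single.
  by apply: sume_ge0 => a _; exact: diameter_ge0.
apply: le_trans low; rewrite lee_fin /riemann_length pair_big/=.
have -> : d%:R * (A * L + A * L ^+ 2) / N%:R =
    \sum_(a : 'I_d * 'I_N) (A * (h / N%:R) + A * h ^+ 2).
  rewrite sumr_const card_prod !card_ord -[RHS]mulr_natl natrM /h; field.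
  by rewrite gt_eqF.
rewrite -sumrB ler_sum// => -[i k] _ /=.
rewrite -/(p k) -/h.
have pL : 0 <= p k <= L by apply: (arcL k); rewrite lexx pq.
have qL : 0 <= q k <= L by apply: (arcL k); rewrite lexx pq.
have [sA _ gq] := gA i pL qL.
have qp : q k - p k = h - h / N%:R by rewrite /q addrAC subrr add0r.
have := normc_dist_le (s i (p k) * (q k - p k)%:C) (g i (q k) - g i (p k)).
rewrite [in leRHS]normc_distC => /le_trans/(_ gq).
rewrite normcM normcR qp ger0_norm ?subr_ge0//.
have : A * (h - h / N%:R) ^+ 2 <= A * h ^+ 2.
  by rewrite ler_wpM2l// lerXn2r ?nnegrE ?subr_ge0 ?(ltW h0)// gerBl.
have : normc (s i (p k)) * (h / N%:R) <= A * (h / N%:R) by rewrite ler_wpM2r.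
lra.
Qed.

End Curves.

(** * The length of a regular lemniscate *)

Section LemniscateLength.
Context {R : realType}.

Lemma cexp_polar (v : R[i]) : v != 0 ->
  exists2 x : R, 0 <= x <= pi *+ 2 & v = cexp (Complex (ln (normc v)) x).
Proof.
move=> v0; have n0 : 0 < normc v by rewrite normc_gt0.
pose c := Re v / normc v; pose s := Im v / normc v.
have cs : c ^+ 2 + s ^+ 2 = 1.
  by rewrite !expr_div_n -mulrDl -normc_sqr divff// expf_neq0 ?gt_eqF.
have c1 : -1 <= c <= 1.
  by rewrite -ler_norml -(@ler_pXn2r _ 2)// ?nnegrE// real_normK ?num_real//
    expr1n -cs lerDl sqr_ge0.
have [a1 a2] : 0 <= acos c /\ acos c <= pi by rewrite acos_ge0// acos_lepi.
have p0 := @pi_ge0 R.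
have ca : cos (acos c) = c by rewrite acosK// in_itv.
have sa : sin (acos c) = `|s|.
  rewrite sin_acos//; have -> : 1 - c ^+ 2 = s ^+ 2 by rewrite -cs addrAC subrr add0r.
  exact: sqrtr_sqr.
have vE x : cos x = c -> sin x = s -> v = cexp (Complex (ln (normc v)) x).
  move=> cx sx; rewrite /cexp /= lnK ?posrE// cx sx /c /s.
  by rewrite !(mulrC (normc v)) !divfK ?gt_eqF//; case: (v).
have [s0|s0] := leP 0 s.
  exists (acos c); first by rewrite a1/= (le_trans a2)// mulr2n lerDl.
  by apply: vE => //; rewrite sa ger0_norm.
exists (- acos c + pi *+ 2); first by rewrite mulr2n; apply/andP; split; lra.
by apply: vE; rewrite ?cosD2pi ?cosN// sinD2pi sinN sa ltr0_norm// opprK.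
Qed.

Lemma cos_le_away (e y : R) : 0 <= e -> e <= pi -> e <= y <= pi *+ 2 - e ->
  cos y <= cos e.
Proof.
move=> e0 ep /andP[ey ye]; have [yp|/ltW yp] := leP y pi; first exact: cos_mono.
have -> : cos y = cos (pi *+ 2 - y).
  by rewrite -cosN -(cosD2pi (- y)) addrC.
by move: ye; rewrite mulr2n => ye; apply: cos_mono => //; lra.
Qed.

Lemma normc_cexp_diff (t x x' : R) :
  normc (cexp (Complex t x) - cexp (Complex t x')) =
  expR t * normc (cexp (ivec (x - x')) - 1).
Proof.
have -> : cexp (Complex t x) = cexp (Complex t x') * cexp (ivec (x - x')).
  rewrite -cexpD; congr cexp; congr Complex; first by rewrite addr0.
  by rewrite addrC subrK.
by rewrite -[X in _ - X]mulr1 -mulrBr normcM normc_cexp.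
Qed.

Variables (P : {poly R[i]}) (I : set R).
Hypotheses (Pm : P \is monic) (Ps : (1 < size P)%N) (regI : regular_range P I).
Variables (d : nat) (Z q q' : 'I_d -> R[i] -> R[i]) (s : 'I_d -> 'I_d).
Hypothesis br : branches P I Z q q' s.
Variables (t : R) (It : I t).

Let L : R := pi *+ 2.
Let L0 : 0 < L. Proof. by rewrite /L pmulrn_lgt0// pi_gt0. Qed.

Let g i x := Z i (Complex t x).
Let v i x := q i (Complex t x) ^+ 2 * ivec 1.

Let It_strip x : strip I (Complex t x). Proof. exact: It. Qed.

Let Pg i x : P.[g i x] = cexp (Complex t x).
Proof. by apply/(branchP br _ (It_strip x)); exists i. Qed.

Let in_box x : 0 <= x <= L -> box t t L (Complex t x).
Proof. by move=> /andP[x0 xL]; split; rewrite /= ?lexx ?ger0_norm. Qed.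

Lemma log_level_curve : log_level P t = curve_points g L.
Proof.
apply/seteqP; split=> [z [Pz0 Pzt]|z [i [x [_ ->]]]].
  have [x xL Pz] := cexp_polar Pz0; rewrite Pzt in Pz.
  have [i zi] := (branchP br _ (It_strip x)).1 Pz.
  by exists i, x.
by split; rewrite -/(g i x) Pg ?cexp_neq0// normc_cexp /= expRK.
Qed.

Let curve_bounds : exists2 A : R, 0 <= A & forall i x y, 0 <= x <= L -> 0 <= y <= L ->
  [/\ normc (v i x) <= A, normc (g i y - g i x) <= A * `|y - x| &
      normc (g i y - g i x - v i x * (y - x)%:C) <= A * `|y - x| ^+ 2].
Proof.
have ex i := branch_diff br i L It It.
have ex' i : exists A, 0 <= A /\ forall w w',
    box t t L w -> box t t L w' -> [/\ normc (Z i w) <= A, normc (q i w ^+ 2) <= A,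
    normc (Z i w' - Z i w) <= A * normc (w' - w) &
    normc (Z i w' - Z i w - q i w ^+ 2 * (w' - w)) <= A * normc (w' - w) ^+ 2].
  by have [A A0 h] := ex i; exists A.
have [A hA] := choice ex'.
have A0 i : 0 <= A i by case: (hA i).
have Ale i : A i <= \sum_(j < d) A j by rewrite (bigD1 i)//= lerDl sumr_ge0.
exists (\sum_(j < d) A j) => [|i x y xL yL]; first by rewrite sumr_ge0.
have [_ h] := hA i; have [_ h2 h3 h4] := h _ _ (in_box xL) (in_box yL).
have yx : Complex t y - Complex t x = ivec (y - x) by congr Complex; rewrite subrr.
rewrite yx normcRi in h3 h4; split.
- by rewrite normcM normcRi normr1 mulr1 (le_trans h2).
- by rewrite (le_trans h3)// ler_wpM2r.
- by rewrite /v -mulrA -ivecE (le_trans h4)// ler_wpM2r ?exprn_ge0.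
Qed.

Let arcs_separated : exists N1, forall N, (N1 <= N)%N -> (0 < N)%N ->
  exists2 e : R, 0 < e & forall i i' (k k' : 'I_N) x x',
    L * k%:R / N%:R <= x <= L * k%:R / N%:R + (L / N%:R - L / N%:R / N%:R) ->
    L * k'%:R / N%:R <= x' <= L * k'%:R / N%:R + (L / N%:R - L / N%:R / N%:R) ->
    (i, k) != (i', k') -> e < normc (g i x - g i' x').
Proof.
have [A A0 hA] := curve_bounds.
have Punr := strip_unramified_regular Pm Ps regI L It It.
have cd := @strip_diff_cexp R I t t L It It.
have [r r0 sep] := fibre_separated Pm Ps cd Punr.
have [B hB] := fibre_bounded Pm Ps cd.
have gB i x : 0 <= x <= L -> normc (g i x) <= B.
  by move=> xL; apply: (hB _ (Complex t x)); rewrite ?Pg//; exact: in_box.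
have [D D0 hD] := @unif_diff_horner R [set z | normc z <= B] P B (fun _ h => h).
have D1 : 0 < D + 1 by rewrite ltr_wpDl.
have p2 := @pi_ge2 R.
exists (Num.truncn (2 * A * L / r)).+2 => N NN1 Np.
have N0 : 0 < N%:R :> R by rewrite ltr0n.
have N2 : 2 <= N%:R :> R by rewrite ler_nat (leq_trans _ NN1).
set h := L / N%:R; have h0 : 0 < h by rewrite divr_gt0.
have hr : A * h <= r / 2.
  have : 2 * A * L / r <= N%:R.
    by rewrite (le_trans (ltW (truncnS_gt _)))// ler_nat (leq_trans _ NN1).
  by rewrite ler_pdivrMr// /h mulrA ler_pdivrMr//; lra.
set e1 := h / N%:R; have e10 : 0 < e1 by rewrite divr_gt0.
have hN : h * N%:R = L by rewrite divfK ?gt_eqF.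
have e1h : e1 <= h by rewrite ler_pdivrMr// ler_peMr ?(ltW h0)//; lra.
have hpi : h <= pi by rewrite ler_pdivrMr// /L mulr2n; nra.
have e1p : e1 <= pi by exact: le_trans hpi.
pose ka := normc (cexp (ivec e1) - 1) : R.
have ka0 : 0 < ka.
  by rewrite normc_gt0 subr_eq0 cexp_ivec_neq1// e10/= -/L -hN mulrC; nra.
pose e := Num.min (r / 2) (expR t * ka / (2 * (D + 1))).
have e0 : 0 < e.
  by rewrite lt_min !divr_gt0 ?mulr_gt0 ?expR_gt0.
have node k : L * k%:R / N%:R = k%:R * h by rewrite /h; ring.
have inL (k : 'I_N) x : L * k%:R / N%:R <= x <= L * k%:R / N%:R + (h - e1) ->
    0 <= x <= L - e1.
  rewrite node => /andP[x1 x2].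
  have k0 : 0 <= k%:R * h by rewrite mulr_ge0 ?ler0n ?(ltW h0).
  have : k.+1%:R * h <= L by rewrite -hN mulrC ler_wpM2l ?(ltW h0)// ler_nat.
  by rewrite -natr1; move=> ?; apply/andP; split; lra.
have inL' x : 0 <= x <= L - e1 -> 0 <= x <= L.
  by move=> /andP[? ?]; apply/andP; split; lra.
(* arcs over disjoint parts of the circle are separated by the values of P *)
have apart i i' (k k' : 'I_N) x x' : (k < k')%N ->
    L * k%:R / N%:R <= x <= L * k%:R / N%:R + (h - e1) ->
    L * k'%:R / N%:R <= x' <= L * k'%:R / N%:R + (h - e1) ->
    e < normc (g i x - g i' x').
  move=> kk' xk xk'; have xL := inL _ _ xk; have xL' := inL _ _ xk'.
  have [_ _ lip _] := hD _ _ (gB i' _ (inL' _ xL')) (gB i _ (inL' _ xL)).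
  rewrite !Pg normc_cexp_diff in lip.
  have kale : ka <= normc (cexp (ivec (x - x')) - 1).
    rewrite -(@ler_pXn2r _ 2) ?nnegrE ?normc_ge0// !normc_cexp_ivec_sub1.
    rewrite ler_wpM2l// lerD2l lerN2 -cosN opprB; apply: cos_le_away => //; first exact: ltW.
    rewrite !node in xk xk'.
    move/andP: xk => [x1 x2]; move/andP: xk' => [x1' x2'].
    have : k.+1%:R * h <= k'%:R * h by rewrite ler_wpM2r ?(ltW h0)// ler_nat.
    rewrite -natr1; move/andP: xL => [? ?]; move/andP: xL' => [? ?] ?.
    by rewrite -/L; apply/andP; split; lra.
  rewrite ltNge; apply/negP => ge.
  have : normc (g i x - g i' x') <= expR t * ka / (2 * (D + 1)).
    by rewrite (le_trans ge)// ge_min lexx orbT.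
  rewrite ler_pdivlMr ?mulr_gt0// => ge'.
  have := ler_wpM2l (expR_ge0 t) kale.
  have : 0 < expR t * ka by rewrite mulr_gt0 ?expR_gt0.
  have := normc_ge0 (g i x - g i' x').
  lra.
exists e => // i i' k k' x x' xk xk' ik.
have [kk|kk|kk] := ltngtP k k'; first exact: apart kk xk xk'.
  by rewrite normc_distC; exact: apart kk xk' xk.
(* arcs over the same part of the circle lie in different sheets *)
have {}kk := val_inj kk; rewrite -{}kk in xk' ik.
have ii : i != i' by apply: contraNneq ik => ->.
have xL := inL' _ (inL _ _ xk); have xL' := inL' _ (inL _ _ xk').
have s1 : r < normc (g i x - g i' x).
  rewrite ltNge; apply/negP => /(sep _ _ _ (in_box xL) (Pg _ _) (Pg _ _)).
  by move=> /(branch_inj br (It_strip x)) /eqP; rewrite (negbTE ii).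
have [_ s2 _] := hA i' x' x xL' xL.
have xx : `|x - x'| <= h.
  move/andP: xk => [? ?]; move/andP: xk' => [? ?].
  by rewrite ler_norml; apply/andP; split; lra.
have := ler_wpM2l A0 xx.
have s3 := normc_split (g i' x') (g i x) (g i' x).
rewrite (normc_distC (g i' x')) in s3.
have : e <= r / 2 by rewrite ge_min lexx.
lra.
Qed.

(** A Riemann sum for the length: the speed of the branch [Z i] along the level
    is [|q i|^2]. *)
Definition lemniscate_sum N : R :=
  \sum_(i < d) \sum_(k < N) normc (q i (Complex t (L * k%:R / N%:R))) ^+ 2 * (L / N%:R).

Lemma lemniscate_length : exists2 C : R, 0 <= C &
  (forall e, 0 < e -> exists N0, forall N, (N0 <= N)%N -> (0 < N)%N ->
    (hausdorff1_pre e (log_level P t) <= (lemniscate_sum N + C / N%:R)%:E)%E) /\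
  exists N1, forall N, (N1 <= N)%N -> (0 < N)%N ->
    ((lemniscate_sum N - C / N%:R)%:E <= plane_length (log_level P t))%E.
Proof.
have [A A0 hA] := curve_bounds; have [N1 sep] := arcs_separated.
rewrite log_level_curve.
have lE N : riemann_length v L N = lemniscate_sum N.
  apply: eq_bigr => i _; apply: eq_bigr => k _.
  by rewrite /v normcM normcRi normr1 mulr1 normcX.
have [C1 C10 up] := hausdorff1_pre_curve L0 A0 hA.
have [C2 C20 low] := riemann_length_le_plane_length L0 A0 hA sep.
exists (C1 + C2); first exact: addr_ge0.
have CN C C' N : C <= C' -> C / N%:R <= C' / N%:R :> R.
  by move=> ?; rewrite ler_wpM2r ?invr_ge0 ?ler0n.
split.
  move=> e /up[N0 hN0]; exists N0 => N N0N Np.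
  rewrite (le_trans (hN0 _ N0N Np))// lee_fin lE lerD2l CN// lerDl//.
exists N1 => N N1N Np; rewrite (le_trans _ (low _ N1N Np))// lee_fin lE lerD2l.
by rewrite lerN2 CN// lerDr.
Qed.

End LemniscateLength.

(** * Expansion of the length in exponentials *)

Section LengthSeries.
Context {R : realType}.
Variables (P : {poly R[i]}) (I : set R).
Hypotheses (Pm : P \is monic) (Ps : (1 < size P)%N) (regI : regular_range P I).

Lemma sum_periodic (G : nat -> R) n Q : (forall k, G (k + n)%N = G k) ->
  \sum_(k < Q * n) G k = Q%:R * \sum_(k < n) G k.
Proof.
move=> Gn; have Gm m k : G (m * n + k)%N = G k.
  by elim: m => [|m IH]; rewrite ?mul0n// mulSn -addnA addnC Gn.
elim: Q => [|Q IH]; first by rewrite mul0n big_ord0 mul0r.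
rewrite mulSnr big_split_ord/= IH -natr1 mulrDl mul1r; congr (_ + _).
by apply: eq_bigr => k _; rewrite Gm.
Qed.

Lemma finite_bound (d : nat) (p : 'I_d -> nat -> Prop) :
  (forall i, exists r0, forall r, (r0 <= r)%N -> p i r) ->
  exists r0, forall r, (r0 <= r)%N -> forall i, p i r.
Proof.
move=> /choice[f hf]; exists (\max_(i < d) f i) => r fr i; apply: hf.
by rewrite (leq_trans _ fr)// leq_bigmax.
Qed.

Lemma inv_large (C e : R) : 0 < e -> exists N0, forall N, (N0 <= N)%N -> (0 < N)%N ->
  C / N%:R <= e.
Proof.
move=> e0; exists (Num.truncn (C / e)).+1 => N NN0 Np.
have h : C / e <= N%:R by rewrite (le_trans (ltW (truncnS_gt _)))// ler_nat.
by rewrite ler_pdivrMr ?ltr0n// mulrC -ler_pdivrMr.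
Qed.

(** The Riemann sums for the length over one turn are the square means of the
    [q k] over [Q] turns, because a turn only permutes the branches. Upper and
    lower estimates of the length by these sums then squeeze it onto the limit
    of the partial sums of the series. *)
Lemma lemniscate_series t0 : I t0 -> exists (s : int -> R) (c : R), [/\ 0 < c,
  forall m, 0 <= s m &
  forall t, I t -> exists l B : R, [/\ plane_length (log_level P t) = l%:E, 0 < l &
    forall M, (0 < M)%N ->
    `|l - \sum_(j < 2 * M) s (j%:Z - M%:Z) * expR ((j%:Z - M%:Z)%:~R * (c * t))| <=
      B / M%:R ^+ 2]].
Proof.
move=> It0; have Ii : is_interval I by case: regI.
have [d [Z [q [q' [sg [d0 br]]]]]] := branches_exist Pm Ps regI It0.
pose Q := (2 * d`!)%N.
have Q0 : (0 < Q)%N by rewrite muln_gt0 fact_gt0.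
have Q1 : Q%:R != 0 :> R by rewrite pnatr_eq0 -lt0n.
have p0 := @pi_gt0 R; have pp0 : 0 < pi *+ 2 :> R by rewrite pmulrn_lgt0.
have [a ha] := choice (fun i => fourier_coefficients Ii (branch_root_diff br i) Q0
  (branch_root_period br i) It0).
have a0 i m : 0 <= a i m by case: (ha i).
exists (fun m => pi *+ 2 * \sum_(i < d) a i m), (2 / Q%:R); split.
- by rewrite divr_gt0// lt_neqAle eq_sym Q1 ler0n.
- by move=> m; rewrite mulr_ge0 ?(ltW pp0)// sumr_ge0.
move=> t It.
pose A i N := N%:R^-1 *
  (\sum_(k < N) normc (q i (Complex t (pi *+ 2 *+ Q * k%:R / N%:R))) ^+ 2) : R.
pose S i M := \sum_(j < 2 * M) a i (j%:Z - M%:Z) *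
  expR ((j%:Z - M%:Z)%:~R * (2 / Q%:R * t)).
have exB i : exists B : R, 0 <= B /\ forall M (e : R), (0 < M)%N -> 0 < e ->
    exists r0, forall r N, (r0 <= r)%N -> N = (Q * 2 ^ r)%N ->
      `|A i N - S i M| <= B / M%:R ^+ 2 + e.
  by have [_ /(_ t It)[B B0 h]] := ha i; exists B.
have [B hB] := choice exB.
pose series M := \sum_(j < 2 * M) pi *+ 2 * (\sum_(i < d) a i (j%:Z - M%:Z)) *
  expR ((j%:Z - M%:Z)%:~R * (2 / Q%:R * t)).
have seriesE M : series M = pi *+ 2 * \sum_(i < d) S i M.
  rewrite /series /S exchange_big/= mulr_sumr; apply: eq_bigr => j _.
  by rewrite -mulrA mulr_suml.
pose lsum := lemniscate_sum q t.
have sumE r : lsum (2 ^ r)%N = pi *+ 2 * \sum_(i < d) A i (Q * 2 ^ r)%N.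
  have n1 : (2 ^ r)%:R != 0 :> R by rewrite pnatr_eq0 expn_eq0.
  pose G k := \sum_(i < d) normc (q i (Complex t (pi *+ 2 * k%:R / (2 ^ r)%:R))) ^+ 2.
  have Gper k : G (k + 2 ^ r)%N = G k.
    rewrite /G [RHS](reindex_inj (branch_perm_inj br)); apply: eq_bigr => i _.
    rewrite -(branch_root_turn br)//; congr (normc (q i _) ^+ 2); congr Complex.
      by rewrite addr0.
    by rewrite natrD mulrDr mulrDl mulfK.
  have -> : lsum (2 ^ r)%N = (\sum_(k < 2 ^ r) G k) * (pi *+ 2 / (2 ^ r)%:R).
    rewrite /lsum /lemniscate_sum exchange_big/= mulr_suml.
    by apply: eq_bigr => k _; rewrite mulr_suml.
  have -> : \sum_(i < d) A i (Q * 2 ^ r)%N =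
      (Q * 2 ^ r)%:R^-1 * (\sum_(k < Q * 2 ^ r) G k).
    rewrite /A -mulr_sumr exchange_big/=; congr (_ * _).
    apply: eq_bigr => k _; apply: eq_bigr => i _; congr (normc (q i (Complex t _)) ^+ 2).
    by rewrite natrM -[_ *+ Q]mulr_natl; field; rewrite Q1 n1.
  rewrite sum_periodic// natrM; field.
  by rewrite Q1 n1.
have [C C0 [up low]] := lemniscate_length Pm Ps regI br It.
have [N1 hlow] := low.
pose Bs := pi *+ 2 * \sum_(i < d) B i.
have Bs0 : 0 <= Bs.
  by rewrite mulr_ge0 ?(ltW pp0)// sumr_ge0// => i _; case: (hB i).
have approx M e : (0 < M)%N -> 0 < e -> exists r0, forall r, (r0 <= r)%N ->
    `|lsum (2 ^ r)%N - series M| <= Bs / M%:R ^+ 2 + e.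
  move=> M0 e0; pose e' := e / (pi *+ 2 * d%:R).
  have dR : 0 < d%:R :> R by rewrite ltr0n.
  have e'0 : 0 < e' by rewrite divr_gt0// mulr_gt0.
  have [r0 hr0] := @finite_bound d (fun i r =>
    `|A i (Q * 2 ^ r)%N - S i M| <= B i / M%:R ^+ 2 + e')
    (fun i => let: conj _ h := hB i in
      let: ex_intro r0 h' := h M e' M0 e'0 in
      ex_intro _ r0 (fun r r0r => h' r _ r0r erefl)).
  exists r0 => r r0r; rewrite sumE seriesE -mulrBr -sumrB normrM (ger0_norm (ltW pp0)).
  rewrite (@le_trans _ _ (pi *+ 2 * \sum_(i < d) (B i / M%:R ^+ 2 + e')))//.
    rewrite ler_wpM2l ?(ltW pp0)// (le_trans (ler_norm_sum _ _ _))// ler_sum// => i _.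
    exact: hr0.
  rewrite big_split/= sumr_const card_ord -mulr_suml mulrDr mulrA lerD2l.
  suff -> : pi *+ 2 * (e' *+ d) = e by [].
  have cancel (x y z : R) : x != 0 -> y != 0 -> x * (z / (x * y) * y) = z.
    by move=> x0 y0; field; rewrite x0 y0.
  by rewrite -[e' *+ d]mulr_natr cancel ?gt_eqF.
have large N0 : exists r0, forall r, (r0 <= r)%N -> (N0 <= 2 ^ r)%N.
  by exists N0 => r /leq_trans; apply; exact: ltnW (ltn_expl r (ltnSn 1)).
have upper M e : (0 < M)%N -> 0 < e ->
    (plane_length (log_level P t) <= (series M + Bs / M%:R ^+ 2 + e)%:E)%E.
  move=> M0 e0; have e2 : 0 < e / 2 by rewrite divr_gt0.
  apply: plane_length_le => dl dl0.
  have [Nu hNu] := up _ dl0; have [Nc hNc] := inv_large C e2.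
  have [r1 hr1] := approx _ _ M0 e2; have [r2 hr2] := large (Nu + Nc)%N.
  pose r := (r1 + r2)%N.
  have h1 := hr1 r (leq_addr _ _); have h2 := hr2 r (leq_addl _ _).
  have n0 : (0 < 2 ^ r)%N by rewrite expn_gt0.
  rewrite (le_trans (hNu _ (leq_trans (leq_addr _ _) h2) n0))// lee_fin -/lsum.
  have := hNc _ (leq_trans (leq_addl _ _) h2) n0.
  by move: h1; rewrite ler_norml => /andP[_ h1]; lra.
have lower M e : (0 < M)%N -> 0 < e ->
    ((series M - Bs / M%:R ^+ 2 - e)%:E <= plane_length (log_level P t))%E.
  move=> M0 e0; have e2 : 0 < e / 2 by rewrite divr_gt0.
  have [Nc hNc] := inv_large C e2.
  have [r1 hr1] := approx _ _ M0 e2; have [r2 hr2] := large (N1 + Nc)%N.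
  pose r := (r1 + r2)%N.
  have h1 := hr1 r (leq_addr _ _); have h2 := hr2 r (leq_addl _ _).
  have n0 : (0 < 2 ^ r)%N by rewrite expn_gt0.
  rewrite (le_trans _ (hlow _ (leq_trans (leq_addr _ _) h2) n0))// lee_fin -/lsum.
  have := hNc _ (leq_trans (leq_addl _ _) h2) n0.
  by move: h1; rewrite ler_norml => /andP[h1 _]; lra.
have lfin : plane_length (log_level P t) \is a fin_num.
  rewrite fin_numE; apply/andP; split; apply/eqP => e.
    by have := lower 1%N 1 isT ltr01; rewrite e.
  by have := upper 1%N 1 isT ltr01; rewrite e.
pose l := fine (plane_length (log_level P t)).
have lE : plane_length (log_level P t) = l%:E by rewrite fineK.
exists l, Bs; split=> //.
  have [m m0 hm] := branch_speed br (Ordinal d0) (pi *+ 2) It It.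
  have m1 : 0 < pi *+ 2 * m / 2 by rewrite divr_gt0 ?mulr_gt0.
  have [Nc hNc] := inv_large C m1.
  pose N := (N1 + Nc).+1.
  have Np : 0 < N%:R :> R by rewrite ltr0n.
  have := hlow N (leq_trans (leq_addr _ _) (leqnSn _)) isT; rewrite lE lee_fin -/lsum.
  have := hNc N (leq_trans (leq_addl _ _) (leqnSn _)) isT.
  have : pi *+ 2 * m <= lsum N.
    rewrite /lsum /lemniscate_sum (bigD1 (Ordinal d0))//= ler_wpDr//.
      apply: sumr_ge0 => i _; apply: sumr_ge0 => k _.
      by rewrite mulr_ge0 ?exprn_ge0 ?normc_ge0// divr_ge0 ?ler0n// ltW.
    have -> : pi *+ 2 * m = \sum_(k < N) m * (pi *+ 2 / N%:R).
      by rewrite sumr_const card_ord -[RHS]mulr_natl; field; rewrite gt_eqF.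
    apply: ler_sum => k _; rewrite ler_wpM2r//; first by rewrite divr_ge0 ?ler0n// ltW.
    apply: hm; split; rewrite /= ?lexx// ger0_norm.
      by rewrite ler_pdivrMr// ler_wpM2l ?(ltW pp0)// ler_nat ltnW.
    by rewrite divr_ge0 ?mulr_ge0 ?ler0n// ltW.
  lra.
move=> M M0; rewrite -/(series M) ler_norml lerBrDl lerBlDl; apply/andP; split.
  apply/ler_addgt0Pr => e e0; have := lower M e M0 e0; rewrite lE lee_fin; lra.
by apply/ler_addgt0Pr => e e0; have := upper M e M0 e0; rewrite lE lee_fin; lra.
Qed.

End LengthSeries.

(** * Stieltjes integrals of lattice step functions *)

Section LatticeStieltjes.
Context {R : realType}.
Variables (s : int -> R) (c : R).
Hypotheses (s0 : forall m, 0 <= s m) (c0 : 0 < c).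

(** The primitive of [s] vanishing at [0]; both tails of [s] may have infinite
    sum, so that it cannot be anchored at infinity. *)
Definition lattice_primitive (m : int) : R :=
  match m with
  | Posz n => \sum_(k < n) s k.+1%:Z
  | Negz n => - \sum_(k < n.+1) s (- k%:Z)
  end.

Lemma lattice_primitiveS m : lattice_primitive (m + 1) = lattice_primitive m + s (m + 1).
Proof.
case: m => [n|n].
  have -> : n%:Z + 1 = n.+1%:Z by lia.
  by rewrite /= big_ord_recr.
case: n => [|n].
  have -> : Negz 0 + 1 = 0 by lia.
  by rewrite /= big_ord0 big_ord_recl big_ord0 addr0 oppr0 addNr.
have -> : Negz n.+1 + 1 = Negz n by lia.
rewrite /= [in RHS]big_ord_recr/= opprD -addrA -[LHS]addr0; congr (_ + _).
by rewrite NegzE addNr.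
Qed.

Lemma le_lattice_primitive : {homo lattice_primitive : m n / m <= n}.
Proof.
move=> m n mn; have [k ->] : exists k : nat, n = m + k%:Z.
  by exists `|n - m|%N; lia.
elim: k => [|k IH]; first by rewrite addr0.
have -> : m + k.+1%:Z = m + k%:Z + 1 by lia.
by rewrite lattice_primitiveS (le_trans IH)// lerDl.
Qed.

Definition lattice_step (x : R) : R := lattice_primitive (Num.floor (x / c)).

Lemma lattice_step_nd : {homo lattice_step : x y / x <= y}.
Proof.
move=> x y xy; apply: le_lattice_primitive; apply: le_floor.
by rewrite ler_pM2r// invr_gt0.
Qed.

Lemma lattice_stepE (m : int) x : m%:~R * c <= x < (m + 1)%:~R * c ->
  lattice_step x = lattice_primitive m.
Proof.
move=> /andP[mx xm]; congr lattice_primitive; apply: floor_def.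
by rewrite ler_pdivlMr// mx ltr_pdivrMr.
Qed.

Lemma right_limit_lattice_step x : right_limit lattice_step_nd x = lattice_step x.
Proof.
pose m := Num.floor (x / c).
have /andP[mx xm] : m%:~R * c <= x < (m + 1)%:~R * c.
  by rewrite -ler_pdivlMr// floor_le -ltr_pdivrMr// floorD1_gt.
apply/cvg_lim => //.
have h : \forall y \near x^'+, lattice_step y = lattice_step x.
  near=> y; rewrite (lattice_stepE (m := m)) ?(@lattice_stepE m x) ?mx//.
  apply/andP; split; last by near: y; exact: nbhs_right_lt.
  by rewrite (le_trans mx)// ltW//; near: y; exact: nbhs_right_gt.
by apply: cvg_near_cst.
Unshelve. all: by end_near. Qed.

Let mu := lebesgue_stieltjes_measure (right_limit lattice_step_nd).

Let mu_itv (a b : R) : a <= b -> mu `]a, b]%classic = (lattice_step b - lattice_step a)%:E.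
Proof.
move=> ab; rewrite /mu /lebesgue_stieltjes_measure /measure_extension/=.
rewrite measurable_mu_extE/=; last exact: is_ocitv.
by rewrite wlength_itv_bnd// !right_limit_lattice_step.
Qed.

Let gap (m : int) : set R := `]m%:~R * c, (m + 1)%:~R * c[%classic.

Let node_le (m : int) : m%:~R * c <= (m + 1)%:~R * c.
Proof. by rewrite ler_pM2r// ler_int lerDl. Qed.

Let step_node (m : int) : lattice_step (m%:~R * c) = lattice_primitive m.
Proof. by apply: lattice_stepE; rewrite lexx/= ltr_pM2r// ltr_int ltrDl. Qed.

(** The gap is exhausted by intervals on which the step function is constant. *)
Let mu_gap m : mu (gap m) = 0%E.
Proof.
apply/eqP; rewrite eq_le measure_ge0 andbT.
pose b k := (m + 1)%:~R * c - c / k.+1%:R.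
pose F k : set R := `]m%:~R * c, b k]%classic.
have mb k : m%:~R * c <= b k.
  rewrite /b rmorphD/= mulrDl mul1r -addrA lerDl subr_ge0.
  by rewrite ler_pdivrMr// ler_peMr ?(ltW c0)// ler1n.
have Fm k : measurable (F k : set (measurableTypeR R)) by exact: measurable_itv.
have sub : gap m `<=` \bigcup_k F k.
  move=> x; rewrite /gap /= in_itv/= => /andP[mx xm].
  have e0 : 0 < (m + 1)%:~R * c - x by rewrite subr_gt0.
  exists (Num.truncn (c / ((m + 1)%:~R * c - x))) => //; rewrite /F /= in_itv/= mx/=.
  rewrite /b lerBrDl -lerBrDr ler_pdivrMr// mulrC -ler_pdivrMr//.
  exact/ltW/truncnS_gt.
have := measure_sigma_subadditive mu Fm (measurable_itv _) sub.
move=> /le_trans; apply; rewrite eseries0// => k _ _.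
transitivity (lattice_step (b k) - lattice_step (m%:~R * c))%:E; first exact: mu_itv.
rewrite step_node.
rewrite (lattice_stepE (m := m)) ?subrr// mb/= /b ltrBlDr ltrDl.
by rewrite divr_gt0.
Qed.

Section Integral.
Variable f : R -> R.
Hypotheses (f0 : forall x, 0 <= f x) (fm : measurable_fun [set: R] f).

Let fE (D : set R) : measurable_fun D (EFin \o f).
Proof. by apply/measurable_EFinP; exact: measurable_funTS. Qed.

Let cell (m k : int) : set R := `]m%:~R * c, k%:~R * c]%classic.

Let integral_piece (m : int) :
  (\int[mu]_(x in cell m (m + 1)%R) (f x)%:E)%E =
  (s (m + 1) * f ((m + 1)%:~R * c))%:E.
Proof.
set D : set R := cell _ _; set b := (m + 1)%:~R * c.
have mlt : m%:~R * c < b by rewrite ltr_pM2r// ltr_int ltrDl.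
have Dm : measurable (D : set (measurableTypeR R)) by exact: measurable_itv.
have gm : measurable (gap m : set (measurableTypeR R)) by exact: measurable_itv.
have bm : measurable ([set b] : set (measurableTypeR R)) by exact: measurable_set1.
have Dgap : D `\` gap m = [set b].
  apply/seteqP; split=> [x|x ->].
    rewrite /D /cell /gap /= !in_itv/= => -[/andP[mx xb] nx].
    apply/eqP; rewrite eq_le xb leNgt; apply/negP => xb'.
    by apply: nx; rewrite mx.
  by rewrite /D /cell /gap /= !in_itv/= mlt lexx ltxx andbF.
have mub : mu [set b] = (s (m + 1))%:E.
  have := ge0_negligible_integral gm Dm (measurable_cst 1%E) (fun _ _ => lee01) (mu_gap m).
  rewrite Dgap !integral_cst// !mul1e => e.
  transitivity (mu D); first exact: esym e.
  by rewrite (mu_itv (ltW mlt)) !step_node lattice_primitiveS addrAC subrr add0r.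
rewrite (ge0_negligible_integral gm Dm (@fE D) _ (mu_gap m)) => [|x _]; last first.
  by rewrite lee_fin.
rewrite Dgap (eq_integral (cst (f b)%:E)) => [|x]; last by rewrite inE => ->.
rewrite integral_cst//; transitivity ((f b)%:E * (s (m + 1))%:E)%E.
  by congr (_ * _)%E; exact: mub.
by rewrite -EFinM mulrC.
Qed.

Let integral_block (m : int) n :
  (\int[mu]_(x in cell m (m + n%:Z)%R) (f x)%:E)%E =
  (\sum_(j < n) s (m + j.+1%:Z) * f ((m + j.+1%:Z)%:~R * c))%:E.
Proof.
elim: n => [|n IH]; first by rewrite addr0 /cell set_itvoc0 integral_set0 big_ord0.
have -> : m + n.+1%:Z = m + n%:Z + 1 by lia.
rewrite big_ord_recr/= EFinD -IH.
have -> : m + n.+1%:Z = m + n%:Z + 1 by lia.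
set A : set (measurableTypeR R) := cell m (m + n%:Z).
set B : set (measurableTypeR R) := cell (m + n%:Z) (m + n%:Z + 1).
have mA : measurable A by exact: measurable_itv.
have mB : measurable B by exact: measurable_itv.
have AB : [disjoint A & B].
  apply/disj_setPLR => x; rewrite /A /B /cell /= !in_itv/= => /andP[_ xn] /andP[nx _].
  by rewrite ltNge xn in nx.
have f0' (x : R) : (A `|` B) x -> (0 <= (f x)%:E)%E by rewrite lee_fin.
rewrite -integral_piece -(ge0_integral_setU _ mA mB (@fE _) f0' AB).
congr (integral _ _ _); apply/seteqP; split=> x; rewrite /A /B /cell /= !in_itv/=.
  move=> /andP[mx xn]; have [xn'|xn'] := leP x ((m + n%:Z)%:~R * c).
    by left; rewrite mx.
  by right; rewrite xn.
move=> [/andP[mx xn]|/andP[mx xn]].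
  by rewrite mx (le_trans xn).
by rewrite xn andbT (le_lt_trans _ mx)// ler_pM2r// ler_int lerDl.
Qed.

(** The measure is carried by the lattice, so that the partial sums are the
    integrals over an increasing sequence of windows, which converge to the
    integral over the line by monotonicity. *)
Lemma stieltjes_integral_lattice (l B : R) :
  (forall M, (0 < M)%N ->
    `|l - \sum_(j < 2 * M) s (j%:Z - M%:Z) * f ((j%:Z - M%:Z)%:~R * c)| <=
    B / M%:R ^+ 2) ->
  stieltjes_integral lattice_step_nd f = l%:E.
Proof.
move=> hl; rewrite /stieltjes_integral -/mu.
pose lo (M : nat) : int := - M%:Z - 1.
pose D M : set R := cell (lo M) (lo M + (2 * M)%:Z).
have Dm M : measurable (D M : set (measurableTypeR R)) by exact: measurable_itv.
have DM : \bigcup_M D M = [set: R].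
  apply/seteqP; split=> // x _.
  pose k := Num.truncn `|x / c|; pose M := k.+2; exists M => //.
  have : `|x / c| < k.+1%:R by exact: truncnS_gt.
  have hiE : (lo M + (2 * M)%:Z)%:~R = k.+1%:R :> R.
    by rewrite pmulrn; congr (_ *~ _); rewrite /lo /M; lia.
  have loE : (lo M)%:~R = - k.+3%:R :> R.
    by rewrite pmulrn -mulrNz; congr (_ *~ _); rewrite /lo /M; lia.
  rewrite ltr_norml /D /cell /= in_itv/= hiE loE => /andP[x1 x2].
  rewrite -ltr_pdivlMr// -ler_pdivrMr// (ltW x2) andbT (lt_trans _ x1)//.
  by rewrite ltrN2 ltr_nat.
have Dnd : nondecreasing_seq D.
  move=> M M' MM'; apply/subsetPset => x; rewrite /D /cell /= !in_itv/= => /andP[x1 x2].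
  apply/andP; split.
    by rewrite (le_lt_trans _ x1)// ler_pM2r// ler_int /lo; lia.
  by rewrite (le_trans x2)// ler_pM2r// ler_int /lo; lia.
have cv := ge0_nondecreasing_set_cvg_integral (mu := mu) Dnd Dm
  (fun M => @fE (D M)) (fun i x _ => f0 x : (0 <= (f x)%:E)%E).
rewrite DM in cv.
have cv' : (\int[mu]_(x in D M) (f x)%:E)%E @[M --> \oo] --> l%:E.
  under eq_fun do rewrite integral_block.
  apply: cvg_EFin; first by near=> M.
  apply/cvgrPdist_le => e e0; near=> M.
  have M0 : (0 < M)%N by near: M; exact: nbhs_infty_gt.
  have -> : (fine \o (fun n : nat => (\sum_(j < 2 * n) s (lo n + j.+1%:Z) *
      f ((lo n + j.+1%:Z)%:~R * c))%:E)) M =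
      \sum_(j < 2 * M) s (j%:Z - M%:Z) * f ((j%:Z - M%:Z)%:~R * c).
    rewrite /=; apply: eq_bigr => j _.
    by have -> : lo M + j.+1%:Z = j%:Z - M%:Z by rewrite /lo; lia.
  rewrite (le_trans (hl M M0))//.
  have B0 : 0 <= B.
    by have := le_trans (normr_ge0 _) (hl 1%N isT); rewrite expr1n divr1.
  have M1 : 1 <= M%:R :> R by rewrite ler1n.
  rewrite (@le_trans _ _ (B / M%:R))//.
    by rewrite ler_wpM2l// lef_pV2 ?posrE ?exprn_gt0 ?ltr0n// expr2 ler_peMr ?ler0n.
  rewrite ler_pdivrMr ?ltr0n// mulrC -ler_pdivrMr//.
  near: M; exact: nbhs_infty_ger.
exact: (cvg_unique _ cv cv').
Unshelve. all: by end_near. Qed.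

End Integral.
End LatticeStieltjes.

(** * Exponential representation and logarithmic convexity *)

Section LogConvexity.
Context {R : realType}.

(** Young's inequality for the normalised exponentials, summed over the
    frequencies. *)
Lemma exponential_sum_log_convex (s : int -> R) (k : {i01 R}) (c x y lx ly lz Bx By Bz : R) :
  (forall m, 0 <= s m) -> 0 < lx -> 0 < ly -> 0 < lz ->
  let S t M := \sum_(j < 2 * M) s (j%:Z - M%:Z) * expR ((j%:Z - M%:Z)%:~R * (c * t)) in
  (forall M, (0 < M)%N -> `|lx - S x M| <= Bx / M%:R ^+ 2) ->
  (forall M, (0 < M)%N -> `|ly - S y M| <= By / M%:R ^+ 2) ->
  (forall M, (0 < M)%N -> `|lz - S (k%:num * x + (1 - k%:num) * y) M| <= Bz / M%:R ^+ 2) ->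
  ln lz <= k%:num * ln lx + (1 - k%:num) * ln ly.
Proof.
have k0 : 0 <= k%:num by []. have k0' : 0 <= 1 - k%:num by rewrite subr_ge0.
set a := k%:num in k0 k0' * => s0 lx0 ly0 lz0 S hx hy hz.
pose K := expR (a * ln lx + (1 - a) * ln ly); have K0 : 0 < K by exact: expR_gt0.
rewrite -ler_expR lnK ?posrE// -/K.
have term m : expR (m * (c * (a * x + (1 - a) * y))) <=
    K * (a * (expR (m * (c * x)) / lx) + (1 - a) * (expR (m * (c * y)) / ly)).
  have := convex_expR k (m * (c * x) - ln lx) (m * (c * y) - ln ly).
  rewrite !convRE -/a (expRD (m * (c * x))) (expRD (m * (c * y))) !expRN.
  rewrite !lnK ?posrE// => /(ler_wpM2l (ltW K0)).
  suff <- : expR (m * (c * (a * x + (1 - a) * y))) = K * expR (a * (m * (c * x) - ln lx) +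
    (1 - a) * (m * (c * y) - ln ly)) by [].
  by rewrite /K -expRD; congr expR; ring.
have SM M : S (a * x + (1 - a) * y) M <= K * (a * (S x M / lx) + (1 - a) * (S y M / ly)).
  rewrite /S !mulr_suml !mulr_sumr -big_split/= mulr_sumr ler_sum// => j _.
  have := ler_wpM2l (s0 (j%:Z - M%:Z)) (term (j%:Z - M%:Z)%:~R).
  move=> /le_trans; apply; set e1 := expR _; set e2 := expR _; set sj := s _.
  suff -> : sj * (K * (a * (e1 / lx) + (1 - a) * (e2 / ly))) =
    K * (a * (sj * e1 / lx) + (1 - a) * (sj * e2 / ly)) by [].
  by ring.
pose C := K * (a * (Bx / lx) + (1 - a) * (By / ly)) + Bz.
have CM M : (0 < M)%N -> lz <= K + C / M%:R ^+ 2.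
  move=> M0; have := hx M M0; have := hy M M0; have := hz M M0.
  rewrite !ler_norml => /andP[_ z1] /andP[y1 _] /andP[x1 _].
  have {}x1 : S x M / lx <= 1 + Bx / M%:R ^+ 2 / lx.
    by rewrite ler_pdivrMr// mulrDl mul1r divfK ?gt_eqF//; lra.
  have {}y1 : S y M / ly <= 1 + By / M%:R ^+ 2 / ly.
    by rewrite ler_pdivrMr// mulrDl mul1r divfK ?gt_eqF//; lra.
  have := ler_wpM2l (ltW K0) (lerD (ler_wpM2l k0 x1) (ler_wpM2l k0' y1)).
  have := SM M.
  have -> : C / M%:R ^+ 2 = K * (a * (Bx / M%:R ^+ 2 / lx) +
      (1 - a) * (By / M%:R ^+ 2 / ly)) + Bz / M%:R ^+ 2 by rewrite /C; ring.
  lra.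
apply/ler_addgt0Pr => e e0; have [N0 hN0] := inv_large `|C| e0.
have := CM N0.+1 isT => /le_trans; apply; rewrite lerD2l.
apply: le_trans (hN0 N0.+1 (leqnSn _) isT).
apply: (@le_trans _ _ (`|C| / N0.+1%:R ^+ 2)).
  by rewrite ler_wpM2r ?ler_norm// invr_ge0 exprn_ge0.
by rewrite ler_wpM2l// lef_pV2 ?posrE ?exprn_gt0// expr2 ler_peMr// ler1n.
Qed.

End LogConvexity.

Section RegularInterval.
Context {R : realType}.
Variables (P : {poly R[i]}) (nu : nat) (T : nat -> \bar R) (j : nat).
Hypotheses (enumT : critical_enumeration P nu T) (j_range : (1 <= j <= nu)%N).

(** A finite critical value is some [T i] with [i <= j - 1] or [i >= j], hence
    lies outside the interval. *)
Lemma regular_interval_regular : regular_range P (regular_interval T j).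
Proof.
case: enumT => T0 Tnu Tlt Tcrit; have /andP[j1 jnu] := j_range.
split.
- move=> x y /andP[x1 _] /andP[_ y2] z /andP[xz zy]; apply/andP; split.
    by rewrite (lt_le_trans x1)// lee_fin.
  by rewrite (le_lt_trans _ y2)// lee_fin.
- move=> a /andP[a1 a2]; have lt_a x : x < a -> (T j.-1 < x%:E)%E ->
      exists2 a', a' < a & regular_interval T j a'.
    move=> xa Tx; exists x => //; apply/andP; split=> //.
    by rewrite (lt_trans _ a2)// lte_fin.
  case E : (T j.-1) a1 => [r| |] //=; last first.
    by move=> _; apply: (lt_a (a - 1)); rewrite ?E ?ltNyr// ltrBlDr ltrDl.
  rewrite lte_fin => ra; apply: (lt_a ((r + a) / 2)); first lra.
  by rewrite E lte_fin; lra.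
- move=> b /andP[b1 b2]; have gt_b x : b < x -> (x%:E < T j)%E ->
      exists2 b', b < b' & regular_interval T j b'.
    move=> bx Tx; exists x => //; apply/andP; split=> //.
    by rewrite (lt_trans b1)// lte_fin.
  case E : (T j) b2 => [r| |] //=; last first.
    by move=> _; apply: (gt_b (b + 1)); rewrite ?E ?ltry// ltrDl.
  rewrite lte_fin => ra; apply: (gt_b ((b + r) / 2)); first lra.
  by rewrite E lte_fin; lra.
- move=> z Pz0 Pzn0 /andP[v1 v2].
  have : (EFin @` critical_values P) (ln (normc P.[z]))%:E.
    by exists (ln (normc P.[z])) => //; exists z.
  rewrite -Tcrit => -[i /andP[i0 inu] Ti].
  have [ij|ji] := ltnP i j.
    have : (T i <= T j.-1)%E.
      have [->//|ne] := eqVneq i j.-1.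
      apply/ltW/Tlt; rewrite (leq_trans (leq_pred j))// andbT ltn_neqAle ne/=.
      by rewrite -ltnS prednK.
    by rewrite Ti leNgt v1.
  have : (T j <= T i)%E.
    have [->//|ne] := eqVneq i j.
    by apply/ltW/Tlt; rewrite (ltnW inu) andbT ltn_neqAle eq_sym ne.
  by rewrite Ti leNgt v2.
Qed.

End RegularInterval.

Theorem corollary3 (R : realType) (P : {poly R[i]}) (n : nat)
  (P_monic : P \is monic) (n_ge2 : (2 <= n)%N) (deg_P : size P = n.+1)
  (nu : nat) (T : nat -> \bar R) (enumT : critical_enumeration P nu T)
  (j : nat) (j_range : (1 <= j <= nu)%N) :
  [/\ exists (sigma : R -> R) (sigma_nd : {homo sigma : x y / x <= y}),
        forall t, regular_interval T j t ->
          plane_length (log_level P t) =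
          stieltjes_integral sigma_nd (fun x => expR (x * t)),
      forall t, regular_interval T j t ->
        (0 < plane_length (log_level P t) < +oo)%E &
      convex_function (regular_interval T j : set R^o)
        (fun t => ln (fine (plane_length (log_level P t))))].
Proof.
have Ps : (1 < size P)%N by rewrite deg_P ltnS (ltn_trans _ n_ge2).
have regI := regular_interval_regular enumT j_range.
set I := regular_interval T j in regI *.
have [[t0 It0]|nI] := pselect (exists t, I t); last first.
  split.
  - by exists (fun=> 0), (fun _ _ _ => lexx _) => t It; case: nI; exists t.
  - by move=> t It; case: nI; exists t.
  - by move=> k x y; rewrite inE => Ix; case: nI; exists x.
have [s [c [c0 s0 hs]]] := lemniscate_series P_monic Ps regI It0.
split.
- exists (lattice_step s c), (lattice_step_nd s0 c0) => t It.
  have [l [B [-> _ lB]]] := hs t It.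
  apply: esym; apply: (@stieltjes_integral_lattice _ _ _ s0 c0 _ _ _ l B) => [x||M M0].
  + exact: expR_ge0.
  + apply: measurableT_comp; first exact: measurable_expR.
    by apply: measurable_funM => //; exact: measurable_cst.
  + apply: le_trans (lB M M0); rewrite le_eqVlt; apply/orP; left; apply/eqP.
    by congr `|_ - _|; apply: eq_bigr => i _; rewrite mulrA.
- by move=> t /hs[l [B [-> l0 _]]]; rewrite lte_fin l0 ltry.
move=> k x y; rewrite !inE => Ix Iy.
rewrite !convRE.
have Iz : I (k%:num * x + (1 - k%:num) * y).
  have [Ii _ _ _] := regI; have k0 : 0 <= k%:num by [].
  have k1 : k%:num <= 1 by [].
  have [xy|/ltW yx] := leP (x : R) y.
    by apply: (Ii _ _ Ix Iy); apply/andP; split; nra.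
  by apply: (Ii _ _ Iy Ix); apply/andP; split; nra.
have [lx [Bx [-> lx0 hx]]] := hs x Ix; have [ly [By [-> ly0 hy]]] := hs y Iy.
have [lz [Bz [-> lz0 hz]]] := hs _ Iz.
exact: exponential_sum_log_convex s0 lx0 ly0 lz0 hx hy hz.
Qed.
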